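(* (1) $\mathsf{CZF}+\mathsf{DCom}$ is equiconsistent with $\mathsf{CZF}+\mathsf{Pow}$. (2) $\mathsf{CZF}$ is equiconsistent with $\mathsf{CZF}+\mathsf{NDCom}$.
   Context: The logic of all theories is intuitionistic. $\mathsf{CZF}$ has axioms Extensionality, Pairing, Union, Infinity, the $\in$-Induction scheme, $\Delta_0$-Separation, Strong Collection (if $\forall x\in a\,\exists y\,\phi(x,y)$ then there is a set $b$ with $\forall x\in a\,\exists y\in b\,\phi(x,y)$ and $\forall y\in b\,\exists x\in a\,\phi(x,y)$), and Subset Collection (for all sets $a,b$ there is a set $c$ such that for all $u$, if $\forall x\in a\,\exists y\in b\,\phi(x,y,u)$ then there is $d\in c$ with $\forall x\in a\,\exists y\in d\,\phi(x,y,u)$ and $\forall y\in d\,\exists x\in a\,\phi(x,y,u)$). $\mathsf{Pow}$ is the Axiom of Power Set: for every set $a$, $\{b\mid b\subseteq a\}$ is a set. $\mathsf{DCom}$ (Axiom of Double Complement): $\forall x\,\exists y\,\forall z\,(\neg\neg(z\in x)\to z\in y)$. $\mathsf{NDCom}$ (Axiom of Non-Double Complement): $\exists x\,\forall y\,\neg[\forall z\,(\neg\neg(z\in x)\to z\in y)]$. Two theories are equiconsistent if the consistency of each implies the consistency of the other. *)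

(* Defs.v *)
From Stdlib Require Import Arith List Lia.
Import ListNotations.

(** First-order language of set theory, with de Bruijn indices: the only terms
    are variables, and [All], [Ex] bind index 0. *)
Inductive form : Type :=
| Mem : nat -> nat -> form
| Eq  : nat -> nat -> form
| Bot : form
| And : form -> form -> form
| Or  : form -> form -> form
| Imp : form -> form -> form
| All : form -> form
| Ex  : form -> form.

Definition Neg (p : form) : form := Imp p Bot.
Definition Iff (p q : form) : form := And (Imp p q) (Imp q p).

Declare Scope form_scope.
Delimit Scope form_scope with form.
Bind Scope form_scope with form.
Notation "x '∈' y" := (Mem x y) (at level 70) : form_scope.
Notation "x '≐' y" := (Eq x y) (at level 70) : form_scope.
Notation "'¬' p" := (Neg p) (at level 75, right associativity) : form_scope.
Notation "p '∧' q" := (And p q) (at level 80, right associativity) : form_scope.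
Notation "p '∨' q" := (Or p q) (at level 85, right associativity) : form_scope.
Notation "p '⇒' q" := (Imp p q) (at level 90, right associativity) : form_scope.
Notation "p '⇔' q" := (Iff p q) (at level 95, no associativity) : form_scope.
Local Open Scope form_scope.

(** Bounded quantifiers.  The bound [t] is an index of the context outside the
    quantifier; index 0 of [p] is the quantified variable. *)
Definition AllIn (t : nat) (p : form) : form := All (0 ∈ S t ⇒ p).
Definition ExIn (t : nat) (p : form) : form := Ex (0 ∈ S t ∧ p).

Definition up (r : nat -> nat) (n : nat) : nat :=
  match n with 0 => 0 | S m => S (r m) end.

Fixpoint ren (r : nat -> nat) (p : form) : form :=
  match p with
  | Mem x y => Mem (r x) (r y)
  | Eq x y => Eq (r x) (r y)
  | Bot => Bot
  | And p q => And (ren r p) (ren r q)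
  | Or p q => Or (ren r p) (ren r q)
  | Imp p q => Imp (ren r p) (ren r q)
  | All p => All (ren (up r) p)
  | Ex p => Ex (ren (up r) p)
  end.

Definition shift (p : form) : form := ren S p.

(** [inst k [x0; ...; xm] p] reads [p] as p(v0,...,vm; parameters): it replaces
    the indices 0,...,m by the variables x0,...,xm, and sends the i-th
    parameter (index m+1+i of [p]) to the variable k+i.  In the axiom schemes
    below, k is the number of quantifiers around the occurrence of [p], so that
    none of them captures a parameter. *)
Definition inst (k : nat) (xs : list nat) (p : form) : form :=
  ren (fun n => nth n xs (n - length xs + k)) p.

(** Instantiation of the outermost bound variable, as in the rules for [All]
    and [Ex]. *)
Definition subst (x : nat) (p : form) : form := inst 0 [x] p.

(** Least n such that all free indices of [p] are below n. *)
Fixpoint fv (p : form) : nat :=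
  match p with
  | Mem x y | Eq x y => Nat.max (S x) (S y)
  | Bot => 0
  | And p q | Or p q | Imp p q => Nat.max (fv p) (fv q)
  | All p | Ex p => Nat.pred (fv p)
  end.

Definition closure (p : form) : form := Nat.iter (fv p) All p.

(** Theories are meant to be sets of sentences; this is why the rule [prv_ax]
    needs no side condition in the presence of [prv_allI] and [prv_exE]. *)
Definition theory := form -> Prop.

Definition add (T : theory) (a : form) : theory := fun p => T p \/ p = a.

(** Natural deduction for intuitionistic first-order logic with equality. *)
Inductive prv (T : theory) : list form -> form -> Prop :=
| prv_ax G p : T p -> prv T G p
| prv_hyp G p : In p G -> prv T G p
| prv_botE G p : prv T G Bot -> prv T G p
| prv_andI G p q : prv T G p -> prv T G q -> prv T G (p ∧ q)
| prv_andE1 G p q : prv T G (p ∧ q) -> prv T G p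
| prv_andE2 G p q : prv T G (p ∧ q) -> prv T G q
| prv_orI1 G p q : prv T G p -> prv T G (p ∨ q)
| prv_orI2 G p q : prv T G q -> prv T G (p ∨ q)
| prv_orE G p q r :
    prv T G (p ∨ q) -> prv T (p :: G) r -> prv T (q :: G) r -> prv T G r
| prv_impI G p q : prv T (p :: G) q -> prv T G (p ⇒ q)
| prv_impE G p q : prv T G (p ⇒ q) -> prv T G p -> prv T G q
| prv_allI G p : prv T (map shift G) p -> prv T G (All p)
| prv_allE G p x : prv T G (All p) -> prv T G (subst x p)
| prv_exI G p x : prv T G (subst x p) -> prv T G (Ex p)
| prv_exE G p q :
    prv T G (Ex p) -> prv T (p :: map shift G) (shift q) -> prv T G q
| prv_eqI G x : prv T G (x ≐ x)
| prv_eqE G p x y : prv T G (x ≐ y) -> prv T G (subst x p) -> prv T G (subst y p).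

Definition consistent (T : theory) : Prop := ~ prv T [] Bot.

Definition equiconsistent (T1 T2 : theory) : Prop :=
  (consistent T1 -> consistent T2) /\ (consistent T2 -> consistent T1).

Inductive Delta0 : form -> Prop :=
| Delta0_mem x y : Delta0 (x ∈ y)
| Delta0_eq x y : Delta0 (x ≐ y)
| Delta0_bot : Delta0 Bot
| Delta0_and p q : Delta0 p -> Delta0 q -> Delta0 (p ∧ q)
| Delta0_or p q : Delta0 p -> Delta0 q -> Delta0 (p ∨ q)
| Delta0_imp p q : Delta0 p -> Delta0 q -> Delta0 (p ⇒ q)
| Delta0_all t p : Delta0 p -> Delta0 (AllIn t p)
| Delta0_ex t p : Delta0 p -> Delta0 (ExIn t p).

(** In the axioms, a comment [x y z] after a quantifier lists the variables in
    scope in its body by increasing index (index 0 first). *)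

Definition ax_ext : form :=
  All (All (* b a *)
    (All (* x b a *) (0 ∈ 2 ⇔ 0 ∈ 1) ⇒ 1 ≐ 0)).

Definition ax_pair : form :=
  All (All (Ex (All (* x c b a *) (0 ∈ 1 ⇔ 0 ≐ 3 ∨ 0 ≐ 2)))).

Definition ax_union : form :=
  All (Ex (All (* x u a *) (0 ∈ 1 ⇔ ExIn 2 (* y x u a *) (1 ∈ 0)))).

(** Some set contains the empty set and is closed under x ↦ x ∪ {x}. *)
Definition ax_inf : form :=
  Ex (* a *)
    (ExIn 0 (* e a *) (All (* z e a *) (¬ 0 ∈ 1))
     ∧ AllIn 0 (* x a *) (ExIn 1 (* y x a *)
         (All (* z y x a *) (0 ∈ 1 ⇔ 0 ∈ 2 ∨ 0 ≐ 2)))).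

(** Scheme formula: p(x). *)
Definition ax_set_ind (p : form) : form :=
  All (* a *) (AllIn 0 (* x a *) (inst 2 [0] p) ⇒ inst 1 [0] p)
  ⇒ All (* a *) (inst 1 [0] p).

(** Scheme formula: p(x). *)
Definition ax_sep (p : form) : form :=
  All (Ex (All (* x b a *) (0 ∈ 1 ⇔ 0 ∈ 2 ∧ inst 3 [0] p))).

(** Scheme formula: p(x, y). *)
Definition ax_strong_coll (p : form) : form :=
  All (* a *)
    (AllIn 0 (* x a *) (Ex (* y x a *) (inst 3 [1; 0] p))
     ⇒ Ex (* b a *)
         (AllIn 1 (* x b a *) (ExIn 1 (* y x b a *) (inst 4 [1; 0] p))
          ∧ AllIn 0 (* y b a *) (ExIn 2 (* x y b a *) (inst 4 [0; 1] p)))).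

(** Scheme formula: p(x, y, u). *)
Definition ax_subset_coll (p : form) : form :=
  All (All (Ex (All (* u c b a *)
    (AllIn 3 (* x u c b a *) (ExIn 3 (* y x u c b a *) (inst 6 [1; 0; 2] p))
     ⇒ ExIn 1 (* d u c b a *)
         (AllIn 4 (* x d u c b a *)
            (ExIn 1 (* y x d u c b a *) (inst 7 [1; 0; 3] p))
          ∧ AllIn 0 (* y d u c b a *)
              (ExIn 5 (* x y d u c b a *) (inst 7 [0; 1; 3] p))))))).

Inductive CZF : theory :=
| CZF_ext : CZF ax_ext
| CZF_pair : CZF ax_pair
| CZF_union : CZF ax_union
| CZF_inf : CZF ax_inf
| CZF_set_ind p : CZF (closure (ax_set_ind p))
| CZF_sep p : Delta0 p -> CZF (closure (ax_sep p))
| CZF_strong_coll p : CZF (closure (ax_strong_coll p))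
| CZF_subset_coll p : CZF (closure (ax_subset_coll p)).

Definition Pow : form :=
  All (Ex (All (* b y a *) (0 ∈ 1 ⇔ All (* z b y a *) (0 ∈ 1 ⇒ 0 ∈ 3)))).

Definition DCom : form :=
  All (Ex (All (* z y x *) (¬ ¬ 0 ∈ 2 ⇒ 0 ∈ 1))).

Definition NDCom : form :=
  Ex (All (* y x *) (¬ All (* z y x *) (¬ ¬ 0 ∈ 2 ⇒ 0 ∈ 1))).

Lemma fv_closure p : fv (closure p) = 0.
Proof.
assert (H : forall n, fv (Nat.iter n All p) = fv p - n).
{ induction n as [|n IH]; simpl; [lia | rewrite IH; lia]. }
unfold closure; rewrite H; lia.
Qed.

Lemma CZF_closed p : CZF p -> fv p = 0.
Proof. intros []; solve [reflexivity | apply fv_closure]. Qed.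

Lemma Pow_DCom_NDCom_closed : fv Pow = 0 /\ fv DCom = 0 /\ fv NDCom = 0.
Proof. repeat split. Qed.

(* Main.v *)
From Stdlib Require Import Arith List Lia.
From Stdlib Require Import FunctionalExtensionality PropExtensionality ProofIrrelevance.
Require Import Defs.
Import ListNotations.

(** The theorem rests on three constructions, all of them carried out inside a
    set theory that is given by its provable formulas.

    From a double complement to power sets
    ([power_of_double_complement]).  Every subset of 1 is not-not an element
    of 2, so a set that includes the double complement of 2 contains all truth
    values.  A subset of [a] sends each element [x] of [a] to the part of {x}
    that it contains; subset collection bounds such functions once the truth
    values form a set, and power sets follow.

    From Pow to DCom.  In CZF + Pow the connectives are reinterpreted by a
    modality J that is double negation on truth values given by a set and that
    asks for more elsewhere: J P says that P follows from the inhabitedness of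
    a set that is not empty ([jclosed], [J]).  Because this set is given,
    strong collection survives ([j_coll]), whereas double negation in front of
    all existential quantifiers would destroy it.  Subset collection is
    replaced by power sets and strong collection.  Membership becomes stable
    under double negation, so every set is its own double complement
    ([star_DCom]).

    From Pow to NDCom.  In CZF + Pow all sets serve as forcing conditions,
    ordered by inclusion.  A name lists its elements, each together with a
    condition that is needed for it to be one ([listed]).  The truth value of a bounded formula at a condition depends only on the
    intersection of the condition with a fixed set ([settles_slice]), and the
    subsets of this set form a set, which yields separation ([name_ex]).  There
    is a proper class of conditions and hence one of subsets of 1, but any
    given name only sees the conditions up to some set: no name includes the
    double complement of 2 ([kstr_NDCom]).

    In both models the elements that are listed in a set do not determine it,
    and extensionality is restored by passing to bisimilarity
    ([star_czf_minus], [star_extensional]).  So CZF + DCom and CZF + NDCom are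
    consistent relative to CZF + Pow, and CZF + Pow is consistent relative to
    CZF + DCom.  Finally, if CZF + NDCom is inconsistent, then so is CZF + Pow,
    and CZF refutes Pow; as a bound on the double complement of 2 would yield
    Pow, CZF then proves NDCom, and is inconsistent.

    To argue inside a theory, contexts are taken as worlds and formulas are
    evaluated to predicates on worlds ([prv_logic], [sem_proves]).  The two
    models change the notion of a truth value as well as the membership
    relation, so all of set theory is developed over an arbitrary [logic]. *)

(** * Renaming *)

Notation env := (nat -> nat).

Definition scons {A : Type} (x : A) (r : nat -> A) (n : nat) : A :=
  match n with 0 => x | S m => r m end.
Infix ".:" := scons (at level 55, right associativity).

Lemma scons_up (x : nat) (s r : env) :
  (fun n => (x .: s) (up r n)) = x .: (fun n => s (r n)).
Proof. apply functional_extensionality; now intros [|n]. Qed.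

Lemma ren_ext_fv p : forall r s, (forall n, n < fv p -> r n = s n) -> ren r p = ren s p.
Proof.
induction p; simpl; intros r s H; f_equal; auto with arith;
  try (apply H; lia);
  try (apply IHp1; intros; apply H; lia); try (apply IHp2; intros; apply H; lia);
  apply IHp; intros [|n] Hn; simpl; auto; f_equal; apply H; lia.
Qed.

Lemma ren_ren p : forall r s, ren s (ren r p) = ren (fun n => s (r n)) p.
Proof.
induction p; simpl; intros r s; f_equal; auto; rewrite IHp; f_equal;
  apply functional_extensionality; now intros [|n].
Qed.

Lemma ren_id p : ren (fun n => n) p = p.
Proof.
induction p; simpl; f_equal; auto; rewrite <- IHp at 2; f_equal;
  apply functional_extensionality; now intros [|n].
Qed.

Lemma ren_closed p r : fv p = 0 -> ren r p = p.
Proof.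
intros H; rewrite <- (ren_id p) at 2; apply ren_ext_fv; intros n Hn; lia.
Qed.

Lemma subst_ren x p : subst x p = ren (x .: fun n => n) p.
Proof.
unfold subst, inst; f_equal; apply functional_extensionality; intros [|n]; simpl; auto.
destruct n; simpl; lia.
Qed.

Lemma ren_subst r x p : ren r (subst x p) = subst (r x) (ren (up r) p).
Proof.
rewrite !subst_ren, !ren_ren; f_equal; apply functional_extensionality; now intros [|n].
Qed.

Lemma ren_shift r p : ren (up r) (shift p) = shift (ren r p).
Proof. unfold shift; now rewrite !ren_ren. Qed.

Lemma subst_ren_up x r p : subst x (ren (up r) p) = ren (x .: r) p.
Proof.
rewrite subst_ren, ren_ren; f_equal; apply functional_extensionality; now intros [|n].
Qed.

Lemma prv_weak T G p : prv T G p -> forall G', incl G G' -> prv T G' p.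
Proof.
induction 1; intros G' HG.
- now apply prv_ax.
- apply prv_hyp; auto.
- apply prv_botE; auto.
- apply prv_andI; auto.
- eapply prv_andE1; eauto.
- eapply prv_andE2; eauto.
- apply prv_orI1; auto.
- apply prv_orI2; auto.
- eapply prv_orE; [apply IHprv1 | apply IHprv2 | apply IHprv3]; auto;
    apply incl_cons; try (now left); apply incl_tl; auto.
- apply prv_impI, IHprv, incl_cons; [now left | apply incl_tl; auto].
- eapply prv_impE; eauto.
- apply prv_allI, IHprv, incl_map; auto.
- apply prv_allE; auto.
- eapply prv_exI; eauto.
- eapply prv_exE; [now apply IHprv1 | apply IHprv2].
  apply incl_cons; [now left | apply incl_tl, incl_map; auto].
- apply prv_eqI.
- eapply prv_eqE; eauto.
Qed.

Lemma map_shift_ren r (G : list form) :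
  map (ren (up r)) (map shift G) = map shift (map (ren r) G).
Proof. rewrite !map_map; apply map_ext; intros; apply ren_shift. Qed.

Lemma prv_ren T (HT : forall a, T a -> fv a = 0) G p :
  prv T G p -> forall r, prv T (map (ren r) G) (ren r p).
Proof.
induction 1; intros r0; simpl in *.
- rewrite ren_closed; auto; now apply prv_ax.
- apply prv_hyp, in_map; auto.
- apply prv_botE, IHprv.
- apply prv_andI; auto.
- eapply prv_andE1; eauto.
- eapply prv_andE2; eauto.
- apply prv_orI1; auto.
- apply prv_orI2; auto.
- eapply prv_orE; eauto.
- apply prv_impI; auto.
- eapply prv_impE; eauto.
- apply prv_allI; rewrite <- map_shift_ren; auto.
- rewrite ren_subst; apply prv_allE, IHprv.
- apply prv_exI with (r0 x); rewrite <- ren_subst; auto.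
- eapply prv_exE; [apply IHprv1|].
  rewrite <- map_shift_ren, <- ren_shift; apply IHprv2.
- apply prv_eqI.
- rewrite ren_subst; eapply prv_eqE; [apply IHprv1|].
  rewrite <- ren_subst; auto.
Qed.

Lemma fresh_var (G : list form) (r : env) n :
  exists x, (forall g, In g G -> fv g <= x) /\ (forall k, k < n -> r k < x).
Proof.
assert (A : exists x, forall g, In g G -> fv g <= x).
{ induction G as [|g G [x Hx]]; [exists 0; easy|].
  exists (fv g + x); intros h [<-|Hh]; [lia|]; specialize (Hx h Hh); lia. }
assert (B : exists x, forall k, k < n -> r k < x).
{ induction n as [|n [x Hx]]; [exists 0; lia|].
  exists (S (r n + x)); intros k Hk.
  destruct (Nat.eq_dec k n) as [->|]; [lia|].
  assert (k < n) by lia; specialize (Hx k); lia. }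
destruct A as [x Hx], B as [y Hy]; exists (x + y); split; intros.
- specialize (Hx g H); lia.
- specialize (Hy k H); lia.
Qed.

(** Exchanging a fresh variable with the bound one takes an instance back to
    the body of the quantifier, and shifts the context. *)
Lemma swap_fresh G r p x :
  (forall g, In g G -> fv g <= x) -> (forall k, k < fv p -> r k < x) ->
  let s n := if n =? x then 0 else S n in
  map (ren s) G = map shift G /\ ren s (ren (x .: r) p) = ren (up r) p.
Proof.
intros HG Hr s; split.
- apply map_ext_in; intros g Hg; apply ren_ext_fv; intros n Hn; unfold s.
  destruct (Nat.eqb_spec n x); auto; specialize (HG g Hg); lia.
- rewrite ren_ren; apply ren_ext_fv; intros [|n] Hn; unfold s; simpl.
  + now rewrite Nat.eqb_refl.
  + destruct (Nat.eqb_spec (r n) x); auto; specialize (Hr n); lia.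
Qed.

(** The quantifier rules with a universally quantified meta-variable in the
    place of an eigenvariable: a fresh variable is available in every context. *)
Lemma prv_all_intro T (HT : forall a, T a -> fv a = 0) G r p :
  (forall x, prv T G (ren (x .: r) p)) -> prv T G (ren r (All p)).
Proof.
intros H; destruct (fresh_var G r (fv p)) as (x & HG & Hr).
destruct (swap_fresh G r p x HG Hr) as [E1 E2].
simpl; apply prv_allI; rewrite <- E1, <- E2; apply prv_ren; auto.
Qed.

Lemma prv_ex_elim T (HT : forall a, T a -> fv a = 0) G r p q :
  prv T G (ren r (Ex p)) -> (forall x, prv T (ren (x .: r) p :: G) q) -> prv T G q.
Proof.
intros H1 H2; destruct (fresh_var (q :: G) r (fv p)) as (x & HG & Hr).
destruct (swap_fresh (q :: G) r p x HG Hr) as [E1 E2].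
injection E1 as E0 E1.
apply prv_exE with (ren (up r) p); [exact H1|].
rewrite <- E1, <- E2, <- E0; apply (prv_ren T HT _ _ (H2 x)).
Qed.

(** * Logics of closed predicates on a preorder *)

(** A complete Heyting algebra, presented as a class of closed predicates on
    worlds.  Arbitrary intersections and implications are all that is asked of
    it; the presentation by worlds turns reasoning in the algebra into reasoning
    at a variable world. *)
Record logic := Logic {
  world : Type;
  le : world -> world -> Prop;
  le_refl : forall w, le w w;
  le_trans : forall u v w, le u v -> le v w -> le u w;
  closed : (world -> Prop) -> Prop;
  closed_up : forall Q w w', closed Q -> le w w' -> Q w -> Q w';
  closed_all : forall (I : Type) (Q : I -> world -> Prop),
    (forall i, closed (Q i)) -> closed (fun w => forall i, Q i w);
  closed_imp : forall P Q : world -> Prop,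
    (forall w w', le w w' -> P w -> P w') -> closed Q ->
    closed (fun w => forall w', le w w' -> P w' -> Q w') }.

Record truth (L : logic) := Truth { holds : world L -> Prop; holds_closed : closed L holds }.
Arguments Truth {L} _ _.
Arguments holds {L} _ _.

Notation "w ⊩ P" := (holds P w) (at level 97, P at level 200, no associativity).

Lemma truth_ext L (P Q : truth L) : (forall w, (w ⊩ P) <-> (w ⊩ Q)) -> P = Q.
Proof.
destruct P as [P HP], Q as [Q HQ]; simpl; intros H.
assert (P = Q) as ->.
{ apply functional_extensionality; intros w; apply propositional_extensionality, H. }
f_equal; apply proof_irrelevance.
Qed.

Lemma holds_up L (P : truth L) w w' : le L w w' -> (w ⊩ P) -> (w' ⊩ P).
Proof. apply closed_up, holds_closed. Qed.

Section Connectives.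
Context {L : logic}.
Implicit Types P Q R : truth L.

Definition tAll {I : Type} (P : I -> truth L) : truth L :=
  Truth (fun w => forall i, w ⊩ P i) (closed_all L I _ (fun i => holds_closed L (P i))).
Definition tImp P Q : truth L :=
  Truth (fun w => forall w', le L w w' -> (w' ⊩ P) -> (w' ⊩ Q))
    (closed_imp L _ _ (holds_up L P) (holds_closed L Q)).
(** Existence, like disjunction and absurdity below, is given by its elimination
    rule. *)
Definition tEx {I : Type} (P : I -> truth L) : truth L :=
  tAll (fun Q => tImp (tAll (fun i => tImp (P i) Q)) Q).
Definition tAnd P Q : truth L := tAll (fun b : bool => if b then P else Q).
Definition tOr P Q : truth L := tEx (fun b : bool => if b then P else Q).
Definition tBot : truth L := tEx (fun f : False => match f with end).
Definition tIff P Q : truth L := tAnd (tImp P Q) (tImp Q P).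
Definition tNot P : truth L := tImp P tBot.

Lemma mp {P Q w} : (w ⊩ tImp P Q) -> (w ⊩ P) -> (w ⊩ Q).
Proof. intros H; apply H, le_refl. Qed.
Lemma and_i {P Q w} : (w ⊩ P) -> (w ⊩ Q) -> (w ⊩ tAnd P Q).
Proof. now intros ? ? [|]. Qed.
Lemma and_l {P Q w} : (w ⊩ tAnd P Q) -> (w ⊩ P).
Proof. intros H; exact (H true). Qed.
Lemma and_r {P Q w} : (w ⊩ tAnd P Q) -> (w ⊩ Q).
Proof. intros H; exact (H false). Qed.
Lemma iff_l {P Q w} : (w ⊩ tIff P Q) -> (w ⊩ P) -> (w ⊩ Q).
Proof. intros H; apply mp, (and_l H). Qed.
Lemma iff_r {P Q w} : (w ⊩ tIff P Q) -> (w ⊩ Q) -> (w ⊩ P).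
Proof. intros H; apply mp, (and_r H). Qed.
Lemma ex_i {I} {P : I -> truth L} {w} i : (w ⊩ P i) -> (w ⊩ tEx P).
Proof.
intros H Q w1 H1 HQ; apply (HQ i w1 (le_refl _ _)); now apply (holds_up _ _ _ _ H1).
Qed.
Lemma ex_e {I} {P : I -> truth L} {Q w} : (w ⊩ tEx P) ->
  (forall i w', le L w w' -> (w' ⊩ P i) -> (w' ⊩ Q)) -> (w ⊩ Q).
Proof. intros H HQ; exact (H Q w (le_refl _ _) HQ). Qed.
Lemma or_l {P Q w} : (w ⊩ P) -> (w ⊩ tOr P Q).
Proof. intros H; now apply (ex_i true). Qed.
Lemma or_r {P Q w} : (w ⊩ Q) -> (w ⊩ tOr P Q).
Proof. intros H; now apply (ex_i false). Qed.
Lemma or_e {P Q R w} : (w ⊩ tOr P Q) ->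
  (forall w', le L w w' -> (w' ⊩ P) -> (w' ⊩ R)) ->
  (forall w', le L w w' -> (w' ⊩ Q) -> (w' ⊩ R)) -> (w ⊩ R).
Proof. intros H H1 H2; apply (ex_e H); intros [|]; auto. Qed.
Lemma bot_e {Q w} : (w ⊩ tBot) -> (w ⊩ Q).
Proof. intros H; now apply (ex_e H). Qed.
End Connectives.

#[global] Arguments holds : simpl never.
#[global] Arguments tAll : simpl never.
#[global] Arguments tImp : simpl never.
#[global] Arguments tEx : simpl never.

Declare Scope truth_scope.
Delimit Scope truth_scope with truth.
Bind Scope truth_scope with truth.
Notation "'⊥'" := tBot : truth_scope.
Notation "'¬' p" := (tNot p) (at level 75, right associativity) : truth_scope.
Notation "p '∧' q" := (tAnd p q) (at level 80, right associativity) : truth_scope.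
Notation "p '∨' q" := (tOr p q) (at level 85, right associativity) : truth_scope.
Notation "p '⇒' q" := (tImp p q) (at level 90, right associativity) : truth_scope.
Notation "p '⇔' q" := (tIff p q) (at level 95, no associativity) : truth_scope.
Notation "'∀' x .. y , p" := (tAll (I := nat) (fun x => .. (tAll (I := nat) (fun y => p)) ..))
  (at level 96, x binder, y binder, right associativity) : truth_scope.
Notation "'∃' x .. y , p" := (tEx (I := nat) (fun x => .. (tEx (I := nat) (fun y => p)) ..))
  (at level 96, x binder, y binder, right associativity) : truth_scope.
Open Scope truth_scope.

(** Everything known at a world is moved to a later one, which replaces it: so
    only one world is in sight at any time, and hypotheses read as in ordinary
    intuitionistic logic. *)
Ltac move_to Hle :=
  match type of Hle with
  | le _ ?w ?w' =>
      repeat match goal with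
      | H : @holds ?L ?P w |- _ => apply (holds_up L P w w' Hle) in H
      end;
      try (clear Hle; clear w; rename w' into w)
  end.

Tactic Notation "imp" ident(H) :=
  let w' := fresh "w" in let Hle := fresh "Hle" in intros w' Hle H; move_to Hle.
Tactic Notation "imp" ident(H1) ident(H2) := imp H1; imp H2.
Tactic Notation "imp" ident(H1) ident(H2) ident(H3) := imp H1; imp H2; imp H3.

Tactic Notation "obtain" ident(x) ident(H) "from" constr(E) :=
  let w' := fresh "w" in let Hle := fresh "Hle" in
  refine (ex_e E _); try (is_var E; clear E); intros x w' Hle H; move_to Hle; cbv beta in H.

Tactic Notation "cases" hyp(H) :=
  let w' := fresh "w" in let Hle := fresh "Hle" in
  refine (or_e H _ _); clear H; intros w' Hle H; move_to Hle; cbv beta in H.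

(** Decomposition of the hypotheses and of the goal by the rules that lose no
    information. *)
Ltac dec_hyp :=
  match goal with
  | H : holds tBot _ |- holds _ _ => exact (bot_e H)
  | H : holds (tAnd ?P ?Q) ?w |- _ =>
      let H2 := fresh H in
      pose proof (and_r H) as H2; apply and_l in H; cbv beta in H, H2
  | H : holds (tEx _) ?w |- holds _ ?w =>
      let x := fresh "x" in let w' := fresh "w" in let Hle := fresh "Hle" in
      refine (ex_e H _); clear H; intros x w' Hle H; move_to Hle; cbv beta in H
  | H : holds (tOr ?P ?Q) ?w |- holds _ ?w =>
      let w' := fresh "w" in let Hle := fresh "Hle" in
      refine (or_e H _ _); clear H; intros w' Hle H; move_to Hle
  end.
Ltac dec_goal :=
  match goal with
  | |- holds (tIff _ _) _ => apply and_i
  | |- holds (tAnd _ _) _ => apply and_i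
  | |- holds (tAll _) _ => let x := fresh "x" in intros x; cbv beta
  | |- holds (tImp _ _) _ => let H := fresh "H" in imp H
  | |- holds (tNot _) _ => let H := fresh "H" in imp H
  end.
Ltac dec := repeat first [dec_hyp | dec_goal].
Ltac dech := repeat dec_hyp.
Ltac ands := repeat match goal with |- holds (tAnd _ _) _ => apply and_i end; auto.

(** * Set structures and their semantics *)

(** The elements are always the variables of the object language; only their
    membership and equality take different truth values. *)
Record structure (L : logic) := Structure { mem : nat -> nat -> truth L; equ : nat -> nat -> truth L }.
Arguments Structure {L} _ _.
Arguments mem {L} _ _ _.
Arguments equ {L} _ _ _.

Fixpoint sem {L} (S : structure L) (p : form) (r : env) : truth L :=
  match p with
  | Mem x y => mem S (r x) (r y)
  | Eq x y => equ S (r x) (r y)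
  | Bot => ⊥
  | And p q => sem S p r ∧ sem S q r
  | Or p q => sem S p r ∨ sem S q r
  | Imp p q => sem S p r ⇒ sem S q r
  | All p => ∀ x, sem S p (x .: r)
  | Ex p => ∃ x, sem S p (x .: r)
  end.

Lemma sem_ren {L} (S : structure L) p : forall s r,
  sem S (ren s p) r = sem S p (fun n => r (s n)).
Proof.
induction p; simpl; intros s r; auto; try (now rewrite IHp1, IHp2);
  f_equal; apply functional_extensionality; intros x; now rewrite IHp, scons_up.
Qed.

Record equality {L} (S : structure L) : Prop := {
  eq_refl_ : forall x w, w ⊩ equ S x x;
  eq_sym_ : forall x y w, (w ⊩ equ S x y) -> (w ⊩ equ S y x);
  eq_trans_ : forall x y z w, (w ⊩ equ S x y) -> (w ⊩ equ S y z) -> (w ⊩ equ S x z);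
  eq_mem_l : forall x y a w, (w ⊩ equ S x y) -> (w ⊩ mem S x a) -> (w ⊩ mem S y a);
  eq_mem_r : forall x a b w, (w ⊩ equ S a b) -> (w ⊩ mem S x a) -> (w ⊩ mem S x b) }.

Lemma sem_equ {L} {S : structure L} (HE : equality S) p : forall w r s,
  (forall n, w ⊩ equ S (r n) (s n)) -> (w ⊩ sem S p r) -> (w ⊩ sem S p s).
Proof.
induction p; simpl; intros w r s H.
- intros H1; apply (eq_mem_r S HE _ (r n0)); auto; apply (eq_mem_l S HE (r n)); auto.
- intros H1; apply (eq_trans_ S HE _ (r n0)); auto.
  apply (eq_trans_ S HE _ (r n)); auto; apply (eq_sym_ S HE); auto.
- auto.
- intros H1; dec; eauto.
- intros H1; refine (or_e H1 _ _); intros w' Hle H2; [apply or_l|apply or_r].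
  + apply (IHp1 w' r s); auto; intros k; apply (holds_up _ _ _ _ Hle), H.
  + apply (IHp2 w' r s); auto; intros k; apply (holds_up _ _ _ _ Hle), H.
- intros H1 w' Hle H2.
  assert (H' : forall k, w' ⊩ equ S (r k) (s k)) by (intros k; apply (holds_up _ _ _ _ Hle), H).
  apply (IHp2 w' r s); auto; apply H1; auto; apply (IHp1 w' s r); auto.
  intros k; apply (eq_sym_ S HE); auto.
- intros H1 x; apply (IHp w (x .: r)); auto; intros [|k]; simpl; auto; apply (eq_refl_ S HE).
- intros H1; refine (ex_e H1 _); intros x w' Hle H2; apply (ex_i x).
  apply (IHp w' (x .: r)); auto; intros [|k]; simpl.
  + apply (eq_refl_ S HE).
  + apply (holds_up _ _ _ _ Hle), H.
Qed.

(** The axioms are assumed at one world only: a proof from a further axiom can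
    then be used under that axiom as a hypothesis. *)
Theorem soundness {L} (S : structure L) (HE : equality S) T G p :
  prv T G p -> forall r w,
  (forall a, T a -> forall s, w ⊩ sem S a s) ->
  (forall g, In g G -> w ⊩ sem S g r) -> (w ⊩ sem S p r).
Proof.
assert (UT : forall w w', le L w w' -> (forall a, T a -> forall s, w ⊩ sem S a s) ->
             forall a, T a -> forall s, w' ⊩ sem S a s)
  by (intros w w' Hle H a Ha s; apply (holds_up _ _ _ _ Hle); auto).
assert (UG : forall w w' q r H, le L w w' -> (forall g, In g H -> w ⊩ sem S g r) ->
   (w' ⊩ sem S q r) -> forall g, In g (q :: H) -> w' ⊩ sem S g r)
  by (intros w w' q r H Hle HG Hq g [<-|Hg]; auto; apply (holds_up _ _ _ _ Hle); auto).
assert (UM : forall w x r H, (forall g, In g H -> w ⊩ sem S g r) ->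
   forall g, In g (map shift H) -> w ⊩ sem S g (x .: r)).
{ intros w x r H HG g Hg; apply in_map_iff in Hg; destruct Hg as (h & <- & Hh).
  unfold shift; rewrite sem_ren; now apply HG. }
induction 1; intros r0 w HT HG; simpl in *.
- auto.
- auto.
- apply bot_e, (IHprv r0); auto.
- apply and_i; auto.
- eapply and_l; eapply IHprv; eauto.
- eapply and_r; eapply IHprv; eauto.
- apply or_l; auto.
- apply or_r; auto.
- refine (or_e (IHprv1 r0 w HT HG) _ _); intros w' Hle Hp;
    [apply IHprv2 | apply IHprv3]; eauto.
- intros w' Hle Hp; apply IHprv; eauto.
- apply (mp (IHprv1 r0 w HT HG)); auto.
- intros x; apply IHprv; [auto | exact (UM w x r0 G HG)].
- rewrite subst_ren, sem_ren.
  replace (fun n => _) with (r0 x .: r0)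
    by (apply functional_extensionality; now intros [|n]).
  exact (IHprv r0 w HT HG (r0 x)).
- apply (ex_i (r0 x)); generalize (IHprv r0 w HT HG); rewrite subst_ren, sem_ren.
  replace (fun n => _) with (r0 x .: r0)
    by (apply functional_extensionality; now intros [|n]); auto.
- refine (ex_e (IHprv1 r0 w HT HG) _); intros x w' Hle Hp.
  specialize (IHprv2 (x .: r0) w'); unfold shift in IHprv2; rewrite sem_ren in IHprv2.
  apply IHprv2; eauto.
- apply (eq_refl_ S HE).
- generalize (IHprv2 r0 w HT HG); rewrite !subst_ren, !sem_ren; apply (sem_equ HE).
  intros [|n]; simpl; [auto | apply (eq_refl_ S HE)].
Qed.

(** * The logic of provability *)

Section Provability.
Variable T : theory.
Hypothesis HT : forall a, T a -> fv a = 0.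

(** A predicate is closed if it holds in every context proving all the formulas
    that follow from it there.  These predicates form the completion of the
    Lindenbaum algebra by cuts. *)
Definition prv_closed (Q : list form -> Prop) : Prop :=
  (forall G G', incl G G' -> Q G -> Q G') /\
  forall G, (forall p, (forall G', incl G G' -> Q G' -> prv T G' p) -> prv T G p) -> Q G.

Definition imps (G : list form) (p : form) : form := fold_right Imp p G.

Lemma imps_i G1 : forall G p, prv T (G1 ++ G) p -> prv T G (imps G1 p).
Proof.
induction G1 as [|a G1 IH]; simpl; intros G p H; auto.
apply prv_impI, IH, (prv_weak _ _ _ H); intros b.
simpl; rewrite !in_app_iff; simpl; tauto.
Qed.

Lemma imps_e G1 : forall G p, incl G1 G -> prv T G (imps G1 p) -> prv T G p.
Proof.
induction G1 as [|a G1 IH]; simpl; intros G p HG H; auto.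
apply incl_cons_inv in HG; apply IH; [tauto|].
apply prv_impE with a; auto; apply prv_hyp; tauto.
Qed.

Definition prv_logic : logic.
Proof.
refine (Logic (list form) (@incl form) (@incl_refl form) (@incl_tran form) prv_closed _ _ _).
- intros Q w w' [H _]; exact (H w w').
- intros I Q HQ; split.
  + intros G G' HG H i; now apply (proj1 (HQ i) G).
  + intros G H i; apply (proj2 (HQ i)); intros p Hp; apply H; auto.
- intros P Q HP HQ; split.
  + intros G G' HG H G2 HG2; apply H; now apply incl_tran with G'.
  + intros G H G1 HG1 HP1; apply (proj2 HQ); intros p Hp.
    apply (imps_e G1); [apply incl_refl|].
    apply (prv_weak _ G); auto; apply H; intros G' HG' H'; apply imps_i, Hp.
    * apply incl_appl, incl_refl.
    * apply H'; [apply incl_appr, incl_refl | exact (HP _ _ (incl_appl _ (incl_refl _)) HP1)].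
Defined.

Definition proves (p : form) : truth prv_logic.
Proof.
refine (@Truth prv_logic (fun G => prv T G p) _); split.
- intros G G' HG H; exact (prv_weak _ _ _ H _ HG).
- intros G H; apply H; auto.
Defined.

Definition prv_structure : structure prv_logic :=
  Structure (fun x y => proves (Mem x y)) (fun x y => proves (Eq x y)).

Lemma truth_prv (Q : truth prv_logic) (w : list form) :
  (forall p, (forall w', incl w w' -> holds Q w' -> prv T w' p) -> prv T w p) -> holds Q w.
Proof. apply (proj2 (holds_closed _ Q)). Qed.

(** Truth is provability; the quantifiers range over variables, of which there
    is always a fresh one. *)
Lemma sem_proves p : forall r, sem prv_structure p r = proves (ren r p).
Proof.
induction p; simpl; intros r; try reflexivity; apply truth_ext; intros w;
  try rewrite IHp1, IHp2.
- split; intros H.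
  + exact (bot_e (Q := proves Bot) H).
  + intros Q w' Hle _; apply truth_prv; intros p _; apply prv_botE, (prv_weak _ _ _ H), Hle.
- split; intros H.
  + apply prv_andI; [exact (and_l H) | exact (and_r H)].
  + apply and_i; [eapply prv_andE1; exact H | eapply prv_andE2; exact H].
- split; intros H.
  + refine (or_e (R := proves (Or (ren r p1) (ren r p2))) H _ _); intros w' Hle H'.
    * apply prv_orI1, H'.
    * apply prv_orI2, H'.
  + apply truth_prv; intros q Hq; apply prv_orE with (1 := H); apply Hq;
      try (apply incl_tl, incl_refl).
    * apply or_l, prv_hyp; now left.
    * apply or_r, prv_hyp; now left.
- split; intros H.
  + apply prv_impI, (H (ren r p1 :: w)); [apply incl_tl, incl_refl | apply prv_hyp; now left].
  + intros w' Hle H'; apply prv_impE with (ren r p1); auto; apply (prv_weak _ _ _ H), Hle.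
- split; intros H.
  + apply prv_all_intro; auto; intros x; generalize (H x); now rewrite IHp.
  + intros x; rewrite IHp; simpl; rewrite <- subst_ren_up; apply prv_allE, H.
- split; intros H.
  + refine (ex_e (Q := proves (Ex (ren (up r) p))) H _); intros x w' Hle H'.
    rewrite IHp in H'; apply prv_exI with x; rewrite subst_ren_up; apply H'.
  + apply truth_prv; intros q Hq; apply (prv_ex_elim _ HT _ r p); auto.
    intros x; apply Hq; [apply incl_tl, incl_refl|].
    apply (ex_i x); rewrite IHp; apply prv_hyp; now left.
Qed.

Lemma prv_replace w p x y : prv T w (Eq x y) ->
  prv T w (ren (x .: fun n => n) p) -> prv T w (ren (y .: fun n => n) p).
Proof. intros H; rewrite <- !subst_ren; now apply prv_eqE. Qed.

Lemma prv_equality : equality prv_structure.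
Proof.
split; simpl.
- intros; apply prv_eqI.
- intros x y w H; apply (prv_replace w (Eq 0 (S x)) x y H), prv_eqI.
- intros x y z w H1 H2; exact (prv_replace w (Eq (S x) 0) y z H2 H1).
- intros x y a w H1 H2; exact (prv_replace w (Mem 0 (S a)) x y H1 H2).
- intros x a b w H1 H2; exact (prv_replace w (Mem (S x) 0) a b H1 H2).
Qed.

Lemma axiom_holds a r (w : list form) : T a -> holds (sem prv_structure a r) w.
Proof. intros Ha; rewrite sem_proves, ren_closed; auto; now apply prv_ax. Qed.

End Provability.

(** * Definable families of truth values *)

Definition val (t : nat + nat) (r : env) : nat := match t with inl i => r i | inr c => c end.

(** The axiom schemes speak of formulas, so they apply to those families of truth
    values only that come from one.  By [e], a free variable of the formula is
    either an argument of the family or a parameter; keeping the parameters as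
    elements lets families be written as functions, with bound names. *)
Definition dfn {L} (S : structure L) (P : env -> truth L) : Prop :=
  exists p e, forall r, P r = sem S p (fun k => val (e k) r).

(** Elements and environments that may be substituted in a definable family. *)
Definition tm (t : env -> nat) : Prop := exists c, forall r, t r = val c r.
Definition tms (E : env -> env) : Prop := exists e, forall r, E r = fun k => val (e k) r.

Lemma tms_cons t E : tm t -> tms E -> tms (fun r => t r .: E r).
Proof.
intros [c Hc] [e He]; exists (c .: e); intros r; apply functional_extensionality.
intros [|n]; simpl; [apply Hc | now rewrite He].
Qed.
Lemma tms_const s : tms (fun _ => s).
Proof. now exists (fun k => inr (s k)). Qed.
Lemma tms_var f : tms (fun r k => r (f k)).
Proof. now exists (fun k => inl (f k)). Qed.
Lemma tms_comp E F : tms E -> tms F -> tms (fun r => E (F r)).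
Proof.
intros [e He] [f Hf].
exists (fun k => match e k with inl i => f i | inr c => inr c end).
intros r; rewrite He, Hf; apply functional_extensionality; intros k.
now destruct (e k).
Qed.

Lemma tms_nth E n : tms E -> tm (fun r => E r n).
Proof. intros [e He]; exists (e n); intros r; now rewrite He. Qed.

Lemma even_double_div2 k : Nat.even (2 * k) = true /\ Nat.div2 (2 * k) = k.
Proof.
split; [rewrite Nat.even_mul; reflexivity | apply Nat.div2_double].
Qed.
Lemma odd_double_div2 k : Nat.even (S (2 * k)) = false /\ Nat.div2 (S (2 * k)) = k.
Proof.
split; [rewrite Nat.even_succ, <- Nat.negb_even, (proj1 (even_double_div2 k)); reflexivity
       | apply Nat.div2_succ_double].
Qed.

Section Definability.
Context {L : logic} (S : structure L).

Lemma dfn_eq P Q : (forall r, Q r = P r) -> dfn S P -> dfn S Q.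
Proof. intros H; now replace Q with P by (apply functional_extensionality; auto). Qed.

Lemma dfn_sem p E : tms E -> dfn S (fun r => sem S p (E r)).
Proof. intros [e He]; exists p, e; intros r; now rewrite He. Qed.

Lemma dfn_subst P E : dfn S P -> tms E -> dfn S (fun r => P (E r)).
Proof.
intros (p & e & H) HE.
destruct (tms_comp (fun r k => val (e k) r) E) as [f Hf]; auto; [now exists e|].
exists p, f; intros r; now rewrite H, <- Hf.
Qed.

(** The even variables are given to one formula and the odd ones to the other. *)
Lemma dfn_merge P Q : dfn S P -> dfn S Q -> exists p q e,
  (forall r, P r = sem S p (fun k => val (e k) r)) /\
  (forall r, Q r = sem S q (fun k => val (e k) r)).
Proof.
intros (p & e & Hp) (q & f & Hq).
exists (ren (fun k => 2 * k) p), (ren (fun k => Datatypes.S (2 * k)) q).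
exists (fun k => if Nat.even k then e (Nat.div2 k) else f (Nat.div2 k)).
split; intros r; rewrite sem_ren; [rewrite Hp | rewrite Hq];
  f_equal; apply functional_extensionality; intros k.
- now destruct (even_double_div2 k) as [-> ->].
- now destruct (odd_double_div2 k) as [-> ->].
Qed.

Lemma dfn_bot : dfn S (fun _ => ⊥).
Proof. now exists Bot, inl. Qed.
Lemma dfn_and P Q : dfn S P -> dfn S Q -> dfn S (fun r => P r ∧ Q r).
Proof.
intros HP HQ; destruct (dfn_merge P Q HP HQ) as (p & q & e & Hp & Hq).
exists (And p q), e; intros r; simpl; now rewrite Hp, Hq.
Qed.
Lemma dfn_or P Q : dfn S P -> dfn S Q -> dfn S (fun r => P r ∨ Q r).
Proof.
intros HP HQ; destruct (dfn_merge P Q HP HQ) as (p & q & e & Hp & Hq).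
exists (Or p q), e; intros r; simpl; now rewrite Hp, Hq.
Qed.
Lemma dfn_imp P Q : dfn S P -> dfn S Q -> dfn S (fun r => P r ⇒ Q r).
Proof.
intros HP HQ; destruct (dfn_merge P Q HP HQ) as (p & q & e & Hp & Hq).
exists (Imp p q), e; intros r; simpl; now rewrite Hp, Hq.
Qed.

Lemma dfn_binder (P : nat -> env -> truth L) :
  dfn S (fun r => P (r 0) (fun k => r (Datatypes.S k))) ->
  exists p e, forall x r, P x r = sem S p (x .: fun k => val (e k) r).
Proof.
intros (p & e & H).
exists (ren (fun k => match e k with inl 0 => 0 | _ => Datatypes.S k end) p).
exists (fun k => match e k with inl (Datatypes.S i) => inl i | c => c end).
intros x r; specialize (H (x .: r)); simpl in H.
rewrite sem_ren; change P with (fun x r => P x r); cbv beta.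
transitivity (P x (fun k => r k)); [reflexivity|]; rewrite H.
f_equal; apply functional_extensionality; intros k.
destruct (e k) as [[|i]|c] eqn:E; simpl; rewrite ?E; reflexivity.
Qed.
Lemma dfn_all P : dfn S (fun r => P (r 0) (fun k => r (Datatypes.S k))) ->
  dfn S (fun r => ∀ x, P x r).
Proof.
intros H; destruct (dfn_binder P H) as (p & e & He).
exists (All p), e; intros r; simpl; f_equal; apply functional_extensionality; auto.
Qed.
Lemma dfn_ex P : dfn S (fun r => P (r 0) (fun k => r (Datatypes.S k))) ->
  dfn S (fun r => ∃ x, P x r).
Proof.
intros H; destruct (dfn_binder P H) as (p & e & He).
exists (Ex p), e; intros r; simpl; f_equal; apply functional_extensionality; auto.
Qed.

Lemma dfn_mem t s : tm t -> tm s -> dfn S (fun r => mem S (t r) (s r)).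
Proof.
intros [c Hc] [d Hd]; exists (Mem 0 1), (c .: d .: inl); intros r; simpl; congruence.
Qed.
Lemma dfn_equ t s : tm t -> tm s -> dfn S (fun r => equ S (t r) (s r)).
Proof.
intros [c Hc] [d Hd]; exists (Eq 0 1), (c .: d .: inl); intros r; simpl; congruence.
Qed.

Definition dfn1 (P : nat -> truth L) := dfn S (fun r => P (r 0)).
Definition dfn2 (P : nat -> nat -> truth L) := dfn S (fun r => P (r 0) (r 1)).
Definition dfn3 (P : nat -> nat -> nat -> truth L) := dfn S (fun r => P (r 0) (r 1) (r 2)).

Lemma dfn1_app P t : dfn1 P -> tm t -> dfn S (fun r => P (t r)).
Proof.
intros H Ht; apply (dfn_subst _ (fun r => t r .: r) H), tms_cons; auto.
apply (tms_var (fun k => k)).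
Qed.
Lemma dfn2_app P t s : dfn2 P -> tm t -> tm s -> dfn S (fun r => P (t r) (s r)).
Proof.
intros H Ht Hs; apply (dfn_subst _ (fun r => t r .: s r .: r) H).
repeat apply tms_cons; auto; apply (tms_var (fun k => k)).
Qed.
Lemma dfn3_app P t s u : dfn3 P -> tm t -> tm s -> tm u ->
  dfn S (fun r => P (t r) (s r) (u r)).
Proof.
intros H Ht Hs Hu; apply (dfn_subst _ (fun r => t r .: s r .: u r .: r) H).
repeat apply tms_cons; auto; apply (tms_var (fun k => k)).
Qed.

(** In the axiom schemes the arguments are the first variables of the formula,
    and the parameters come after them. *)
Lemma dfn_form P n : dfn S P -> exists p s, forall xs, length xs = n ->
  P (fun k => nth k xs 0) = sem S p (fun k => nth k xs (s (k - n))).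
Proof.
intros (p & e & H).
exists (ren (fun k => match e k with
                      | inl i => if i <? n then i else n + k
                      | inr _ => n + k end) p).
exists (fun k => match e k with inl _ => 0 | inr c => c end).
intros xs Hn; rewrite H, sem_ren; f_equal; apply functional_extensionality; intros k.
destruct (e k) as [i|c] eqn:E; simpl; [destruct (Nat.ltb_spec i n)|].
- apply nth_indep; lia.
- rewrite !nth_overflow by lia; replace (n + k - n) with k by lia; now rewrite E.
- rewrite nth_overflow by lia; replace (n + k - n) with k by lia; now rewrite E.
Qed.
Lemma dfn1_form P : dfn1 P -> exists p r, forall x, P x = sem S p (x .: r).
Proof.
intros H; destruct (dfn_form _ 1 H) as (p & s & Hp); exists p, s; intros x.
etransitivity; [exact (Hp [x] eq_refl)|]; f_equal; apply functional_extensionality.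
intros [|[|k]]; reflexivity.
Qed.
Lemma dfn2_form P : dfn2 P -> exists p r, forall x y, P x y = sem S p (x .: y .: r).
Proof.
intros H; destruct (dfn_form _ 2 H) as (p & s & Hp); exists p, s; intros x y.
etransitivity; [exact (Hp [x; y] eq_refl)|]; f_equal; apply functional_extensionality.
intros [|[|[|k]]]; reflexivity.
Qed.
Lemma dfn3_form P : dfn3 P ->
  exists p r, forall x y z, P x y z = sem S p (x .: y .: z .: r).
Proof.
intros H; destruct (dfn_form _ 3 H) as (p & s & Hp); exists p, s; intros x y z.
etransitivity; [exact (Hp [x; y; z] eq_refl)|]; f_equal; apply functional_extensionality.
intros [|[|[|[|k]]]]; reflexivity.
Qed.
End Definability.

Ltac tm := first [ eexists (inl _); intros ?; reflexivity
                 | eexists (inr _); intros ?; reflexivity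
                 | match goal with H : tms ?E |- tm (fun r => ?E r ?n) => exact (tms_nth E n H) end
                 | match goal with H : tms ?E |- tm (fun r => ?E (@?F r) ?n) =>
                     exact (tms_nth (fun r => E (F r)) n (tms_comp E F H (tms_var _))) end ].
Ltac tms := repeat first
  [ assumption
  | apply tms_const
  | apply tms_var
  | refine (tms_cons _ _ _ _); [ tm | ]
  | match goal with H : tms ?E |- tms (fun r => ?E (@?F r)) => apply (tms_comp E F H) end ].
Create HintDb dfn.
Ltac dfn_step :=
  match goal with
  | |- dfn ?S ?P => assumption
  | |- dfn ?S (fun r => tAll (fun x => @?P r x)) => apply (dfn_all S (fun x r => P r x))
  | |- dfn ?S (fun r => tEx (fun x => @?P r x)) => apply (dfn_ex S (fun x r => P r x))
  | |- dfn ?S (fun r => tImp (@?P r) (@?Q r)) => apply (dfn_imp S P Q)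
  | |- dfn ?S (fun r => tAnd (@?P r) (@?Q r)) => apply (dfn_and S P Q)
  | |- dfn ?S (fun r => tOr (@?P r) (@?Q r)) => apply (dfn_or S P Q)
  | |- dfn ?S (fun r => tBot) => apply (dfn_bot S)
  | |- dfn ?S (fun r => tNot (@?P r)) => unfold tNot
  | |- dfn ?S (fun r => tIff (@?P r) (@?Q r)) => unfold tIff
  | |- dfn ?S (fun r => mem ?S (@?t r) (@?s r)) => apply (dfn_mem S t s); tm
  | |- dfn ?S (fun r => equ ?S (@?t r) (@?s r)) => apply (dfn_equ S t s); tm
  | |- dfn ?S (fun r => sem ?S ?p (@?E r)) => apply (dfn_sem S p E); tms
  | H : dfn1 ?S ?P |- dfn ?S (fun r => ?P (@?t r)) => apply (dfn1_app S P t H); tm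
  | H : dfn2 ?S ?P |- dfn ?S (fun r => ?P (@?t r) (@?s r)) => apply (dfn2_app S P t s H); tm
  | H : dfn3 ?S ?P |- dfn ?S (fun r => ?P (@?t r) (@?s r) (@?u r)) =>
      apply (dfn3_app S P t s u H); tm
  end; cbv beta.
(** Extended below for families of a special form. *)
Ltac dfn_more := fail.
Ltac dfn := unfold dfn1, dfn2, dfn3;
  repeat (repeat autounfold with dfn; first [dfn_step | dfn_more]).

(** * Set theory without extensionality *)

(** The axioms of CZF other than extensionality, as conditions on truth values.
    [equ] may be finer than having the same elements. *)
Record czf_minus {L} (S : structure L) : Prop := {
  cz_eq : equality S;
  cz_pair : forall a b w,
    w ⊩ ∃ c, ∀ x, mem S x c ⇔ equ S x a ∨ equ S x b;
  cz_union : forall a w, w ⊩ ∃ u, ∀ x, mem S x u ⇔ ∃ y, mem S y a ∧ mem S x y;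
  cz_inf : forall w, w ⊩ ∃ a, (∃ e, mem S e a ∧ ∀ z, ¬ mem S z e) ∧
    ∀ x, mem S x a ⇒ ∃ y, mem S y a ∧ ∀ z, mem S z y ⇔ mem S z x ∨ equ S z x;
  cz_ind : forall P, dfn1 S P -> forall w,
    (w ⊩ ∀ a, (∀ x, mem S x a ⇒ P x) ⇒ P a) -> w ⊩ ∀ a, P a;
  cz_sep : forall p r, Delta0 p -> forall a w,
    w ⊩ ∃ b, ∀ x, mem S x b ⇔ mem S x a ∧ sem S p (x .: r);
  cz_coll : forall P, dfn2 S P -> forall a w,
    (w ⊩ ∀ x, mem S x a ⇒ ∃ y, P x y) ->
    w ⊩ ∃ b, (∀ x, mem S x a ⇒ ∃ y, mem S y b ∧ P x y)
           ∧ (∀ y, mem S y b ⇒ ∃ x, mem S x a ∧ P x y);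
  cz_subc : forall P, dfn3 S P -> forall a b w,
    w ⊩ ∃ c, ∀ u, (∀ x, mem S x a ⇒ ∃ y, mem S y b ∧ P x y u) ⇒
      ∃ d, mem S d c ∧ (∀ x, mem S x a ⇒ ∃ y, mem S y d ∧ P x y u)
                     ∧ (∀ y, mem S y d ⇒ ∃ x, mem S x a ∧ P x y u) }.

Definition extensional {L} (S : structure L) : Prop := forall a b w,
  (w ⊩ ∀ x, mem S x a ⇔ mem S x b) -> w ⊩ equ S a b.

Lemma sem_closure {L} (S : structure L) p w :
  (forall r, w ⊩ sem S (closure p) r) <-> (forall r, w ⊩ sem S p r).
Proof.
unfold closure; generalize (fv p); intros n; split.
- revert w; induction n as [|n IH]; simpl; auto; intros w H; apply IH; intros r.
  replace r with (r 0 .: fun k => r (Datatypes.S k)); [exact (H _ (r 0))|].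
  apply functional_extensionality; now intros [|k].
- intros H; induction n as [|n IH]; simpl; auto; intros r x; apply IH.
Qed.

Lemma sem_inst {L} (S : structure L) k xs p r :
  sem S (inst k xs p) r = sem S p (fun n => nth n (map r xs) (r (k + (n - length xs)))).
Proof.
unfold inst; rewrite sem_ren; f_equal; apply functional_extensionality; intros n.
rewrite map_nth; f_equal; f_equal; lia.
Qed.

Lemma all_ext {L} (P Q : nat -> truth L) : (forall x, P x = Q x) -> tAll P = tAll Q.
Proof. intros H; f_equal; now apply functional_extensionality. Qed.
Lemma ex_ext {L} (P Q : nat -> truth L) : (forall x, P x = Q x) -> tEx P = tEx Q.
Proof. intros H; f_equal; now apply functional_extensionality. Qed.

Ltac sem_congr :=
  lazymatch goal with
  | |- tAll _ = tAll _ => apply all_ext; intros ?; sem_congr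
  | |- tEx _ = tEx _ => apply ex_ext; intros ?; sem_congr
  | |- tImp ?a ?b = tImp ?c ?d => apply (f_equal2 tImp (x1 := a) (y1 := c)); sem_congr
  | |- tAnd ?a ?b = tAnd ?c ?d => apply (f_equal2 tAnd (x1 := a) (y1 := c)); sem_congr
  | |- sem _ (inst _ _ _) _ = _ =>
      rewrite sem_inst; apply f_equal; apply functional_extensionality;
      intros [|[|[|[|n]]]]; reflexivity
  | |- _ => reflexivity
  end.

Lemma sem_set_ind {L} (S : structure L) p r : sem S (ax_set_ind p) r =
  let P x := sem S p (x .: r) in
  ((∀ a, (∀ x, mem S x a ⇒ P x) ⇒ P a) ⇒ ∀ a, P a).
Proof. unfold ax_set_ind, AllIn; cbn [sem]; cbv zeta; sem_congr. Qed.

Lemma sem_sep {L} (S : structure L) p r : sem S (ax_sep p) r =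
  (∀ a, ∃ b, ∀ x, mem S x b ⇔ mem S x a ∧ sem S p (x .: r)).
Proof. unfold ax_sep, Iff; cbn [sem]; unfold tIff; sem_congr. Qed.

Lemma sem_strong_coll {L} (S : structure L) p r : sem S (ax_strong_coll p) r =
  let P x y := sem S p (x .: y .: r) in
  (∀ a, (∀ x, mem S x a ⇒ ∃ y, P x y) ⇒
    ∃ b, (∀ x, mem S x a ⇒ ∃ y, mem S y b ∧ P x y)
       ∧ (∀ y, mem S y b ⇒ ∃ x, mem S x a ∧ P x y)).
Proof.
unfold ax_strong_coll, AllIn, ExIn; cbn [sem]; cbv zeta; sem_congr.
Qed.

Lemma sem_subset_coll {L} (S : structure L) p r : sem S (ax_subset_coll p) r =
  let P x y u := sem S p (x .: y .: u .: r) in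
  (∀ a b, ∃ c, ∀ u, (∀ x, mem S x a ⇒ ∃ y, mem S y b ∧ P x y u) ⇒
      ∃ d, mem S d c ∧ (∀ x, mem S x a ⇒ ∃ y, mem S y d ∧ P x y u)
                     ∧ (∀ y, mem S y d ⇒ ∃ x, mem S x a ∧ P x y u)).
Proof.
unfold ax_subset_coll, AllIn, ExIn; cbn [sem]; cbv zeta; sem_congr.
Qed.

Lemma czf_minus_of_axioms {L} (S : structure L) : equality S ->
  (forall a, CZF a -> forall r w, w ⊩ sem S a r) -> czf_minus S /\ extensional S.
Proof.
intros HE HA; split; [split; auto|].
- intros a b w; pose proof (HA _ CZF_pair (fun _ => 0) w a b) as H; exact H.
- intros a w; exact (HA _ CZF_union (fun _ => 0) w a).
- intros w; exact (HA _ CZF_inf (fun _ => 0) w).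
- intros P HP w; destruct (dfn1_form S P HP) as (p & r & Hp).
  pose proof (proj1 (sem_closure S _ w) (fun r => HA _ (CZF_set_ind p) r w) r) as H.
  rewrite sem_set_ind in H; cbv zeta in H.
  replace P with (fun x => sem S p (x .: r)); [exact (mp H)|].
  now apply functional_extensionality.
- intros p r Hp a w.
  pose proof (proj1 (sem_closure S _ w) (fun r => HA _ (CZF_sep p Hp) r w) r) as H.
  rewrite sem_sep in H; exact (H a).
- intros P HP a w; destruct (dfn2_form S P HP) as (p & r & Hp).
  pose proof (proj1 (sem_closure S _ w) (fun r => HA _ (CZF_strong_coll p) r w) r) as H.
  rewrite sem_strong_coll in H; cbv zeta in H.
  replace P with (fun x y => sem S p (x .: y .: r)); [exact (mp (H a))|].
  repeat (apply functional_extensionality; intros); auto.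
- intros P HP a b w; destruct (dfn3_form S P HP) as (p & r & Hp).
  pose proof (proj1 (sem_closure S _ w) (fun r => HA _ (CZF_subset_coll p) r w) r) as H.
  rewrite sem_subset_coll in H; cbv zeta in H.
  replace P with (fun x y z => sem S p (x .: y .: z .: r)); [exact (H a b)|].
  repeat (apply functional_extensionality; intros); auto.
- intros a b w H; exact (mp (HA _ CZF_ext (fun _ => 0) w a b) H).
Qed.

Lemma axioms_of_czf_minus {L} (S : structure L) : czf_minus S -> extensional S ->
  forall a, CZF a -> forall r w, w ⊩ sem S a r.
Proof.
intros HS HX a [] r w.
- intros x y; imp H; exact (HX x y w H).
- exact (fun a b => cz_pair S HS a b w).
- exact (fun a => cz_union S HS a w).
- exact (cz_inf S HS w).
- apply sem_closure; clear r; intros r; rewrite sem_set_ind; cbv zeta; imp H.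
  exact (cz_ind S HS (fun x => sem S p (x .: r)) ltac:(dfn) w H).
- apply sem_closure; clear r; intros r; rewrite sem_sep; intros b.
  now apply (cz_sep S HS).
- apply sem_closure; clear r; intros r; rewrite sem_strong_coll; cbv zeta; intros b; imp H1.
  exact (cz_coll S HS (fun x y => sem S p (x .: y .: r)) ltac:(dfn) b w H1).
- apply sem_closure; clear r; intros r; rewrite sem_subset_coll; cbv zeta; intros b c.
  exact (cz_subc S HS (fun x y z => sem S p (x .: y .: z .: r)) ltac:(dfn) b c w).
Qed.

Ltac exi t := apply (ex_i t); cbv beta.
Tactic Notation "have" ident(H) ":=" uconstr(t) := pose proof t as H; cbv beta in H.

(** * Small truth values *)

Lemma Delta0_ren p : Delta0 p -> forall r, Delta0 (ren r p).
Proof. induction 1; intros r; simpl; constructor; auto. Qed.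

Notation inh S t := (tEx (I := nat) (fun x => mem S x t)).
(** Truth values given by a set, which are those that separation can handle. *)
Definition small {L} (S : structure L) (P : truth L) : truth L := ∃ t, (∃ x, mem S x t) ⇔ P.
Notation sub S a b := (tAll (I := nat) (fun x => mem S x a ⇒ mem S x b)).
#[global] Hint Unfold small : dfn.

Lemma equ_subst {L} (S : structure L) (HE : equality S) P x y w :
  dfn1 S P -> (w ⊩ equ S x y) -> (w ⊩ P x) -> w ⊩ P y.
Proof.
intros HP H; destruct (dfn1_form S P HP) as (p & r & Hp); rewrite !Hp.
apply (sem_equ HE); intros [|n]; simpl; auto; apply (eq_refl_ S HE).
Qed.

Section Sets.
Context {L : logic} (S : structure L) (HS : czf_minus S).
Local Notation "x '∈' y" := (mem S x y) (at level 70) : truth_scope.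
Local Notation "x '≐' y" := (equ S x y) (at level 70) : truth_scope.
Local Notation inh t := (inh S t).
Local Notation small := (small S).

Let HE : equality S := cz_eq S HS.

Lemma equ_refl x w : w ⊩ x ≐ x.
Proof. apply (eq_refl_ S HE). Qed.

Lemma sep_D0 p r a w : Delta0 p -> w ⊩ ∃ b, ∀ x, x ∈ b ⇔ x ∈ a ∧ sem S p (x .: r).
Proof. intros Hp; now apply (cz_sep S HS). Qed.

Lemma small_D0 p r w : Delta0 p -> w ⊩ small (sem S p r).
Proof.
intros Hp; obtain c Hc from (cz_pair S HS 0 0 w).
obtain b Hb from (sep_D0 (ren Datatypes.S p) r c w (Delta0_ren _ Hp _)).
exi b; dec.
- have H1 := (iff_l (Hb x) H); rewrite sem_ren in H1; exact (and_r H1).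
- exi 0; apply (iff_r (Hb 0)), and_i; [|now rewrite sem_ren].
  apply (iff_r (Hc 0)), or_l, equ_refl.
Qed.

Lemma small_mem x y w : w ⊩ small (x ∈ y).
Proof. exact (small_D0 (Mem 0 1) (x .: y .: fun k => k) w ltac:(constructor)). Qed.
Lemma small_equ x y w : w ⊩ small (x ≐ y).
Proof. exact (small_D0 (Eq 0 1) (x .: y .: fun k => k) w ltac:(constructor)). Qed.
Lemma small_bot w : w ⊩ small ⊥.
Proof. exact (small_D0 Bot (fun k => k) w ltac:(constructor)). Qed.

Let inhf (k : nat) : form := ExIn k (Eq 0 0).
Let inhf_D0 k : Delta0 (inhf k).
Proof. constructor; constructor. Qed.
Let inhf_sem k r : sem S (inhf k) r = inh (r k).
Proof.
apply truth_ext; intros w; cbn; split; intros H; dec; exi x; auto.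
apply and_i; auto; apply equ_refl.
Qed.

Lemma small_iff P Q w : (w ⊩ small P) -> (w ⊩ P ⇔ Q) -> w ⊩ small Q.
Proof.
intros H1 H2; obtain t Ht from H1; exi t; dec.
- apply (iff_l H2), (iff_l Ht); exi x; auto.
- exact (iff_r Ht (iff_r H2 H)).
Qed.

Lemma small_imp P Q w : (w ⊩ small P) -> (w ⊩ small Q) -> w ⊩ small (P ⇒ Q).
Proof.
intros H1 H2; obtain t Ht from H1; obtain s Hs from H2.
assert (K : w ⊩ small (inh t ⇒ inh s)).
{ pose proof (small_D0 (Imp (inhf 0) (inhf 1)) (t .: s .: fun k => k) w) as K.
  cbn [sem] in K; rewrite !inhf_sem in K; apply K; constructor; apply inhf_D0. }
refine (small_iff _ _ _ K _); apply and_i; imp K1 K2; [exact (iff_l Hs (mp K1 (iff_r Ht K2))) | exact (iff_r Hs (mp K1 (iff_l Ht K2)))].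
Qed.

Lemma small_or P Q w : (w ⊩ small P) -> (w ⊩ small Q) -> w ⊩ small (P ∨ Q).
Proof.
intros H1 H2; obtain t Ht from H1; obtain s Hs from H2.
assert (K : w ⊩ small (inh t ∨ inh s)).
{ pose proof (small_D0 (Or (inhf 0) (inhf 1)) (t .: s .: fun k => k) w) as K.
  cbn [sem] in K; rewrite !inhf_sem in K; apply K; constructor; apply inhf_D0. }
refine (small_iff _ _ _ K _); apply and_i; imp K1; cases K1; solve [apply or_l, (iff_l Ht), K1 | apply or_r, (iff_l Hs), K1 | apply or_l, (iff_r Ht), K1 | apply or_r, (iff_r Hs), K1].
Qed.

Lemma small_and P Q w : (w ⊩ small P) -> (w ⊩ small Q) -> w ⊩ small (P ∧ Q).
Proof.
intros H1 H2; obtain t Ht from H1; obtain s Hs from H2.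
assert (K : w ⊩ small (inh t ∧ inh s)).
{ pose proof (small_D0 (And (inhf 0) (inhf 1)) (t .: s .: fun k => k) w) as K.
  cbn [sem] in K; rewrite !inhf_sem in K; apply K; constructor; apply inhf_D0. }
refine (small_iff _ _ _ K _); apply and_i; imp K1; apply and_i; solve [apply (iff_l Ht), (and_l K1) | apply (iff_l Hs), (and_r K1) | apply (iff_r Ht), (and_l K1) | apply (iff_r Hs), (and_r K1)].
Qed.

Lemma small_not P w : (w ⊩ small P) -> w ⊩ small (¬ P).
Proof. intros H; apply small_imp; auto; apply small_bot. Qed.

(** The values are collected together with a description of the argument, and
    united, so no pairing of arguments and values is involved. *)
Lemma image P a w : dfn2 S P ->
  (w ⊩ ∀ x, x ∈ a ⇒ ∃ s, ∀ m, m ∈ s ⇔ P x m) ->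
  w ⊩ ∃ b, ∀ m, m ∈ b ⇔ ∃ x, x ∈ a ∧ P x m.
Proof.
intros HP H.
obtain B HB from (cz_coll S HS (fun x s => ∀ m, m ∈ s ⇔ P x m) ltac:(dfn) a w H).
obtain u Hu from (cz_union S HS B w).
exi u; dec.
- have K := (iff_l (Hu x) H0); dec.
  have K' := (mp (HB0 x0) K); dec; exi x1; apply and_i; auto.
  exact (iff_l (K'0 x) K0).
- apply (iff_r (Hu x)).
  have K := (mp (HB x0) H0); dec; exi x1; apply and_i; auto.
  exact (iff_r (K0 x) H1).
Qed.

Lemma singleton x w : w ⊩ ∃ c, ∀ z, z ∈ c ⇔ z ≐ x.
Proof.
obtain c Hc from (cz_pair S HS x x w); exi c; dec.
- have H1 := (iff_l (Hc x0) H); dec; auto.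
- apply (iff_r (Hc x0)), or_l, H.
Qed.

(** Each [x] contributes the part of its singleton on which [P x] holds; the sets
    that witness smallness need not be chosen. *)
Lemma sep_small P a w : dfn1 S P -> (w ⊩ ∀ x, x ∈ a ⇒ small (P x)) ->
  w ⊩ ∃ b, ∀ x, x ∈ b ⇔ x ∈ a ∧ P x.
Proof.
intros HP H.
assert (HI : w ⊩ ∀ x, x ∈ a ⇒ ∃ s, ∀ m, m ∈ s ⇔ m ≐ x ∧ P x).
{ intros x; imp Hx; have K := (mp (H x) Hx); obtain t Ht from K.
  obtain c Hc from (singleton x w).
  obtain b Hb from (sep_D0 (inhf 1) (t .: fun k => k) c w (inhf_D0 _)).
  exi b; intros m; apply and_i; imp K.
  - have K' := (and_r (iff_l (Hb m) K)); rewrite inhf_sem in K'; apply and_i.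
    + exact (iff_l (Hc m) (and_l (iff_l (Hb m) K))).
    + exact (iff_l Ht K').
  - apply (iff_r (Hb m)), and_i; [exact (iff_r (Hc m) (and_l K))|].
    rewrite inhf_sem; exact (iff_r Ht (and_r K)). }
obtain b Hb from (image (fun x m => m ≐ x ∧ P x) a w ltac:(dfn) HI).
exi b; intros x; apply and_i; imp K.
- have K' := (iff_l (Hb x) K); dec.
  + apply (eq_mem_l S HE x0); auto; apply (eq_sym_ S HE); auto.
  + apply (equ_subst S HE P x0); auto; apply (eq_sym_ S HE); auto.
- apply (iff_r (Hb x)); dec; exi x; repeat apply and_i; auto; apply equ_refl.
Qed.

Lemma small_all P a w : dfn1 S P -> (w ⊩ ∀ x, x ∈ a ⇒ small (P x)) ->
  w ⊩ small (∀ x, x ∈ a ⇒ P x).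
Proof.
intros HP H; obtain b Hb from (sep_small P a w HP H).
refine (small_iff _ _ _ (small_D0 (AllIn 0 (Mem 0 2)) (a .: b .: fun k => k) w _) _).
{ constructor; constructor. }
cbn; dec.
- exact (and_r (iff_l (Hb x) (mp (H0 x) H1))).
- exact (iff_r (Hb x) (and_i H1 (mp (H0 x) H1))).
Qed.

Lemma small_ex P a w : dfn1 S P -> (w ⊩ ∀ x, x ∈ a ⇒ small (P x)) ->
  w ⊩ small (∃ x, x ∈ a ∧ P x).
Proof.
intros HP H; obtain b Hb from (sep_small P a w HP H).
exi b; dec; exi x; [exact (and_i (and_l (iff_l (Hb x) H0)) (and_r (iff_l (Hb x) H0))) | exact (iff_r (Hb x) (and_i H0 H1))].
Qed.

Lemma small_inh t w : w ⊩ small (inh t).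
Proof. exi t; dec; exi x; auto. Qed.

Lemma cz_set_ind P : dfn1 S P -> (forall w a, (w ⊩ ∀ x, x ∈ a ⇒ P x) -> w ⊩ P a) ->
  forall w a, w ⊩ P a.
Proof. intros HP H w; apply (cz_ind S HS P HP w); dec; now apply H. Qed.

Lemma cup a b w : w ⊩ ∃ c, ∀ x, x ∈ c ⇔ x ∈ a ∨ x ∈ b.
Proof.
obtain c Hc from (cz_pair S HS a b w); obtain u Hu from (cz_union S HS c w).
exi u; dec.
- have K := (iff_l (Hu x) H); dec; have K' := (iff_l (Hc x0) K); dec.
  + apply or_l, (eq_mem_r S HE _ x0); auto.
  + apply or_r, (eq_mem_r S HE _ x0); auto.
- apply (iff_r (Hu x)); exi a; apply and_i; auto; apply (iff_r (Hc a)), or_l, equ_refl.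
- apply (iff_r (Hu x)); exi b; apply and_i; auto; apply (iff_r (Hc b)), or_r, equ_refl.
Qed.

End Sets.

(** * Extensional equality as bisimilarity *)

Section Star.
Context {L : logic} (S : structure L) (HS : czf_minus S).
Local Notation "x '∈' y" := (mem S x y) (at level 70) : truth_scope.
Local Notation "x '≐' y" := (equ S x y) (at level 70) : truth_scope.
Let HE : equality S := cz_eq S HS.

(** A reflexive and symmetric relation is coded by a set [C] of classes: two sets
    are related if they are elements of one class.  This saves ordered pairs. *)
Definition shares (C x y : nat) : truth L := ∃ c, c ∈ C ∧ x ∈ c ∧ y ∈ c.
Definition bisim (C : nat) : truth L :=
  ∀ c, c ∈ C ⇒ ∀ x, x ∈ c ⇒ ∀ y, y ∈ c ⇒ ∀ u, u ∈ x ⇒ ∃ v, v ∈ y ∧ shares C u v.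
Definition sim (x y : nat) : truth L := ∃ C, bisim C ∧ shares C x y.
Definition half (x y : nat) : truth L := ∀ u, u ∈ x ⇒ ∃ v, v ∈ y ∧ sim u v.
Hint Unfold shares bisim sim half : dfn.

Lemma shares_sym C x y w : (w ⊩ shares C x y) -> w ⊩ shares C y x.
Proof. unfold shares; intros H; dec; exi x0; dec; auto. Qed.
Lemma shares_refl C x y w : (w ⊩ shares C x y) -> w ⊩ shares C x x.
Proof. unfold shares; intros H; dec; exi x0; dec; auto. Qed.
Lemma shares_sub C D x y w : (w ⊩ sub S C D) -> (w ⊩ shares C x y) -> w ⊩ shares D x y.
Proof. unfold shares; intros H1 H; dec; exi x0; dec; auto; exact (mp (H1 _) H). Qed.

Lemma sim_sym x y w : (w ⊩ sim x y) -> w ⊩ sim y x.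
Proof. unfold sim; intros H; dec; exi x0; dec; auto; now apply shares_sym. Qed.

Lemma bisim_step C x y u w : (w ⊩ bisim C) -> (w ⊩ shares C x y) -> (w ⊩ u ∈ x) ->
  w ⊩ ∃ v, v ∈ y ∧ shares C u v.
Proof.
unfold bisim; intros H H0 H1; unfold shares in H0; dec.
exact (mp (mp (mp (mp (H x0) H0 x) H2 y) H3 u) H1).
Qed.

Lemma sim_half x y w : (w ⊩ sim x y) -> w ⊩ half x y.
Proof.
unfold sim, half; intros H; dec.
have K := (bisim_step _ _ _ _ _ H H0 H1); obtain v Hv from K; dec.
exi v; dec; auto; exi x0; dec; auto.
Qed.

(** Bisimilarity is the largest bisimulation: the sets of classes witnessing
    the similarity of the elements are collected, and one class is added to
    their union. *)
Lemma sim_fold x y w : (w ⊩ half x y) -> (w ⊩ half y x) -> w ⊩ sim x y.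
Proof.
intros H1 H2; pose (P y u C := bisim C ∧ ∃ v, v ∈ y ∧ shares C u v).
assert (coll : forall x y w, (w ⊩ half x y) ->
  w ⊩ ∃ B, (∀ u, u ∈ x ⇒ ∃ C, C ∈ B ∧ P y u C) ∧ (∀ C, C ∈ B ⇒ ∃ u, u ∈ x ∧ P y u C)).
{ clear x y w H1 H2; intros x y w H; apply (cz_coll S HS (P y) ltac:(unfold P; dfn)).
  unfold P; intros u; imp Hu; have K := (mp (H u) Hu); unfold sim in K; dec.
  exi x1; dec; auto; exi x0; dec; auto. }
obtain B1 HB1 from (coll x y w H1); obtain B2 HB2 from (coll y x w H2).
obtain D HD from (cup S HS B1 B2 w).
obtain V HV from (cz_union S HS D w).
obtain e He from (cz_pair S HS x y w); obtain s Hs from (singleton S HS e w).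
obtain W HW from (cup S HS V s w).
assert (DW : w ⊩ ∀ C, C ∈ D ⇒ bisim C ∧ sub S C W).
{ intros C; imp HC; apply and_i.
  - have K := (iff_l (HD C) HC); cases K;
      [have K' := (mp (and_r HB1 C) K) | have K' := (mp (and_r HB2 C) K)];
      unfold P in K'; dec; auto.
  - intros c; imp Hc; apply (iff_r (HW c)), or_l, (iff_r (HV c)); exi C; dec; auto. }
assert (K1 : w ⊩ ∀ u, u ∈ x ⇒ ∃ v, v ∈ y ∧ shares W u v).
{ intros u; imp Hu; have K := (mp (and_l HB1 u) Hu); unfold P in K; dec.
  exi x1; dec; auto; apply (shares_sub x0); auto.
  exact (and_r (mp (DW x0) (iff_r (HD x0) (or_l K)))). }
assert (K2 : w ⊩ ∀ u, u ∈ y ⇒ ∃ v, v ∈ x ∧ shares W u v).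
{ intros u; imp Hu; have K := (mp (and_l HB2 u) Hu); unfold P in K; dec.
  exi x1; dec; auto; apply (shares_sub x0); auto.
  exact (and_r (mp (DW x0) (iff_r (HD x0) (or_r K)))). }
exi W; apply and_i.
- intros c; imp Hc; intros a; imp Ha; intros b; imp Hb; intros u; imp Hu.
  have K := (iff_l (HW c) Hc); cases K.
  + have K' := (iff_l (HV c) K); obtain C HC from K'; dec.
    have KC := (mp (DW C) HC); dec.
    assert (Hab : w ⊩ shares C a b) by (exi c; dec; auto).
    have Kv := (bisim_step _ _ _ _ _ KC Hab Hu); obtain v Hv from Kv; dec.
    exi v; dec; auto; now apply (shares_sub C).
  + have E := (iff_l (Hs c) K).
    have Ea := (iff_l (He a) (eq_mem_r S HE _ _ _ _ E Ha)).
    have Eb := (iff_l (He b) (eq_mem_r S HE _ _ _ _ E Hb)).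
    assert (move : forall z v w, (w ⊩ b ≐ z) -> (w ⊩ v ∈ z) -> w ⊩ v ∈ b).
    { intros z v w' E1; apply (eq_mem_r S HE), (eq_sym_ S HE), E1. }
    (* Within the new class {x, y} each of [a] and [b] is [x] or [y]. *)
    cases Ea; cases Eb; have Hu' := (eq_mem_r S HE _ _ _ _ Ea Hu);
      [have Kv := (mp (K1 u) Hu') | have Kv := (mp (K1 u) Hu')
      |have Kv := (mp (K2 u) Hu') | have Kv := (mp (K2 u) Hu')];
      obtain v Hv from Kv; dec.
    * exi u; dec; [exact (move _ _ _ Eb Hu') | now apply (shares_refl W u v)].
    * exi v; dec; auto; exact (move _ _ _ Eb Hv).
    * exi v; dec; auto; exact (move _ _ _ Eb Hv).
    * exi u; dec; [exact (move _ _ _ Eb Hu') | now apply (shares_refl W u v)].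
- exi e; dec.
  + apply (iff_r (HW e)), or_r, (iff_r (Hs e)), (eq_refl_ S HE).
  + apply (iff_r (He x)), or_l, (eq_refl_ S HE).
  + apply (iff_r (He y)), or_r, (eq_refl_ S HE).
Qed.

Lemma sim_refl w x : w ⊩ sim x x.
Proof.
revert w x; apply (cz_set_ind S HS (fun x => sim x x)); [dfn|].
intros w x H; assert (K : w ⊩ half x x).
{ intros u; imp Hu; exi u; dec; auto; exact (mp (H u) Hu). }
now apply sim_fold.
Qed.

Lemma sim_trans x y z w : (w ⊩ sim x y) -> (w ⊩ sim y z) -> w ⊩ sim x z.
Proof.
assert (K : forall w x, w ⊩ ∀ y z, sim x y ⇒ sim y z ⇒ sim x z);
  [|intros H1 H2; exact (mp (mp (K w x y z) H1) H2)]; clear x y z w.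
apply (cz_set_ind S HS (fun x => ∀ y z, sim x y ⇒ sim y z ⇒ sim x z)); [dfn|].
intros w x IH y z; imp H1 H2; apply sim_fold; intros u; imp Hu.
- have K := (mp (sim_half _ _ _ H1 u) Hu); obtain v Hv from K; dec.
  have K := (mp (sim_half _ _ _ H2 v) Hv); obtain t Ht from K; dec.
  exi t; dec; auto; exact (mp (mp (mp (IH u) Hu v t) Hv0) Ht0).
- have K := (mp (sim_half _ _ _ (sim_sym _ _ _ H2) u) Hu); obtain v Hv from K; dec.
  have K := (mp (sim_half _ _ _ (sim_sym _ _ _ H1) v) Hv); obtain t Ht from K; dec.
  exi t; dec; auto; apply sim_sym.
  exact (mp (mp (mp (IH t) Ht v u) (sim_sym _ _ _ Ht0)) (sim_sym _ _ _ Hv0)).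
Qed.

Definition smem (x a : nat) : truth L := ∃ z, z ∈ a ∧ sim x z.
Definition star : structure L := Structure smem sim.
Hint Unfold smem : dfn.

Lemma star_equality : equality star.
Proof.
split; simpl.
- intros; apply sim_refl.
- intros; now apply sim_sym.
- intros; now apply (sim_trans x y).
- unfold smem; intros x y a w H H1; dec; exi x0; dec; auto.
  apply (sim_trans _ x); auto; now apply sim_sym.
- unfold smem; intros x a b w H H1; dec; have K := (mp (sim_half _ _ _ H x0) H1).
  obtain v Hv from K; dec; exi v; dec; auto; now apply (sim_trans _ x0).
Qed.

Lemma mem_smem x a w : (w ⊩ x ∈ a) -> w ⊩ smem x a.
Proof. intros H; exi x; apply and_i; auto; apply sim_refl. Qed.

Lemma star_extensional : extensional star.
Proof.
intros a b w H; simpl in *; apply sim_fold; intros u; imp Hu.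
- exact (iff_l (H u) (mem_smem _ _ _ Hu)).
- exact (iff_r (H u) (mem_smem _ _ _ Hu)).
Qed.

Lemma dfn_star p : forall E, tms E -> dfn S (fun r => sem star p (E r)).
Proof.
induction p; intros E HE'; cbn [sem star mem equ]; try (dfn; auto; fail).
- apply (dfn_all S (fun x r => sem star p (x .: E r))), (IHp (fun r => r 0 .: E _)).
  apply tms_cons; [tm|]; apply (tms_comp E _ HE'), tms_var.
- apply (dfn_ex S (fun x r => sem star p (x .: E r))), (IHp (fun r => r 0 .: E _)).
  apply tms_cons; [tm|]; apply (tms_comp E _ HE'), tms_var.
Qed.

Lemma star_dfn P : dfn star P -> dfn S P.
Proof.
intros (p & e & H); replace P with (fun r => sem star p (fun k => val (e k) r)).
- apply dfn_star; now exists e.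
- apply functional_extensionality; intros r; now rewrite H.
Qed.

Lemma small_half x y w : (w ⊩ ∀ u, u ∈ x ⇒ ∀ y, small S (sim u y)) ->
  w ⊩ small S (half x y).
Proof.
intros H; apply (small_all S HS); [dfn|]; intros u; imp Hu.
apply (small_ex S HS); [dfn|]; intros v; imp Hv; exact (mp (H u) Hu v).
Qed.

(** By induction on [x], because the similarity of two sets is a bounded statement
    about the similarity of their elements. *)
Lemma small_sim x y w : w ⊩ small S (sim x y).
Proof.
assert (K : forall w x, w ⊩ ∀ y, small S (sim x y)); [|exact (K w x y)]; clear x y w.
apply (cz_set_ind S HS); [dfn|]; intros w x H y.
apply (small_iff S (half x y ∧ ∀ v, v ∈ y ⇒ ∃ u, u ∈ x ∧ sim u v)).
- apply (small_and S HS); [now apply small_half|].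
  apply (small_all S HS); [dfn|]; intros v; imp Hv.
  apply (small_ex S HS); [dfn|]; intros u; imp Hu; exact (mp (H u) Hu v).
- apply and_i; imp K.
  + apply sim_fold; [exact (and_l K)|]; intros v; imp Hv.
    have K' := (mp (and_r K v) Hv); obtain u Hu from K'; dec.
    exi u; dec; auto; now apply sim_sym.
  + apply and_i; [now apply sim_half|]; intros v; imp Hv.
    have K' := (mp (sim_half _ _ _ (sim_sym _ _ _ K) v) Hv).
    obtain u Hu from K'; dec; exi u; dec; auto; now apply sim_sym.
Qed.

Lemma small_smem x a w : w ⊩ small S (smem x a).
Proof.
apply (small_ex S HS); [dfn|]; intros z; imp Hz; apply small_sim.
Qed.

Lemma smem_all P a w : dfn1 star P ->
  (w ⊩ ∀ x, x ∈ a ⇒ P x) -> w ⊩ ∀ x, smem x a ⇒ P x.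
Proof.
intros HP H x; imp Hx; unfold smem in Hx; dec.
apply (equ_subst star star_equality P x0); auto; [now apply sim_sym | exact (mp (H x0) Hx)].
Qed.
Lemma all_smem P a w : (w ⊩ ∀ x, smem x a ⇒ P x) -> w ⊩ ∀ x, x ∈ a ⇒ P x.
Proof. intros H x; imp Hx; exact (mp (H x) (mem_smem _ _ _ Hx)). Qed.
Lemma ex_smem P a w : (w ⊩ ∃ x, x ∈ a ∧ P x) -> w ⊩ ∃ x, smem x a ∧ P x.
Proof. intros H; dec; exi x; dec; auto; now apply mem_smem. Qed.
Lemma smem_ex P a w : dfn1 star P ->
  (w ⊩ ∃ x, smem x a ∧ P x) -> w ⊩ ∃ x, x ∈ a ∧ P x.
Proof.
intros HP H; dec; unfold smem in H; dec; exi x0; dec; auto.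
now apply (equ_subst star star_equality P x).
Qed.

Lemma small_star p : Delta0 p -> forall r w, w ⊩ small S (sem star p r).
Proof.
induction 1; intros r w; cbn [sem star mem equ AllIn ExIn].
- apply small_smem.
- apply small_sim.
- apply (small_bot S HS).
- now apply (small_and S HS).
- now apply (small_or S HS).
- now apply (small_imp S HS).
- apply (small_iff S (∀ x, x ∈ r t ⇒ sem star p (x .: r))).
  + apply (small_all S HS); [apply star_dfn; dfn|]; intros x; imp Hx; apply IHDelta0.
  + apply and_i; imp K.
    * exact (smem_all (fun x => sem star p (x .: r)) (r t) w ltac:(dfn) K).
    * exact (all_smem (fun x => sem star p (x .: r)) (r t) w K).
- apply (small_iff S (∃ x, x ∈ r t ∧ sem star p (x .: r))).
  + apply (small_ex S HS); [apply star_dfn; dfn|]; intros x; imp Hx; apply IHDelta0.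
  + apply and_i; imp K.
    * exact (ex_smem (fun x => sem star p (x .: r)) (r t) w K).
    * exact (smem_ex (fun x => sem star p (x .: r)) (r t) w ltac:(dfn) K).
Qed.

Lemma star_subst P x y w : dfn1 star P -> (w ⊩ sim x y) -> (w ⊩ P x) -> w ⊩ P y.
Proof. intros HP; exact (equ_subst star star_equality P x y w HP). Qed.

Lemma sim_equ x y z w : (w ⊩ sim x y) -> (w ⊩ y ≐ z) -> w ⊩ sim x z.
Proof. intros H1 H2; exact (equ_subst S HE (sim x) y z w ltac:(dfn) H2 H1). Qed.

(** The axioms carry over since properties that respect bisimilarity may be
    restricted to the elements that are actually listed in a set, by [smem_all]
    and its companions. *)
Theorem star_czf_minus : czf_minus star.
Proof.
split; cbn [star mem equ].
- apply star_equality.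
- intros a b w; obtain c Hc from (cz_pair S HS a b w); exi c.
  intros x; apply and_i; imp K.
  + unfold smem in K; dec; have K' := (iff_l (Hc x0) K); cases K';
      [apply or_l | apply or_r]; now apply (sim_equ _ x0).
  + cases K; [exi a | exi b]; dec; auto; apply (iff_r (Hc _));
      [apply or_l | apply or_r]; apply (eq_refl_ S HE).
- intros a w; obtain u Hu from (cz_union S HS a w); exi u.
  intros x; apply and_i; imp K.
  + unfold smem in K; dec; have K' := (iff_l (Hu x0) K); dec.
    exi x1; dec; [now apply mem_smem | exi x0; dec; auto].
  + have K' := (smem_ex (fun y => mem star x y) a w ltac:(dfn) K); cbn in K'.
    clear K; obtain y Hy from K'; unfold smem in Hy; dec; exi x0; dec; auto.
    apply (iff_r (Hu x0)); exi y; dec; auto.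
- intros w; obtain a Ha from (cz_inf S HS w); dec; exi a; dec.
  + exi x; dec; [now apply mem_smem|].
    unfold smem in H; dec; exact (mp (Ha1 x1) H).
  + revert H; revert x0.
    assert (K : w ⊩ ∀ x0, smem x0 a ⇒ ∃ y, smem y a ∧ ∀ z, smem z y ⇔ smem z x0 ∨ sim z x0);
      [|intros x0 H; exact (mp (K x0) H)].
    apply (smem_all (fun x0 => ∃ y, mem star y a ∧
             ∀ z, mem star z y ⇔ mem star z x0 ∨ equ star z x0)); [dfn|].
    cbn [star mem equ]; intros x0; imp Hx; have K := (mp (Ha0 x0) Hx); dec.
    exi x1; dec; [now apply mem_smem| | |].
    * unfold smem in H; dec; have K' := (iff_l (K0 x3) H); cases K'.
      -- apply or_l; exi x3; dec; auto.
      -- apply or_r; now apply (sim_equ _ x3).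
    * unfold smem in H; dec; exi x3; dec; auto; exact (iff_r (K0 x3) (or_l H)).
    * exi x0; dec; auto; apply (iff_r (K0 x0)), or_r, (eq_refl_ S HE).
- intros P HP w H; apply (cz_ind S HS P (star_dfn _ HP)); intros a; imp K.
  exact (mp (H a) (smem_all P a w HP K)).
- intros p r Hp a w.
  assert (HP : dfn1 star (fun x => sem star p (x .: r))) by dfn.
  obtain b Hb from (sep_small S HS (fun x => sem star p (x .: r)) a w (star_dfn _ HP)
    (fun x w' _ _ => small_star p Hp _ w')).
  exi b; intros x; apply and_i; imp K.
  + unfold smem in K; dec; have K' := (iff_l (Hb x0) K); dec.
    * exi x0; dec; auto.
    * apply (star_subst (fun x => sem star p (x .: r)) x0); auto; now apply sim_sym.
  + dec; unfold smem in K; dec; exi x0; dec; auto.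
    apply (iff_r (Hb x0)); dec; auto.
    now apply (star_subst (fun x => sem star p (x .: r)) x).
- intros P HP a w H.
  obtain b Hb from (cz_coll S HS P (star_dfn _ HP) a w (all_smem _ _ _ H)).
  exi b; apply and_i.
  + apply (smem_all (fun x => ∃ y, mem star y b ∧ P x y)); [dfn|].
    intros x; imp K; apply ex_smem; exact (mp (and_l Hb x) K).
  + apply (smem_all (fun y => ∃ x, mem star x a ∧ P x y)); [dfn|].
    intros y; imp K; apply ex_smem; exact (mp (and_r Hb y) K).
- intros P HP a b w.
  obtain c Hc from (cz_subc S HS P (star_dfn _ HP) a b w); exi c; intros u; imp H.
  assert (K : w ⊩ ∀ x, x ∈ a ⇒ ∃ y, y ∈ b ∧ P x y u).
  { intros x; imp Hx; apply smem_ex; [dfn|]; exact (mp (H x) (mem_smem _ _ _ Hx)). }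
  have Kd := (mp (Hc u) K); obtain d Hd from Kd; exi d; repeat apply and_i.
  + exact (mem_smem _ _ _ (and_l Hd)).
  + apply (smem_all (fun x => ∃ y, mem star y d ∧ P x y u)); [dfn|].
    intros x; imp Hx; apply ex_smem; exact (mp (and_l (and_r Hd) x) Hx).
  + apply (smem_all (fun y => ∃ x, mem star x a ∧ P x y u)); [dfn|].
    intros y; imp Hy; apply ex_smem; exact (mp (and_r (and_r Hd) y) Hy).
Qed.

(** Small truth values are stable under double negation as soon as inhabitedness
    is, and then a set is its own double complement. *)
Lemma star_DCom : (forall t w, (w ⊩ ¬ ¬ inh S t) -> w ⊩ inh S t) ->
  forall r w, w ⊩ sem star DCom r.
Proof.
intros H r w; intros x; exi x; intros z; imp K; cbn in K |- *.
obtain t Ht from (small_smem z x w); apply (iff_l Ht), H; imp K1.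
apply (mp K); imp K2; exact (mp K1 (iff_r Ht K2)).
Qed.

End Star.
#[global] Hint Unfold shares bisim sim half smem : dfn.

(** * Adding excluded middle for small truth values *)

Definition has_power {L} (S : structure L) : Prop := forall a w,
  w ⊩ ∃ b, ∀ y, mem S y b ⇔ ∀ z, mem S z y ⇒ mem S z a.

Section Classical.
Context {L : logic} (V : structure L) (HV : czf_minus V) (HP : has_power V).
Local Notation "x '∈' y" := (mem V x y) (at level 70) : truth_scope.
Local Notation "x '≐' y" := (equ V x y) (at level 70) : truth_scope.
Let HE : equality V := cz_eq V HV.

(** Closed truth values are those that may be proved from the inhabitedness of a
    set that is not empty.  This makes small truth values stable under double
    negation. *)
Definition jclosed (Q : world L -> Prop) : Prop := closed L Q /\
  forall v w, (w ⊩ ¬ ¬ inh V v) -> (forall w', le L w w' -> (w' ⊩ inh V v) -> Q w') -> Q w.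

Definition jlogic : logic.
Proof.
refine (Logic (world L) (le L) (le_refl L) (le_trans L) jclosed _ _ _).
- intros Q w w' [H _]; exact (closed_up L Q w w' H).
- intros I Q H; split; [apply closed_all; intros i; apply H|].
  intros v w Hv K i; apply (proj2 (H i) v w Hv); auto.
- intros P Q HP' [HQ HJ]; split; [now apply closed_imp|].
  intros v w Hv K w1 H1 HP1; apply (HJ v w1); [exact (holds_up _ _ _ _ H1 Hv)|].
  intros w2 H2 Hi; apply (K w2 (le_trans L _ _ _ H1 H2) Hi w2 (le_refl L w2)).
  now apply (HP' w1).
Defined.

Definition forget (Q : truth jlogic) : truth L := @Truth L (holds Q) (proj1 (holds_closed _ Q)).

Lemma j_elim (Q : truth jlogic) v w : (w ⊩ ¬ ¬ inh V v) ->
  (forall w', le L w w' -> (w' ⊩ inh V v) -> holds Q w') -> holds Q w.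
Proof. apply (proj2 (holds_closed _ Q)). Qed.

Lemma j_ex_e {I} (P : I -> truth L) (Q : truth jlogic) w : (w ⊩ tEx P) ->
  (forall i w', le L w w' -> (w' ⊩ P i) -> holds Q w') -> holds Q w.
Proof. exact (ex_e (Q := forget Q)). Qed.

(** Classical reasoning about small truth values. *)
Lemma j_small (P : truth L) (Q : truth jlogic) w : (w ⊩ small V P) -> (w ⊩ ¬ ¬ P) ->
  (forall w', le L w w' -> (w' ⊩ P) -> holds Q w') -> holds Q w.
Proof.
intros H1 H2 H3; refine (j_ex_e _ _ _ H1 _); intros t w1 Hle Ht.
apply (j_elim Q t).
- apply (holds_up _ _ _ _ Hle) in H2; imp K; apply (mp H2); imp K1.
  exact (mp K (iff_r Ht K1)).
- intros w2 Hle2 Hi; apply H3; [exact (le_trans L _ _ _ Hle Hle2)|].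
  exact (iff_l (holds_up _ _ _ _ Hle2 Ht) Hi).
Qed.

Definition jnn (P : truth L) : truth jlogic.
Proof.
refine (@Truth jlogic (fun w => w ⊩ ¬ ¬ P) _); split; [apply holds_closed|].
intros v w Hv H; assert (K : w ⊩ inh V v ⇒ ¬ ¬ P) by (intros w' Hle; now apply H).
clear H; imp K1; apply (mp Hv); imp K2; exact (mp (mp K K2) K1).
Defined.

Definition jstr : structure jlogic :=
  Structure (fun x y => jnn (x ∈ y)) (fun x y => jnn (x ≐ y)).

Lemma jnn_i P w : (w ⊩ P) -> holds (jnn P) w.
Proof. intros H; change (w ⊩ ¬ ¬ P); imp K; exact (mp K H). Qed.

Lemma jmem_e x y (Q : truth jlogic) w : holds (jnn (x ∈ y)) w ->
  (forall w', le L w w' -> (w' ⊩ x ∈ y) -> holds Q w') -> holds Q w.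
Proof. apply j_small, (small_mem V HV). Qed.
Lemma jequ_e x y (Q : truth jlogic) w : holds (jnn (x ≐ y)) w ->
  (forall w', le L w w' -> (w' ⊩ x ≐ y) -> holds Q w') -> holds Q w.
Proof. apply j_small, (small_equ V HV). Qed.

Ltac jelim H :=
  let w' := fresh "w" in let Hle := fresh "Hle" in
  first [refine (jmem_e _ _ _ _ H _) | refine (jequ_e _ _ _ _ H _)];
  clear H; intros w' Hle H; move_to Hle.
Tactic Notation "jobtain" ident(x) ident(H) "from" constr(E) :=
  let w' := fresh "w" in let Hle := fresh "Hle" in
  refine (j_ex_e _ _ _ E _); try (is_var E; clear E); intros x w' Hle H; move_to Hle; cbv beta in H.

Lemma jstr_equality : equality jstr.
Proof.
split; cbn [jstr mem equ].
- intros x w; apply jnn_i, (eq_refl_ V HE).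
- intros x y w H; jelim H; now apply jnn_i, (eq_sym_ V HE).
- intros x y z w H H'; jelim H; jelim H'; now apply jnn_i, (eq_trans_ V HE x y).
- intros x y z w H H'; jelim H; jelim H'; now apply jnn_i, (eq_mem_l V HE x y).
- intros x y z w H H'; jelim H; jelim H'; now apply jnn_i, (eq_mem_r V HE x y).
Qed.

(** The double negation of small truth values, extended to all truth values. *)
Definition J (P : truth L) : truth L := ∃ v, (¬ ¬ inh V v) ∧ (inh V v ⇒ P).
Hint Unfold J : dfn.

Lemma dfn_J (P : env -> truth L) : dfn V P -> dfn V (fun r => J (P r)).
Proof.
intros H; apply (dfn_ex V (fun v r => (¬ ¬ inh V v) ∧ (inh V v ⇒ P r))).
assert (H' := dfn_subst V P (fun r k => r (Datatypes.S k)) H (tms_var _)).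
dfn.
Qed.
Lemma dfn_at P r : dfn V P -> dfn V (fun _ => P r).
Proof. intros H; apply (dfn_subst V P (fun _ => r) H), tms_const. Qed.

(** The sets that witness the inner modality are collected over the one that
    witnesses the outer modality, and united. *)
Lemma J_closed P : dfn V (fun _ => P) -> jclosed (holds (J P)).
Proof.
intros HP'; split; [apply holds_closed|].
intros v w Hv H; assert (K : w ⊩ inh V v ⇒ J P) by (intros w' Hle; now apply H); clear H.
assert (K1 : w ⊩ ∀ m, m ∈ v ⇒ ∃ u, (¬ ¬ inh V u) ∧ (inh V u ⇒ P)).
{ intros m; imp Hm; apply (mp K); exi m; auto. }
assert (HD : dfn2 V (fun m u => (¬ ¬ inh V u) ∧ (inh V u ⇒ P))).
{ unfold dfn2; repeat dfn_step. }
obtain B HB from (cz_coll V HV _ HD v w K1); dec.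
obtain u Hu from (cz_union V HV B w).
exi u; apply and_i.
- imp K2; apply (mp Hv); imp K3; dec.
  have G := (mp (HB x) K3); dec; apply (mp G0); imp K6; apply (mp K2); dec.
  exi x1; apply (iff_r (Hu x1)); exi x0; dec; auto.
- imp K2; dec; have G := (iff_l (Hu x) K2); dec; have F := (mp (HB0 x0) G); dec.
  apply (mp F1); exi x; auto.
Qed.

Lemma J_i P w : (w ⊩ P) -> w ⊩ J P.
Proof.
intros H; obtain c Hc from (singleton V HV 0 w); exi c; apply and_i; [|imp K; auto].
imp K; apply (mp K); exi 0; apply (iff_r (Hc 0)), (eq_refl_ V HE).
Qed.

Lemma J_e (P : truth L) (Q : truth jlogic) w : (w ⊩ J P) ->
  (forall w', le L w w' -> (w' ⊩ P) -> holds Q w') -> holds Q w.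
Proof.
intros H HQ; refine (j_ex_e _ _ _ H _); intros v w1 Hle Hv.
apply (j_elim Q v _ (and_l Hv)); intros w2 Hle2 Hi.
apply HQ; [exact (le_trans L _ _ _ Hle Hle2)|].
exact (mp (holds_up _ _ _ _ Hle2 (and_r Hv)) Hi).
Qed.

(** Existence in the new logic is expressed in the old one; hence the schemes for
    the new logic reduce to those for the old one. *)
Lemma forget_ex {I} (P : I -> truth jlogic) :
  dfn V (fun _ => tEx (fun i => forget (P i))) ->
  forget (tEx P) = J (tEx (fun i => forget (P i))).
Proof.
intros HD; apply truth_ext; intros w; split; intros H.
- refine (ex_e (Q := @Truth jlogic _ (J_closed _ HD)) H _); intros i w' Hle Hi.
  change (w' ⊩ J (tEx (fun i => forget (P i)))); apply J_i; exact (@ex_i L I (fun i => forget (P i)) w' i Hi).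
- change (holds (tEx P) w); apply (J_e _ _ _ H); intros w' Hle K.
  refine (j_ex_e _ _ _ K _); intros i w2 Hle2 Hi; exact (@ex_i jlogic I P w2 i Hi).
Qed.

Lemma forget_bot : forget ⊥ = ⊥.
Proof.
apply truth_ext; intros w; split; intros H.
- assert (C : jclosed (holds (⊥ : truth L))).
  { split; [apply holds_closed|]; intros v w' Hv K; apply (mp Hv); exact K. }
  exact (bot_e (Q := @Truth jlogic _ C) H).
- exact (bot_e (Q := forget ⊥) H).
Qed.

Lemma forget_nn P : forget (jnn P) = (¬ ¬ P).
Proof. now apply truth_ext. Qed.
Lemma forget_and P Q : forget (P ∧ Q) = (forget P ∧ forget Q).
Proof.
apply truth_ext; intros w; split; intros H.
- exact (and_i (P := forget P) (Q := forget Q) (and_l H) (and_r H)).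
- exact (and_i (P := P) (Q := Q) (and_l H) (and_r H)).
Qed.
Lemma forget_imp P Q : forget (P ⇒ Q) = (forget P ⇒ forget Q).
Proof. now apply truth_ext. Qed.
Lemma forget_all P : forget (∀ x, P x) = (∀ x, forget (P x)).
Proof. now apply truth_ext. Qed.

Lemma dfn_forget p : forall E, tms E -> dfn V (fun r => forget (sem jstr p (E r))).
Proof.
induction p; intros E HE'.
- apply (dfn_eq V (fun r => ¬ ¬ (E r n ∈ E r n0))); [intros r; apply forget_nn|dfn].
- apply (dfn_eq V (fun r => ¬ ¬ (E r n ≐ E r n0))); [intros r; apply forget_nn|dfn].
- cbn [sem]; rewrite forget_bot; dfn.
- apply (dfn_eq V (fun r => forget (sem jstr p1 (E r)) ∧ forget (sem jstr p2 (E r))));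
    [intros r; apply forget_and|].
  apply dfn_and; auto.
- assert (H : dfn V (fun r => forget (sem jstr p1 (E r)) ∨ forget (sem jstr p2 (E r))))
    by (apply dfn_or; auto).
  apply (dfn_eq V (fun r => J (forget (sem jstr p1 (E r)) ∨ forget (sem jstr p2 (E r)))));
    [|now apply dfn_J]; intros r; cbn [sem].
  unfold tOr; rewrite forget_ex.
  + do 2 f_equal; apply functional_extensionality; now intros [|].
  + apply (dfn_at _ r) in H; cbv beta in H.
    replace (tEx _) with (forget (sem jstr p1 (E r)) ∨ forget (sem jstr p2 (E r))); auto.
    unfold tOr; f_equal; apply functional_extensionality; now intros [|].
- apply (dfn_eq V (fun r => forget (sem jstr p1 (E r)) ⇒ forget (sem jstr p2 (E r))));
    [intros r; apply forget_imp|].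
  apply dfn_imp; auto.
- apply (dfn_eq V (fun r => ∀ x, forget (sem jstr p (x .: E r)))); [intros r; apply forget_all|].
  apply (dfn_all V (fun x r => forget (sem jstr p (x .: E r)))), (IHp (fun r => r 0 .: E _)).
  apply tms_cons; [tm|]; apply (tms_comp E _ HE'), tms_var.
- assert (H : dfn V (fun r => ∃ x, forget (sem jstr p (x .: E r)))).
  { apply (dfn_ex V (fun x r => forget (sem jstr p (x .: E r)))), (IHp (fun r => r 0 .: E _)).
    apply tms_cons; [tm|]; apply (tms_comp E _ HE'), tms_var. }
  apply (dfn_eq V (fun r => J (∃ x, forget (sem jstr p (x .: E r))))); [|now apply dfn_J].
  intros r; cbn [sem].
  apply forget_ex; exact (dfn_at _ r H).
Qed.

Lemma jstr_dfn P : dfn jstr P -> dfn V (fun r => forget (P r)).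
Proof.
intros (p & e & H).
apply (dfn_eq V (fun r => forget (sem jstr p (fun k => val (e k) r)))).
- intros r; now rewrite H.
- apply dfn_forget; now exists e.
Qed.

Lemma small_forget p : Delta0 p -> forall r w, w ⊩ small V (forget (sem jstr p r)).
Proof.
assert (nn : forall P w, (w ⊩ small V P) -> w ⊩ small V (¬ ¬ P))
  by (intros; now do 2 apply (small_not V HV)).
assert (nnj : forall (P : truth L) (Q : truth jlogic) w, (w ⊩ small V P) ->
  (forall w', (w' ⊩ P) -> holds Q w') ->
  (forall w', holds Q w' -> holds (jnn P) w') -> w ⊩ small V (forget Q)).
{ intros P Q w H1 H2 H3; apply (small_iff V (¬ ¬ P)); [now apply nn|].
  apply and_i; imp K; [|exact (H3 _ K)].
  apply (j_small P Q _ H1 K); auto. }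
induction 1; intros r w.
- cbn [sem jstr mem]; rewrite forget_nn; apply nn, (small_mem V HV).
- cbn [sem jstr equ]; rewrite forget_nn; apply nn, (small_equ V HV).
- cbn [sem]; rewrite forget_bot; apply (small_bot V HV).
- cbn [sem]; rewrite forget_and; exact (small_and V HV _ _ w (IHDelta0_1 r w) (IHDelta0_2 r w)).
- apply (nnj (forget (sem jstr p r) ∨ forget (sem jstr q r))).
  + exact (small_or V HV _ _ w (IHDelta0_1 r w) (IHDelta0_2 r w)).
  + intros w' K; refine (j_ex_e _ _ _ K _); intros [|] w2 Hle K2; [apply or_l | apply or_r]; exact K2.
  + intros w' K; refine (or_e K _ _); intros w2 Hle K2; apply jnn_i; [apply or_l | apply or_r]; exact K2.
- cbn [sem]; rewrite forget_imp; exact (small_imp V HV _ _ w (IHDelta0_1 r w) (IHDelta0_2 r w)).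
- apply (small_iff V (∀ x, x ∈ r t ⇒ forget (sem jstr p (x .: r)))).
  + apply (small_all V HV); [exact (dfn_forget p (fun s => s 0 .: r) ltac:(tms))|].
    intros x; imp Hx; apply IHDelta0.
  + apply and_i; imp K.
    * change (holds (∀ x, jnn (x ∈ r t) ⇒ sem jstr p (x .: r)) w); intros x; imp Hx.
      jelim Hx; exact (mp (K x) Hx).
    * change (holds (∀ x, jnn (x ∈ r t) ⇒ sem jstr p (x .: r)) w) in K; intros x; imp Hx.
      exact (mp (K x) (jnn_i _ _ Hx)).
- apply (nnj (∃ x, x ∈ r t ∧ forget (sem jstr p (x .: r)))).
  + apply (small_ex V HV); [exact (dfn_forget p (fun s => s 0 .: r) ltac:(tms))|].
    intros x; imp Hx; apply IHDelta0.
  + intros w' K; jobtain x Hx from K; exi x; apply and_i; [apply jnn_i, (and_l Hx)|].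
    exact (and_r Hx).
  + intros w' K; cbn in K; obtain x Hx from K; dec; jelim Hx; apply jnn_i; exi x.
    apply and_i; auto.
Qed.

Lemma j_or_e (P Q : truth L) (R : truth jlogic) w : (w ⊩ P ∨ Q) ->
  (forall w', le L w w' -> (w' ⊩ P) -> holds R w') ->
  (forall w', le L w w' -> (w' ⊩ Q) -> holds R w') -> holds R w.
Proof. intros H H1 H2; apply (j_ex_e _ _ _ H); intros [|]; auto. Qed.

Ltac dfn_more ::=
  match goal with
  | H : dfn2 ?S (fun x y => forget (?P x y)) |- dfn ?S (fun r => forget (?P (@?t r) (@?s r))) =>
      apply (dfn2_app S (fun x y => forget (P x y)) t s H); tm
  end.

(** A set of values witnessing the classical existence for each element of [a]
    is collected first, so that no choice is needed. *)
Lemma j_coll P : dfn2 jstr P -> forall a w,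
  holds (∀ x, mem jstr x a ⇒ ∃ y, P x y) w ->
  holds (∃ b, (∀ x, mem jstr x a ⇒ ∃ y, mem jstr y b ∧ P x y)
            ∧ (∀ y, mem jstr y b ⇒ ∃ x, mem jstr x a ∧ P x y)) w.
Proof.
intros HP' a w H.
assert (HD : dfn2 V (fun x y => forget (P x y))) by exact (jstr_dfn _ HP').
pose (R x v := (¬ ¬ inh V v) ∧ ∀ y, y ∈ v ⇒ forget (P x y)).
assert (H1 : w ⊩ ∀ x, x ∈ a ⇒ ∃ v, R x v).
{ intros x; imp Hx; have K := (mp (H x) (jnn_i _ _ Hx)).
  change (w ⊩ forget (∃ y, P x y)) in K; rewrite forget_ex in K.
  2: { dfn. }
  unfold J in K; obtain u Hu from K; dec.
  assert (K : w ⊩ ∀ m, m ∈ u ⇒ ∃ y, forget (P x y)).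
  { intros m; imp Hm; apply (mp Hu0); exi m; auto. }
  obtain v Hv from (cz_coll V HV (fun m y => forget (P x y)) ltac:(dfn) u w K).
  exi v; apply and_i.
  - imp N; apply (mp Hu); imp M; obtain m Hm from M.
    have G := (mp (and_l Hv m) Hm); apply (mp N); obtain y Hy from G; exi y; exact (and_l Hy).
  - intros y; imp Hy; have G := (mp (and_r Hv y) Hy); obtain m Hm from G; exact (and_r Hm). }
jobtain B HB from (cz_coll V HV R ltac:(unfold R; dfn) a w H1).
jobtain u Hu from (cz_union V HV B w).
exi u; apply and_i.
- intros x; imp Hx; cbn in Hx; jelim Hx; have G := (mp (and_l HB x) Hx).
  jobtain v Hv from G; apply (j_elim _ v _ (and_l (and_r Hv))).
  intros w' Hle Hi; move_to Hle; jobtain y Hy from Hi; exi y; apply and_i.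
  + apply jnn_i, (iff_r (Hu y)); exi v; exact (and_i (and_l Hv) Hy).
  + exact (mp (and_r (and_r Hv) y) Hy).
- intros y; imp Hy; cbn in Hy; jelim Hy; have G := (iff_l (Hu y) Hy).
  jobtain v Hv from G; have F := (mp (and_r HB v) (and_l Hv)).
  jobtain x Hx from F; exi x; apply and_i; [exact (jnn_i _ _ (and_l Hx))|].
  exact (mp (and_r (and_r Hx) y) (and_r Hv)).
Qed.

(** Subset collection follows from strong collection: the power set of [b] has all
    images that may be needed. *)
Theorem jstr_czf_minus : czf_minus jstr.
Proof.
split; cbn [jstr mem equ].
- apply jstr_equality.
- intros a b w; jobtain c Hc from (cz_pair V HV a b w); exi c; intros x; apply and_i; imp K.
  + jelim K; have K' := (iff_l (Hc x) K); apply (j_or_e _ _ _ _ K'); intros w' Hle G.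
    * exact (or_l (jnn_i _ _ G)).
    * exact (or_r (jnn_i _ _ G)).
  + cases K; jelim K; apply jnn_i, (iff_r (Hc x)); [now apply or_l | now apply or_r].
- intros a w; jobtain u Hu from (cz_union V HV a w); exi u; intros x; apply and_i; imp K.
  + jelim K; have K' := (iff_l (Hu x) K); jobtain y Hy from K'; exi y.
    apply and_i; [exact (jnn_i _ _ (and_l Hy)) | exact (jnn_i _ _ (and_r Hy))].
  + obtain y Hy from K; dec; jelim Hy; jelim Hy0.
    apply jnn_i, (iff_r (Hu x)); exi y; apply and_i; auto.
- intros w; jobtain a Ha from (cz_inf V HV w); exi a; apply and_i.
  + have K := (and_l Ha); jobtain e He from K; exi e; apply and_i; [exact (jnn_i _ _ (and_l He))|].
    intros z; imp Hz; jelim Hz; exact (bot_e (Q := forget ⊥) (mp (and_r He z) Hz)).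
  + intros x; imp Hx; jelim Hx; have K := (mp (and_r Ha x) Hx); jobtain y Hy from K.
    exi y; apply and_i; [exact (jnn_i _ _ (and_l Hy))|].
    intros z; apply and_i; imp G.
    * jelim G; apply (j_or_e _ _ _ _ (iff_l (and_r Hy z) G)); intros w' Hle F.
      -- exact (or_l (jnn_i _ _ F)).
      -- exact (or_r (jnn_i _ _ F)).
    * cases G; jelim G; apply jnn_i, (iff_r (and_r Hy z)); [now apply or_l | now apply or_r].
- intros P HP' w H.
  apply (cz_ind V HV (fun x => forget (P x)) (jstr_dfn _ HP') w); intros a; imp K.
  apply (mp (H a)); intros x; imp Hx; jelim Hx; exact (mp (K x) Hx).
- intros p r Hp a w.
  jobtain b Hb from (sep_small V HV (fun x => forget (sem jstr p (x .: r))) a w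
    (dfn_forget p (fun s => s 0 .: r) ltac:(tms)) (fun x w' _ _ => small_forget p Hp _ w')).
  exi b; intros x; apply and_i; imp K.
  + jelim K; have K' := (iff_l (Hb x) K); apply and_i; [exact (jnn_i _ _ (and_l K'))|].
    exact (and_r K').
  + have K1 := (and_l K); have K2 := (and_r K); jelim K1.
    apply jnn_i, (iff_r (Hb x)); exact (and_i (Q := forget _) K1 K2).
- exact j_coll.
- intros P HP' a b w; jobtain c Hc from (HP b w); exi c; intros u; imp H.
  obtain d Hd from (j_coll (fun x y => mem jstr y b ∧ P x y u) ltac:(dfn) a w H).
  cbn [jstr mem] in Hd.
  jobtain e He from (sep_small V HV (fun y => y ∈ b) d w ltac:(dfn)
    (fun x w' _ _ => small_mem V HV x b w')).
  exi e; repeat apply and_i.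
  + apply jnn_i, (iff_r (Hc e)); intros z; imp Hz; exact (and_r (iff_l (He z) Hz)).
  + intros x; imp Hx; have K := (mp (and_l Hd x) Hx); obtain y Hy from K; dec.
    jelim Hy; jelim Hy0; exi y; apply and_i; auto.
    apply jnn_i, (iff_r (He y)), and_i; auto.
  + intros y; imp Hy; jelim Hy; have K := (mp (and_r Hd y) (jnn_i _ _ (and_l (iff_l (He y) Hy)))).
    obtain x Hx from K; dec; exi x; apply and_i; auto.
Qed.

Lemma jstr_stable t w : holds (¬ ¬ inh jstr t) w -> holds (inh jstr t) w.
Proof.
intros H; apply (j_elim (inh jstr t) t).
- imp K; rewrite <- forget_bot; apply (mp (P := ¬ inh jstr t) H); imp G.
  obtain x Hx from G; cbn in Hx; jelim Hx.
  change (holds (forget ⊥) w); rewrite forget_bot; apply (mp K); exi x; auto.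
- intros w' Hle Hi; jobtain x Hx from Hi; exi x; now apply jnn_i.
Qed.

End Classical.

(** * Set-theoretic preliminaries for the forcing model *)

Section Pairs.
Context {L : logic} (V : structure L) (HV : czf_minus V) (HX : extensional V).
Local Notation "x '∈' y" := (mem V x y) (at level 70) : truth_scope.
Local Notation "x '≐' y" := (equ V x y) (at level 70) : truth_scope.
Let HE : equality V := cz_eq V HV.

Definition upair (c a b : nat) : truth L := ∀ t, t ∈ c ⇔ t ≐ a ∨ t ≐ b.
Definition opair (m a b : nat) : truth L := ∀ c, c ∈ m ⇔ upair c a a ∨ upair c a b.
Hint Unfold upair opair : dfn.

Lemma upair_unique c d a b w : (w ⊩ upair c a b) -> (w ⊩ upair d a b) -> w ⊩ c ≐ d.
Proof.
intros H1 H2; apply HX; intros t; apply and_i; imp K.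
- exact (iff_r (H2 t) (iff_l (H1 t) K)).
- exact (iff_r (H1 t) (iff_l (H2 t) K)).
Qed.

Lemma opair_unique m n a b w : (w ⊩ opair m a b) -> (w ⊩ opair n a b) -> w ⊩ m ≐ n.
Proof.
intros H1 H2; apply HX; intros t; apply and_i; imp K.
- exact (iff_r (H2 t) (iff_l (H1 t) K)).
- exact (iff_r (H1 t) (iff_l (H2 t) K)).
Qed.

Lemma upair_ex a b w : w ⊩ ∃ c, upair c a b.
Proof. exact (cz_pair V HV a b w). Qed.

Lemma upair_equ c d a b w : (w ⊩ upair c a b) -> (w ⊩ d ≐ c) -> w ⊩ upair d a b.
Proof.
intros H E; apply (equ_subst V HE (fun c => upair c a b) c); auto; [dfn|].
now apply (eq_sym_ V HE).
Qed.

Lemma opair_ex a b w : w ⊩ ∃ m, opair m a b.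
Proof.
obtain c Hc from (upair_ex a a w); obtain d Hd from (upair_ex a b w).
obtain m Hm from (cz_pair V HV c d w); exi m; intros t; apply and_i; imp K.
- have K' := (iff_l (Hm t) K); cases K'; [apply or_l | apply or_r];
    [now apply (upair_equ c) | now apply (upair_equ d)].
- apply (iff_r (Hm t)); cases K; [apply or_l | apply or_r];
    [now apply (upair_unique _ _ a a) | now apply (upair_unique _ _ a b)].
Qed.

Lemma upair_l c a b w : (w ⊩ upair c a b) -> w ⊩ a ∈ c.
Proof. intros H; apply (iff_r (H a)), or_l, (eq_refl_ V HE). Qed.
Lemma upair_r c a b w : (w ⊩ upair c a b) -> w ⊩ b ∈ c.
Proof. intros H; apply (iff_r (H b)), or_r, (eq_refl_ V HE). Qed.
Lemma upair_in c a b t w : (w ⊩ upair c a b) -> (w ⊩ t ∈ c) -> w ⊩ t ≐ a ∨ t ≐ b.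
Proof. intros H; exact (iff_l (H t)). Qed.
Lemma upair_in1 c a t w : (w ⊩ upair c a a) -> (w ⊩ t ∈ c) -> w ⊩ t ≐ a.
Proof. intros H K; have K' := (upair_in _ _ _ _ _ H K); cases K'; auto. Qed.

Lemma opair_inj1 m a b a' b' w : (w ⊩ opair m a b) -> (w ⊩ opair m a' b') -> w ⊩ a ≐ a'.
Proof.
intros H H'; obtain c Hc from (upair_ex a a w).
have K := (iff_l (H' c) (iff_r (H c) (or_l Hc))); apply (eq_sym_ V HE); cases K.
- exact (upair_in1 _ _ _ _ Hc (upair_l _ _ _ _ K)).
- exact (upair_in1 _ _ _ _ Hc (upair_l _ _ _ _ K)).
Qed.

Lemma opair_inj2 m a b a' b' w : (w ⊩ opair m a b) -> (w ⊩ opair m a' b') -> w ⊩ b ≐ b'.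
Proof.
intros H H'; have Ea := (opair_inj1 _ _ _ _ _ _ H H').
assert (sy : forall x y w, (w ⊩ x ≐ y) -> w ⊩ y ≐ x) by (intros ? ? ?; apply (eq_sym_ V HE)).
assert (tr : forall x y z w, (w ⊩ x ≐ y) -> (w ⊩ y ≐ z) -> w ⊩ x ≐ z)
  by (intros ? ? ? ?; apply (eq_trans_ V HE)).
obtain d Hd from (upair_ex a b w); obtain d' Hd' from (upair_ex a' b' w).
have K := (iff_l (H' d) (iff_r (H d) (or_r Hd))).
have K' := (iff_l (H d') (iff_r (H' d') (or_r Hd'))).
have B := (upair_r _ _ _ _ Hd); have B' := (upair_r _ _ _ _ Hd').
cases K.
- have E1 := (upair_in1 _ _ _ _ K B); cases K'.
  + have E2 := (upair_in1 _ _ _ _ K' B'); apply (tr _ a'); auto; apply (tr _ a); auto.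
  + have E2 := (upair_in _ _ _ _ _ K' B'); cases E2; auto.
    apply (tr _ a'); auto; apply (tr _ a); auto.
- have E1 := (upair_in _ _ _ _ _ K B); cases E1; auto.
  have E2 := (upair_in _ _ _ _ _ Hd (upair_r _ _ _ _ K)); cases E2; auto.
  apply (tr _ a'); auto; apply (tr _ a); auto.
Qed.

Lemma small_opair m a b w : w ⊩ small V (opair m a b).
Proof.
obtain n Hn from (opair_ex a b w).
apply (small_iff V (m ≐ n)); [apply (small_equ V HV)|]; apply and_i; imp K.
- apply (equ_subst V HE (fun m => opair m a b) n); auto; [dfn|]; now apply (eq_sym_ V HE).
- now apply (opair_unique _ _ a b).
Qed.

Lemma product A B w : w ⊩ ∃ Z, ∀ m, m ∈ Z ⇔ ∃ x, x ∈ A ∧ ∃ y, y ∈ B ∧ opair m x y.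
Proof.
apply (image V HV (fun x m => ∃ y, y ∈ B ∧ opair m x y)); [dfn|].
intros x; imp Hx; apply (image V HV (fun y m => opair m x y)); [dfn|].
intros y; imp Hy; obtain n Hn from (opair_ex x y w); obtain s Hs from (singleton V HV n w).
exi s; intros m; apply and_i; imp K.
- apply (equ_subst V HE (fun m => opair m x y) n); auto; [dfn|].
  exact (eq_sym_ V HE _ _ _ (iff_l (Hs m) K)).
- apply (iff_r (Hs m)); now apply (opair_unique _ _ x y).
Qed.

(** No ordered pair is plain, whereas zero and the other natural numbers are. *)
Definition plain (z : nat) : truth L := (∀ t, ¬ t ∈ z) ∨ ∃ e, e ∈ z ∧ ∀ t, ¬ t ∈ e.
Hint Unfold plain : dfn.

Lemma opair_not_plain m a b w : (w ⊩ opair m a b) -> (w ⊩ plain m) -> w ⊩ ⊥.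
Proof.
intros H K; unfold plain in K; cases K.
- obtain c Hc from (upair_ex a a w); exact (mp (K c) (iff_r (H c) (or_l Hc))).
- obtain e He from K; have K' := (iff_l (H e) (and_l He)); cases K';
    exact (mp (and_r He a) (upair_l _ _ _ _ K')).
Qed.

Lemma small_empty z w : w ⊩ small V (∀ t, ¬ t ∈ z).
Proof.
apply (small_iff V (¬ inh V z)); [apply (small_not V HV), (small_inh V)|].
apply and_i; imp K.
- intros t; imp Ht; apply (mp K); exi t; auto.
- imp K1; obtain t Ht from K1; exact (mp (K t) Ht).
Qed.

Lemma small_plain z w : w ⊩ small V (plain z).
Proof.
apply (small_or V HV); [apply small_empty|]; apply (small_ex V HV); [dfn|].
intros e; imp He; apply small_empty.
Qed.

Lemma small_sub a b w : w ⊩ small V (sub V a b).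
Proof. apply (small_all V HV); [dfn|]; intros x; imp Hx; apply (small_mem V HV). Qed.

Lemma not_mem_self x w : w ⊩ ¬ x ∈ x.
Proof.
revert w x; apply (cz_set_ind V HV); [dfn|]; intros w x H; imp K; exact (mp (mp (H x) K) K).
Qed.

(** The second component of a pair in [a] lies three membership steps below [a]. *)
Lemma deep_ind C : dfn1 V C ->
  (forall w a, (w ⊩ ∀ x, (x ∈ a ∨ ∃ m, m ∈ a ∧ ∃ c, c ∈ m ∧ x ∈ c) ⇒ C x) -> w ⊩ C a) ->
  forall w a, w ⊩ C a.
Proof.
intros HC H w a.
assert (K : forall w a, w ⊩ C a ∧ (∀ b, b ∈ a ⇒ C b) ∧ ∀ b, b ∈ a ⇒ ∀ c, c ∈ b ⇒ C c);
  [|exact (and_l (K w a))].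
apply (cz_set_ind V HV); [dfn|]; clear w a; intros w a IH; repeat apply and_i.
- apply H; intros x; imp K; cases K; [exact (and_l (mp (IH x) K))|]; dec.
  exact (mp (mp (and_r (and_r (mp (IH x0) K)) x1) K0 x) K1).
- intros b; imp Hb; exact (and_l (mp (IH b) Hb)).
- intros b; imp Hb; exact (and_l (and_r (mp (IH b) Hb))).
Qed.

End Pairs.
#[global] Hint Unfold upair opair plain : dfn.

(** * Families of truth values that settle *)

Section Settling.
Context {L : logic} (V : structure L) (HV : czf_minus V) (HX : extensional V) (HP : has_power V).
Local Notation "x '∈' y" := (mem V x y) (at level 70) : truth_scope.
Local Notation opair := (opair V).
Local Notation plain := (plain V).
Local Notation sub a b := (sub V a b).
Local Notation small := (small V).
Let HE : equality V := cz_eq V HV.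

(** [U] is increasing, and depends on the part of its argument in [k] only. *)
Definition settled (k : nat) (U : nat -> truth L) : truth L :=
  ∀ p q, (∀ i, i ∈ k ⇒ i ∈ p ⇒ i ∈ q) ⇒ U p ⇒ U q.
Definition settles (U : nat -> truth L) : truth L :=
  ∃ k, settled k U ∧ ∀ p, small (U p).
Hint Unfold settled settles : dfn.

Lemma sub_refl a w : w ⊩ sub a a.
Proof. intros x; imp H; auto. Qed.
Lemma sub_trans a b c w : (w ⊩ sub a b) -> (w ⊩ sub b c) -> w ⊩ sub a c.
Proof. intros H1 H2 x; imp H; exact (mp (H2 x) (mp (H1 x) H)). Qed.

Lemma settled_sub k l U w : (w ⊩ settled k U) -> (w ⊩ sub k l) -> w ⊩ settled l U.
Proof.
intros H1 H2 p q; imp Hpq; apply (mp (H1 p q)); intros i; imp Hi; exact (mp (Hpq i) (mp (H2 i) Hi)).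
Qed.

Lemma settled_mono k U p q w : (w ⊩ settled k U) -> (w ⊩ sub p q) -> (w ⊩ U p) -> w ⊩ U q.
Proof.
intros H1 H2; apply mp, (mp (H1 p q)); intros i; imp Hi; exact (H2 i).
Qed.

Lemma cup_l a b c w : (w ⊩ ∀ x, x ∈ c ⇔ x ∈ a ∨ x ∈ b) -> w ⊩ sub a c.
Proof. intros H x; imp K; exact (iff_r (H x) (or_l K)). Qed.
Lemma cup_r a b c w : (w ⊩ ∀ x, x ∈ c ⇔ x ∈ a ∨ x ∈ b) -> w ⊩ sub b c.
Proof. intros H x; imp K; exact (iff_r (H x) (or_r K)). Qed.

Lemma settles_iff U W w : (w ⊩ settles U) -> (w ⊩ ∀ p, U p ⇔ W p) -> w ⊩ settles W.
Proof.
intros H E; unfold settles in H; dec; exi x; apply and_i.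
- intros p q; imp K1 K2; exact (iff_l (E q) (mp (mp (H p q) K1) (iff_r (E p) K2))).
- intros p; exact (small_iff V _ _ _ (H0 p) (E p)).
Qed.

Lemma settles_const P w : (w ⊩ small P) -> w ⊩ settles (fun _ => P).
Proof. intros H; exi 0; apply and_i; [intros p q; imp K1 K2; auto | intros p; auto]. Qed.

Lemma settles_both U W w : (w ⊩ settles U) -> (w ⊩ settles W) ->
  w ⊩ ∃ k, (settled k U ∧ settled k W) ∧ ∀ p, small (U p) ∧ small (W p).
Proof.
unfold settles; intros H1 H2; obtain k Hk from H1; obtain l Hl from H2.
obtain c Hc from (cup V HV k l w); exi c; repeat apply and_i.
- apply (settled_sub k); [exact (and_l Hk) | now apply (cup_l k l)].
- apply (settled_sub l); [exact (and_l Hl) | now apply (cup_r k l)].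
- intros p; exact (and_i (and_r Hk p) (and_r Hl p)).
Qed.

Lemma settles_and U W w : (w ⊩ settles U) -> (w ⊩ settles W) ->
  w ⊩ settles (fun p => U p ∧ W p).
Proof.
intros H1 H2; obtain k Hk from (settles_both U W w H1 H2); dec; exi k; apply and_i.
- intros p q; imp K K1; apply and_i;
    [exact (mp (mp (Hk p q) K) (and_l K1)) | exact (mp (mp (Hk1 p q) K) (and_r K1))].
- intros p; apply (small_and V HV); [exact (and_l (Hk0 p)) | exact (and_r (Hk0 p))].
Qed.

Lemma settles_or U W w : (w ⊩ settles U) -> (w ⊩ settles W) ->
  w ⊩ settles (fun p => U p ∨ W p).
Proof.
intros H1 H2; obtain k Hk from (settles_both U W w H1 H2); dec; exi k; apply and_i.
- intros p q; imp K; imp K1; cases K1;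
    [exact (or_l (mp (mp (Hk p q) K) K1)) | exact (or_r (mp (mp (Hk1 p q) K) K1))].
- intros p; apply (small_or V HV); [exact (and_l (Hk0 p)) | exact (and_r (Hk0 p))].
Qed.

(** A quantifier over all later conditions reduces to the subsets of a set on
    which both sides have settled; this is where power sets come in. *)
Lemma settles_imp U W w : dfn1 V U -> dfn1 V W ->
  (w ⊩ settles U) -> (w ⊩ settles W) ->
  w ⊩ settles (fun p => ∀ q, sub p q ⇒ U q ⇒ W q).
Proof.
intros DU DW H1 H2; obtain k Hk from (settles_both U W w H1 H2); dec.
(* [U q] is raised to the union of [p] and [q], and [W] comes back to [q]. *)
assert (F : forall p q w, (w ⊩ settled k U) -> (w ⊩ settled k W) ->
  (w ⊩ ∀ i, i ∈ k ⇒ i ∈ p ⇒ i ∈ q) ->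
  (w ⊩ ∀ q, sub p q ⇒ U q ⇒ W q) -> (w ⊩ U q) -> w ⊩ W q).
{ clear w H1 H2 Hk Hk0 Hk1; intros p q w HU HW Hi H Uq.
  obtain c Hc from (cup V HV p q w).
  have Uc := (settled_mono _ _ _ _ _ HU (cup_r _ _ _ _ Hc) Uq).
  have Wc := (mp (mp (H c) (cup_l _ _ _ _ Hc)) Uc).
  refine (mp (mp (HW c q) _) Wc); intros i; imp Ik Ic.
  have G := (iff_l (Hc i) Ic); cases G; auto; exact (mp (mp (Hi i) Ik) G). }
exi k; apply and_i.
- intros p p'; imp K H; intros q; imp Sq Uq; apply (F p); auto.
  intros i; imp Ik Ip; exact (mp (Sq i) (mp (mp (K i) Ik) Ip)).
- intros p; obtain Z HZ from (HP k w).
  apply (small_iff V (∀ q, q ∈ Z ⇒ (∀ i, i ∈ k ⇒ i ∈ p ⇒ i ∈ q) ⇒ U q ⇒ W q)).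
  + apply (small_all V HV); [dfn|]; intros q; imp Hq.
    apply (small_imp V HV); [|apply (small_imp V HV)].
    * apply (small_all V HV); [dfn|]; intros i; imp Hi.
      apply (small_imp V HV); apply (small_mem V HV).
    * exact (and_l (Hk0 q)).
    * exact (and_r (Hk0 q)).
  + apply and_i; imp K; intros q.
    * imp Sq Uq.
      obtain r Hr from (sep_small V HV (fun i => i ∈ q) k w ltac:(dfn)
        (fun i w' _ _ => small_mem V HV i q w')).
      assert (Zr : w ⊩ r ∈ Z)
        by (apply (iff_r (HZ r)); intros i; imp Ir; exact (and_l (iff_l (Hr i) Ir))).
      assert (Ur : w ⊩ U r).
      { refine (mp (mp (Hk q r) _) Uq); intros i; imp Ik Iq; exact (iff_r (Hr i) (and_i Ik Iq)). }
      assert (Wr : w ⊩ W r).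
      { refine (mp (mp (mp (K r) Zr) _) Ur); intros i; imp Ik Ip.
        exact (iff_r (Hr i) (and_i Ik (mp (Sq i) Ip))). }
      refine (settled_mono _ _ _ _ _ Hk1 _ Wr); intros i; imp Ir; exact (and_r (iff_l (Hr i) Ir)).
    * imp Zq Sq Uq; now apply (F p).
Qed.

(** The bounds for the elements of [A] are collected, and [k] is their union. *)
Lemma settles_uniform A U w : dfn2 V U -> (w ⊩ ∀ x, x ∈ A ⇒ settles (U x)) ->
  w ⊩ ∃ k, ∀ x, x ∈ A ⇒ settled k (U x) ∧ ∀ p, small (U x p).
Proof.
intros DU H; pose (R x k := settled k (U x) ∧ ∀ p, small (U x p)).
obtain B HB from (cz_coll V HV R ltac:(unfold R; dfn) A w H).
obtain k Hk from (cz_union V HV B w); exi k; intros x; imp Hx.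
have G := (mp (and_l HB x) Hx); obtain l Hl from G; apply and_i.
- apply (settled_sub l); [exact (and_l (and_r Hl))|]; intros i; imp Hi.
  apply (iff_r (Hk i)); exi l; exact (and_i (and_l Hl) Hi).
- exact (and_r (and_r Hl)).
Qed.

Lemma settles_ex A U w : dfn2 V U -> (w ⊩ ∀ x, x ∈ A ⇒ settles (U x)) ->
  w ⊩ settles (fun p => ∃ x, x ∈ A ∧ U x p).
Proof.
intros DU H; obtain k Hk from (settles_uniform A U w DU H); exi k; apply and_i.
- intros p q; imp K1 K2; obtain x Hx from K2; exi x; apply and_i; [exact (and_l Hx)|].
  exact (mp (mp (and_l (mp (Hk x) (and_l Hx)) p q) K1) (and_r Hx)).
- intros p; apply (small_ex V HV); [dfn|]; intros x; imp Hx; exact (and_r (mp (Hk x) Hx) p).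
Qed.

Lemma settles_all A U w : dfn2 V U -> (w ⊩ ∀ x, x ∈ A ⇒ settles (U x)) ->
  w ⊩ settles (fun p => ∀ x, x ∈ A ⇒ U x p).
Proof.
intros DU H; obtain k Hk from (settles_uniform A U w DU H); exi k; apply and_i.
- intros p q; imp K1 K2; intros x; imp Hx.
  exact (mp (mp (and_l (mp (Hk x) Hx) p q) K1) (mp (K2 x) Hx)).
- intros p; apply (small_all V HV); [dfn|]; intros x; imp Hx; exact (and_r (mp (Hk x) Hx) p).
Qed.

(** * Names *)

(** A plain element belongs to a name at every condition, and the second
    component of a pair at the conditions that include the first one. *)
Definition listed (p z y : nat) : truth L :=
  (z ∈ y ∧ plain z) ∨
  ∃ m, m ∈ y ∧ ∃ c, c ∈ m ∧ ∃ q, q ∈ c ∧ opair m q z ∧ sub q p.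
Hint Unfold listed : dfn.

Lemma listed_i m q z y p w : (w ⊩ m ∈ y) -> (w ⊩ opair m q z) -> (w ⊩ sub q p) ->
  w ⊩ listed p z y.
Proof.
intros H1 H2 H3; apply or_r; exi m; apply and_i; auto.
obtain c Hc from (upair_ex V HV q q w); exi c; apply and_i.
- apply (iff_r (H2 c)), or_l, Hc.
- exi q; ands; exact (upair_l V HV _ _ _ _ Hc).
Qed.

Lemma listed_mono p p' z y w : (w ⊩ sub p p') -> (w ⊩ listed p z y) -> w ⊩ listed p' z y.
Proof.
intros H K; cases K; [now apply or_l|].
obtain m Hm from K; dech; apply (listed_i m x0); auto; now apply (sub_trans x0 p).
Qed.

Lemma listed_pairs p z y w : (w ⊩ ∀ m, m ∈ y ⇒ ∃ q z, opair m q z) ->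
  (w ⊩ listed p z y) -> w ⊩ ∃ m q, m ∈ y ∧ opair m q z ∧ sub q p.
Proof.
intros H K; cases K.
- have G := (mp (H z) (and_l K)); dech; exact (bot_e (opair_not_plain V HV _ _ _ _ G K0)).
- obtain m Hm from K; dech; exi m; exi x0; ands.
Qed.

Lemma listed_plain p z y w : (w ⊩ ∀ z, z ∈ y ⇒ plain z) -> w ⊩ listed p z y ⇔ z ∈ y.
Proof.
intros H; apply and_i; imp K; [|exact (or_l (and_i K (mp (H z) K)))].
cases K; [exact (and_l K)|]; dech.
exact (bot_e (opair_not_plain V HV _ _ _ _ K2 (mp (H x) K))).
Qed.

Lemma settles_listed z y w : w ⊩ settles (fun p => listed p z y).
Proof.
obtain u1 H1 from (cz_union V HV y w); obtain u2 H2 from (cz_union V HV u1 w).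
obtain u3 H3 from (cz_union V HV u2 w); exi u3; apply and_i.
- intros p p'; imp K1 K; cases K; [now apply or_l|].
  obtain m Hm from K; dech; apply (listed_i m x0); auto.
  intros i; imp Hi; refine (mp (mp (K1 i) _) (mp (Hm3 i) Hi)).
  apply (iff_r (H3 i)); exi x0; apply and_i; auto.
  apply (iff_r (H2 x0)); exi x; apply and_i; auto.
  apply (iff_r (H1 x)); exi m; apply and_i; auto.
- intros p; unfold listed; apply (small_or V HV).
  + apply (small_and V HV); [apply (small_mem V HV) | apply (small_plain V HV)].
  + do 3 (apply (small_ex V HV); [dfn|]; intros ?; let Hx := fresh in imp Hx).
    apply (small_and V HV); [now apply small_opair | apply (small_sub V HV)].
Qed.

Lemma listed_bound y w : w ⊩ ∃ A, ∀ p z, listed p z y ⇒ z ∈ A.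
Proof.
obtain u1 H1 from (cz_union V HV y w); obtain u2 H2 from (cz_union V HV u1 w).
obtain A HA from (cup V HV y u2 w); exi A; intros p z; imp K; apply (iff_r (HA z)).
cases K; [exact (or_l (and_l K))|]; apply or_r, (iff_r (H2 z)).
dech; obtain d Hd from (upair_ex V HV x1 z w); exi d; apply and_i.
- apply (iff_r (H1 d)); exi x; apply and_i; auto; apply (iff_r (K2 d)), or_r, Hd.
- exact (upair_r V HV _ _ _ _ Hd).
Qed.

(** Since [U x] settles, the pairs of [x] and a subset [q] of a bound [k] with
    [U x q] suffice, and they form a set. *)
Lemma name_ex A U w : dfn2 V U -> (w ⊩ ∀ x, x ∈ A ⇒ settles (U x)) ->
  w ⊩ ∃ b, (∀ m, m ∈ b ⇒ ∃ q x, opair m q x ∧ U x q) ∧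
           ∀ p x, listed p x b ⇔ x ∈ A ∧ U x p.
Proof.
intros DU H; obtain k Hk from (settles_uniform A U w DU H).
obtain K HK from (HP k w); obtain Z HZ from (product V HV HX K A w).
assert (Sm : w ⊩ ∀ m, m ∈ Z ⇒ small (∃ q, q ∈ K ∧ ∃ x, x ∈ A ∧ opair m q x ∧ U x q)).
{ intros m; imp Hm; apply (small_ex V HV); [dfn|]; intros q; imp Hq.
  apply (small_ex V HV); [dfn|]; intros x; imp Hx.
  apply (small_and V HV); [now apply small_opair | exact (and_r (mp (Hk x) Hx) q)]. }
obtain b Hb from (sep_small V HV (fun m => ∃ q, q ∈ K ∧ ∃ x, x ∈ A ∧ opair m q x ∧ U x q)
  Z w ltac:(dfn) Sm).
assert (Pb : w ⊩ ∀ m, m ∈ b ⇒ ∃ q x, opair m q x).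
{ intros m; imp Hm; have G := (and_r (iff_l (Hb m) Hm)); dech; exi x; exi x0; auto. }
exi b; apply and_i.
- intros m; imp Hm; have G := (and_r (iff_l (Hb m) Hm)); dech; exi x; exi x0; ands.
- intros p x; apply and_i; imp G.
  + have F := (listed_pairs p x b w Pb G); obtain m Hm from F; obtain q Hq from Hm; dech.
    have F := (and_r (iff_l (Hb m) Hq)); obtain q' Hq' from F; dech.
    have E1 := (opair_inj1 V HV _ _ _ _ _ _ Hq'1 Hq0).
    have E2 := (opair_inj2 V HV _ _ _ _ _ _ Hq'1 Hq0).
    have Ax := (eq_mem_l V HE _ _ _ _ E2 Hq'0); apply and_i; auto.
    apply (settled_mono k (U x) q); auto; [exact (and_l (mp (Hk x) Ax))|].
    apply (equ_subst V HE (fun q => U x q) q'); auto; [dfn|].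
    apply (equ_subst V HE (fun x => U x q') x0); auto; dfn.
  + dech; obtain q Hq from (sep_small V HV (fun i => i ∈ p) k w ltac:(dfn)
        (fun i w' _ _ => small_mem V HV i p w')).
    obtain m Hm from (opair_ex V HV HX q x w); apply (listed_i m q); auto.
    * assert (Kq : w ⊩ q ∈ K)
        by (apply (iff_r (HK q)); intros i; imp Hi; exact (and_l (iff_l (Hq i) Hi))).
      assert (Uq : w ⊩ U x q).
      { refine (mp (mp (and_l (mp (Hk x) G) p q) _) G0); intros i; imp Ik Ip.
        exact (iff_r (Hq i) (and_i Ik Ip)). }
      apply (iff_r (Hb m)), and_i; [apply (iff_r (HZ m))|]; exi q; ands; exi x; ands.
    * intros i; imp Hi; exact (and_r (iff_l (Hq i) Hi)).
Qed.

End Settling.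
#[global] Hint Unfold settled settles listed : dfn.

(** * Forcing with all sets as conditions *)

Lemma closed_ext {L : logic} (P Q : world L -> Prop) :
  (forall w, P w <-> Q w) -> closed L P -> closed L Q.
Proof.
intros H; replace Q with P; auto; apply functional_extensionality; intros w.
apply propositional_extensionality, H.
Qed.

Section Forcing.
Context {L : logic} (V : structure L) (HV : czf_minus V) (HX : extensional V) (HP : has_power V).
Local Notation "x '≐' y" := (equ V x y) (at level 70) : truth_scope.
Local Notation sub a b := (sub V a b).
Local Notation listed := (listed V).

(** A truth value is an increasing family of truth values of the old logic, indexed
    by sets. *)
Definition kle (a b : world L * nat) : Prop :=
  le L (fst a) (fst b) /\ (fst b ⊩ sub (snd a) (snd b)).
Definition kclosed (Q : world L * nat -> Prop) : Prop :=
  (forall a b, kle a b -> Q a -> Q b) /\ forall p, closed L (fun w => Q (w, p)).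

Definition klogic : logic.
Proof.
refine (Logic (world L * nat) kle _ _ kclosed _ _ _).
- intros [w p]; split; [apply le_refl | apply sub_refl].
- intros [u p] [v q] [w r] [H1 H2] [H3 H4]; split; cbn in *.
  + exact (le_trans L _ _ _ H1 H3).
  + apply (sub_trans V p q r); auto; exact (holds_up _ _ _ _ H3 H2).
- intros Q w w' [H _]; exact (H w w').
- intros I Q H; split.
  + intros a b Hab HQ i; exact (proj1 (H i) a b Hab (HQ i)).
  + intros p; apply closed_all; intros i; apply H.
- intros P Q HP' [HQ1 HQ2]; split.
  + intros [u p] [v q] [H1 H2] H [w r] [H3 H4] Hw; cbn in *; apply (H (w, r)); auto.
    split; cbn; [exact (le_trans L _ _ _ H1 H3)|].
    apply (sub_trans V p q r); auto; exact (holds_up _ _ _ _ H3 H2).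
  + intros p.
    apply (closed_ext (fun w => forall q w', le L w w' ->
      (w' ⊩ sub p q) /\ P (w', q) -> Q (w', q))).
    * intros w; split; intros H.
      -- intros [w' q] [H1 H2] H3; now apply H.
      -- intros q w' H1 [H2 H3]; apply H; auto; now split.
    * apply closed_all; intros q; apply closed_imp; auto.
      intros w w' H1 [H2 H3]; split; [exact (holds_up _ _ _ _ H1 H2)|].
      apply (HP' (w, q)); auto; split; auto; apply sub_refl.
Defined.

Definition slice (Q : truth klogic) (p : nat) : truth L :=
  @Truth L (fun w => holds Q (w, p)) (proj2 (holds_closed _ Q) p).

Definition raise (f : nat -> truth L)
  (Hf : forall p q w, (w ⊩ sub p q) -> (w ⊩ f p) -> w ⊩ f q) : truth klogic.
Proof.
refine (@Truth klogic (fun a => fst a ⊩ f (snd a)) _); split; cbn.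
- intros [w p] [w' q] [H1 H2] H; cbn in *.
  exact (Hf p q w' H2 (holds_up _ _ _ _ H1 H)).
- intros p; apply holds_closed.
Defined.

Lemma slice_raise f Hf p : slice (raise f Hf) p = f p.
Proof. now apply truth_ext. Qed.

Lemma slice_mono Q p q w : (w ⊩ sub p q) -> (w ⊩ slice Q p) -> w ⊩ slice Q q.
Proof.
intros H; apply (proj1 (holds_closed _ Q) (w, p) (w, q)); split; auto; apply le_refl.
Qed.

Lemma slice_all {I} (P : I -> truth klogic) p : slice (tAll P) p = tAll (fun i => slice (P i) p).
Proof. now apply truth_ext. Qed.

Lemma slice_imp P Q p : slice (P ⇒ Q) p = ∀ q, sub p q ⇒ slice P q ⇒ slice Q q.
Proof.
apply truth_ext; intros w; split; intros H.
- intros q w1 H1 H2 w2 H3 H4; apply (H (w2, q)); auto; split; cbn.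
  + exact (le_trans L _ _ _ H1 H3).
  + exact (holds_up _ _ _ _ H3 H2).
- intros [w1 q] [H1 H2] H3; exact (H q w1 H1 H2 w1 (le_refl _ _) H3).
Qed.

Lemma slice_and P Q p : slice (P ∧ Q) p = (slice P p ∧ slice Q p).
Proof.
unfold tAnd; rewrite slice_all; f_equal; apply functional_extensionality; now intros [|].
Qed.

Lemma slice_ex {I} (P : I -> truth klogic) p : slice (tEx P) p = tEx (fun i => slice (P i) p).
Proof.
apply truth_ext; intros w; split; intros H.
- assert (M : forall p q w, (w ⊩ sub p q) ->
    (w ⊩ tEx (fun i => slice (P i) p)) -> w ⊩ tEx (fun i => slice (P i) q)).
  { clear; intros p q w H K; refine (ex_e K _); intros i w' Hle Hi; apply (ex_i i).
    apply (slice_mono _ p); auto; exact (holds_up _ _ _ _ Hle H). }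
  refine (ex_e (Q := raise _ M) (w := (w, p)) H _); intros i [w' q] Hle Hi.
  exact (@ex_i L I (fun i => slice (P i) q) w' i Hi).
- change (w ⊩ slice (tEx P) p); refine (ex_e H _); intros i w' Hle Hi.
  exact (@ex_i klogic I P (w', p) i Hi).
Qed.

Lemma slice_or P Q p : slice (P ∨ Q) p = (slice P p ∨ slice Q p).
Proof.
unfold tOr; rewrite slice_ex; f_equal; apply functional_extensionality; now intros [|].
Qed.
Lemma slice_bot p : slice ⊥ p = ⊥.
Proof.
unfold tBot; rewrite slice_ex; f_equal; apply functional_extensionality; intros [].
Qed.
Lemma slice_iff P Q p : slice (P ⇔ Q) p = (slice (P ⇒ Q) p ∧ slice (Q ⇒ P) p).
Proof. apply slice_and. Qed.

Lemma slice_mp P Q p q w : (w ⊩ slice (P ⇒ Q) p) -> (w ⊩ sub p q) -> (w ⊩ slice P q) ->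
  w ⊩ slice Q q.
Proof. rewrite slice_imp; intros H H1 H2; exact (mp (mp (H q) H1) H2). Qed.

Definition kstr : structure klogic :=
  Structure (fun z y => raise (fun p => listed p z y) (fun p q w => listed_mono V HV p q z y w))
            (fun x y => raise (fun _ => x ≐ y) (fun _ _ _ _ H => H)).

Lemma slice_mem z y p : slice (mem kstr z y) p = listed p z y.
Proof. exact (slice_raise _ _ p). Qed.
Lemma slice_equ x y p : slice (equ kstr x y) p = (x ≐ y).
Proof. exact (slice_raise _ _ p). Qed.

Lemma dfn_slice p : forall E t, tms E -> tm t -> dfn V (fun r => slice (sem kstr p (E r)) (t r)).
Proof.
assert (T : forall t, tm t -> tms (fun r => t r .: r)).
{ intros t Ht; apply tms_cons; auto; apply (tms_var (fun k => k)). }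
assert (Q : forall P : nat -> env -> truth L, dfn V (fun r => P (r 0) (fun k => r (S k))) ->
   forall t, tm t -> dfn V (fun r => P (t r) r)).
{ intros P HP' t Ht; exact (dfn_subst V _ (fun r => t r .: r) HP' (T t Ht)). }
induction p; intros E t HE' Ht; cbn [sem].
- apply (dfn_eq V (fun r => listed (t r) (E r n) (E r n0))); [intros; apply slice_mem|].
  apply (Q (fun q r => listed q (E r n) (E r n0))); auto; dfn.
- apply (dfn_eq V (fun r => E r n ≐ E r n0)); [intros; apply slice_equ|dfn].
- apply (dfn_eq V (fun r => ⊥)); [intros; apply slice_bot|dfn].
- eapply dfn_eq; [intros; apply slice_and|]; apply dfn_and; auto.
- eapply dfn_eq; [intros; apply slice_or|]; apply dfn_or; auto.
- eapply dfn_eq; [intros; apply slice_imp|].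
  apply (Q (fun q r => ∀ q', sub q q' ⇒ slice (sem kstr p1 (E r)) q' ⇒ slice (sem kstr p2 (E r)) q'));
    auto.
  assert (HE2 : tms (fun r => E (fun k => r (S (S k))))) by apply (tms_comp E _ HE'), tms_var.
  assert (H1 := IHp1 _ (fun r => r 0) HE2 ltac:(tm)).
  assert (H2 := IHp2 _ (fun r => r 0) HE2 ltac:(tm)); dfn.
- eapply dfn_eq; [intros; apply slice_all|].
  apply (dfn_all V (fun x r => slice (sem kstr p (x .: E r)) (t r))).
  apply (IHp (fun r => r 0 .: E _) (fun r => t _)).
  + apply tms_cons; [tm|]; apply (tms_comp E _ HE'), tms_var.
  + destruct Ht as [[i|c] Ht]; [exists (inl (S i)) | exists (inr c)]; intros r; now rewrite Ht.
- eapply dfn_eq; [intros; apply slice_ex|].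
  apply (dfn_ex V (fun x r => slice (sem kstr p (x .: E r)) (t r))).
  apply (IHp (fun r => r 0 .: E _) (fun r => t _)).
  + apply tms_cons; [tm|]; apply (tms_comp E _ HE'), tms_var.
  + destruct Ht as [[i|c] Ht]; [exists (inl (S i)) | exists (inr c)]; intros r; now rewrite Ht.
Qed.

(** The condition becomes the first argument of a definable family. *)
Lemma kstr_dfn P : dfn kstr P -> dfn V (fun r => slice (P (fun k => r (S k))) (r 0)).
Proof.
intros (p & e & H).
apply (dfn_eq V (fun r => slice (sem kstr p (fun k => val (e k) (fun k => r (S k)))) (r 0))).
- intros r; now rewrite H.
- apply (dfn_slice p (fun r k => val (e k) (fun k => r (S k)))); [|tm].
  exists (fun k => match e k with inl i => inl (S i) | c => c end).
  intros r; apply functional_extensionality; intros k; now destruct (e k).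
Qed.

End Forcing.

(** * The axioms in the forcing model *)

Section ForcingAxioms.
Context {L : logic} (V : structure L) (HV : czf_minus V) (HX : extensional V) (HP : has_power V).
Local Notation "x '∈' y" := (mem V x y) (at level 70) : truth_scope.
Local Notation "x '≐' y" := (equ V x y) (at level 70) : truth_scope.
Local Notation opair := (opair V).
Local Notation plain := (plain V).
Local Notation sub a b := (sub V a b).
Local Notation listed := (listed V).
Local Notation settles := (settles V).
Local Notation kstr := (kstr V HV).
Local Notation slice := (slice V).
Let HE : equality V := cz_eq V HV.
Local Notation equ_sym := (eq_sym_ V HE).

Ltac kimp q Hq H := rewrite slice_imp; intros q; imp Hq H.

Ltac dfn_more ::=
  match goal with
  | |- dfn _ (fun r => slice (sem _ ?p (@?E r)) (@?t r)) =>
      apply (dfn_slice V HV p E t); [tms | tm]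
  | H : dfn2 ?S (fun q x => slice (?P x) q)
    |- dfn ?S (fun r => slice (?P (@?a r)) (@?t r)) =>
      apply (dfn2_app S (fun q x => slice (P x) q) t a H); tm
  | H : dfn3 ?S (fun q x y => slice (?P x y) q)
    |- dfn ?S (fun r => slice (?P (@?a r) (@?b r)) (@?t r)) =>
      apply (dfn3_app S (fun q x y => slice (P x y) q) t a b H); tm
  | H : dfn3 ?S (fun q x y => slice (?P x y ?u) q)
    |- dfn ?S (fun r => slice (?P (@?a r) (@?b r) ?u) (@?t r)) =>
      apply (dfn3_app S (fun q x y => slice (P x y u) q) t a b H); tm
  end.

Lemma kstr_equality : equality kstr.
Proof.
split.
- intros x [w p]; exact (eq_refl_ V HE x w).
- intros x y [w p]; exact (eq_sym_ V HE x y w).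
- intros x y z [w p]; exact (eq_trans_ V HE x y z w).
- intros x y a [w p] H1 H2.
  exact (equ_subst V HE (fun x => listed p x a) x y w ltac:(dfn) H1 H2).
- intros x a b [w p] H1 H2.
  exact (equ_subst V HE (fun a => listed p x a) a b w ltac:(dfn) H1 H2).
Qed.

Lemma check_ex A w : w ⊩ ∃ c, ∀ p x, listed p x c ⇔ x ∈ A.
Proof.
obtain c Hc from (name_ex V HV HX HP A (fun x _ => x ≐ x) w ltac:(dfn)
  (fun x w' _ _ => settles_const V (x ≐ x) w' (small_equ V HV x x w'))).
exi c; intros p x; apply and_i; imp K; [exact (and_l (iff_l (and_r Hc p x) K))|].
apply (iff_r (and_r Hc p x)), and_i; auto; apply (eq_refl_ V HE).
Qed.

(** Plain elements are turned into pairs, so that collection may range over the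
    set [n] of all listings in [a]. *)
Lemma listing a w : w ⊩ ∃ n, (∀ m, m ∈ n ⇒ ∃ q x, opair m q x ∧ listed q x a) ∧
  ∀ p x, listed p x a ⇒ ∃ m r, m ∈ n ∧ opair m r x ∧ sub r p.
Proof.
obtain A HA from (listed_bound V HV a w).
obtain n Hn from (name_ex V HV HX HP A (fun x q => listed q x a) w ltac:(dfn)
  (fun x w' _ _ => settles_listed V HV HX x a w')).
exi n; apply and_i; [exact (and_l Hn)|].
intros p x; imp K; apply (listed_pairs V HV).
- intros m; imp Hm; have G := (mp (and_l Hn m) Hm); dech; exi x0; exi x1; auto.
- exact (iff_r (and_r Hn p x) (and_i (mp (HA p x) K) K)).
Qed.

Lemma settles_eq U W w : (forall q, U q = W q) -> (w ⊩ settles W) -> w ⊩ settles U.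
Proof. intros H; now replace U with W by (apply functional_extensionality; auto). Qed.

(** Bounded formulas settle, because the elements ever listed in a name belong to
    one set and [settles_imp] bounds the later conditions. *)
Lemma settles_slice p : Delta0 p -> forall r w, w ⊩ settles (fun q => slice (sem kstr p r) q).
Proof.
induction 1; intros r w; cbn [sem AllIn ExIn].
- eapply settles_eq; [intros; apply slice_mem|]; now apply settles_listed.
- eapply settles_eq; [intros; apply slice_equ|]; apply settles_const, (small_equ V HV).
- eapply settles_eq; [intros; apply slice_bot|]; apply settles_const, (small_bot V HV).
- eapply settles_eq; [intros; apply slice_and|]; now apply settles_and.
- eapply settles_eq; [intros; apply slice_or|]; now apply settles_or.
- eapply settles_eq; [intros; apply slice_imp|]; apply settles_imp; auto; dfn.
- obtain A HA from (listed_bound V HV (r t) w).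
  apply (settles_iff V (fun q => ∀ x, x ∈ A ⇒
    ∀ q', sub q q' ⇒ listed q' x (r t) ⇒ slice (sem kstr p (x .: r)) q')).
  + apply (settles_all V HV A (fun x q =>
      ∀ q', sub q q' ⇒ listed q' x (r t) ⇒ slice (sem kstr p (x .: r)) q')); [dfn|].
    intros x; imp Hx; apply settles_imp; auto; try dfn; now apply settles_listed.
  + intros q; rewrite slice_all; apply and_i; imp K; intros x.
    * kimp q' Hq Hx; cbn [scons] in Hx; rewrite slice_mem in Hx.
      exact (mp (mp (mp (K x) (mp (HA q' x) Hx) q') Hq) Hx).
    * imp Ax; intros q'; imp Hq Hx; exact (slice_mp V _ _ q q' w (K x) Hq Hx).
- obtain A HA from (listed_bound V HV (r t) w).
  apply (settles_iff V (fun q => ∃ x, x ∈ A ∧ listed q x (r t) ∧ slice (sem kstr p (x .: r)) q)).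
  + apply (settles_ex V HV A (fun x q => listed q x (r t) ∧ slice (sem kstr p (x .: r)) q)); [dfn|].
    intros x; imp Hx; apply settles_and; auto.
    now apply settles_listed.
  + intros q; rewrite slice_ex; apply and_i; imp K; obtain x Hx from K; exi x.
    * rewrite slice_and; cbn [sem scons]; rewrite slice_mem; exact (and_r Hx).
    * rewrite slice_and in Hx; cbn [sem scons] in Hx; rewrite slice_mem in Hx; dech; ands.
      exact (mp (HA q x) Hx).
Qed.

Lemma slice_dfn2 P : dfn1 kstr P -> dfn2 V (fun q x => slice (P x) q).
Proof. exact (kstr_dfn V HV (fun r => P (r 0))). Qed.
Lemma slice_dfn3 P : dfn2 kstr P -> dfn3 V (fun q x y => slice (P x y) q).
Proof. exact (kstr_dfn V HV (fun r => P (r 0) (r 1))). Qed.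

Lemma kstr_pair a b q w : w ⊩ slice (∃ c, ∀ x, mem kstr x c ⇔ equ kstr x a ∨ equ kstr x b) q.
Proof.
rewrite slice_ex; obtain A HA from (cz_pair V HV a b w); obtain c Hc from (check_ex A w).
exi c; rewrite slice_all; intros x; rewrite slice_iff; apply and_i; kimp p Hp K.
- rewrite slice_mem in K; rewrite slice_or, !slice_equ; exact (iff_l (HA x) (iff_l (Hc p x) K)).
- rewrite slice_or, !slice_equ in K; rewrite slice_mem; exact (iff_r (Hc p x) (iff_r (HA x) K)).
Qed.

Lemma kstr_union a q w : w ⊩ slice (∃ u, ∀ x, mem kstr x u ⇔ ∃ y, mem kstr y a ∧ mem kstr x y) q.
Proof.
rewrite slice_ex; obtain A HA from (listed_bound V HV a w).
pose (R y B := ∀ p x, listed p x y ⇒ x ∈ B).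
obtain C HC from (cz_coll V HV R ltac:(unfold R; dfn) A w
  (fun y w' _ _ => listed_bound V HV y w')).
obtain B HB from (cz_union V HV C w).
assert (Bd : w ⊩ ∀ p x y, listed p y a ⇒ listed p x y ⇒ x ∈ B).
{ intros p x y; imp K1 K2; have G := (mp (and_l HC y) (mp (HA p y) K1)); obtain D HD from G.
  apply (iff_r (HB x)); exi D; apply and_i; [exact (and_l HD)|].
  exact (mp (and_r HD p x) K2). }
obtain u Hu from (name_ex V HV HX HP B (fun x p => ∃ y, y ∈ A ∧ listed p y a ∧ listed p x y) w
  ltac:(dfn) (fun x w' _ _ => settles_ex V HV A (fun y p => listed p y a ∧ listed p x y) w'
    ltac:(dfn) (fun y w2 _ _ => settles_and V HV _ _ w2
      (settles_listed V HV HX y a w2) (settles_listed V HV HX x y w2)))).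
exi u; rewrite slice_all; intros x; rewrite slice_iff; apply and_i; kimp p Hp K.
- rewrite slice_mem in K; rewrite slice_ex; have G := (and_r (iff_l (and_r Hu p x) K)).
  obtain y Hy from G; exi y; rewrite slice_and, !slice_mem; exact (and_r Hy).
- rewrite slice_ex in K; obtain y Hy from K; rewrite slice_and, !slice_mem in Hy; rewrite slice_mem.
  dech; apply (iff_r (Hu0 p x)), and_i; [exact (mp (mp (Bd p x y) Hy) Hy0)|].
  exi y; ands; exact (mp (HA p y) Hy).
Qed.

(** Natural numbers and their elements are plain, so they are their own names. *)
Lemma kstr_inf q w : w ⊩ slice (∃ a, (∃ e, mem kstr e a ∧ ∀ z, ¬ mem kstr z e) ∧
    ∀ x, mem kstr x a ⇒ ∃ y, mem kstr y a ∧ ∀ z, mem kstr z y ⇔ mem kstr z x ∨ equ kstr z x) q.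
Proof.
rewrite slice_ex; obtain b Hb from (cz_inf V HV w).
obtain a Ha from (sep_small V HV (fun x => plain x ∧ ∀ z, z ∈ x ⇒ plain z) b w ltac:(dfn)
  (fun x w' _ _ => small_and V HV _ _ w' (small_plain V HV x w')
    (small_all V HV plain x w' ltac:(dfn) (fun z w2 _ _ => small_plain V HV z w2)))).
assert (La : w ⊩ ∀ p x, listed p x a ⇔ x ∈ a).
{ intros p x; apply (listed_plain V HV); intros z; imp Hz.
  exact (and_l (and_r (iff_l (Ha z) Hz))). }
assert (Lx : w ⊩ ∀ x, x ∈ a ⇒ ∀ p z, listed p z x ⇔ z ∈ x).
{ intros x; imp Hx; intros p z; apply (listed_plain V HV).
  exact (and_r (and_r (iff_l (Ha x) Hx))). }
exi a; rewrite slice_and; apply and_i.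
- rewrite slice_ex; have G := (and_l Hb); obtain e He from G.
  assert (Ae : w ⊩ e ∈ a).
  { apply (iff_r (Ha e)); repeat apply and_i; [exact (and_l He) | apply or_l; exact (and_r He)|].
    intros z; imp Hz; exact (bot_e (mp (and_r He z) Hz)). }
  exi e; rewrite slice_and, slice_mem, slice_all; apply and_i; [exact (iff_r (La q e) Ae)|].
  intros z; unfold tNot; kimp p Hp K; rewrite slice_mem in K; rewrite slice_bot.
  exact (mp (and_r He z) (iff_l (mp (Lx e) Ae p z) K)).
- rewrite slice_all; intros x; kimp p Hp K; rewrite slice_mem in K; rewrite slice_ex.
  have Ax := (iff_l (La p x) K).
  have G := (mp (and_r Hb x) (and_l (iff_l (Ha x) Ax))); obtain y Hy from G.
  have Px := (and_r (iff_l (Ha x) Ax)).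
  assert (Ay : w ⊩ y ∈ a).
  { apply (iff_r (Ha y)); repeat apply and_i; [exact (and_l Hy)| |].
    - apply or_r; have Px' := (and_l Px); cases Px'.
      + exi x; apply and_i; auto; apply (iff_r (and_r Hy x)), or_r, (eq_refl_ V HE).
      + obtain e He from Px'; exi e; apply and_i; [|exact (and_r He)].
        exact (iff_r (and_r Hy e) (or_l (and_l He))).
    - intros z; imp Hz; have G := (iff_l (and_r Hy z) Hz); cases G; [exact (mp (and_r Px z) G)|].
      apply (equ_subst V HE plain x); [dfn | now apply equ_sym | exact (and_l Px)]. }
  exi y; rewrite slice_and, slice_mem, slice_all; apply and_i; [exact (iff_r (La p y) Ay)|].
  intros z; rewrite slice_iff; apply and_i; kimp r Hr G.
  + rewrite slice_mem in G; rewrite slice_or, slice_mem, slice_equ.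
    have G' := (iff_l (and_r Hy z) (iff_l (mp (Lx y) Ay r z) G)).
    cases G'; [apply or_l, (iff_r (mp (Lx x) Ax r z)), G' | now apply or_r].
  + rewrite slice_or, slice_mem, slice_equ in G; rewrite slice_mem.
    apply (iff_r (mp (Lx y) Ay r z)), (iff_r (and_r Hy z)).
    cases G; [apply or_l, (iff_l (mp (Lx x) Ax r z)), G | now apply or_r].
Qed.

Lemma kstr_ind P p w : dfn1 kstr P ->
  (w ⊩ slice (∀ a, (∀ x, mem kstr x a ⇒ P x) ⇒ P a) p) -> w ⊩ slice (∀ a, P a) p.
Proof.
intros HD H; have D := (slice_dfn2 P HD).
(* The assumption is made part of [C] to keep it available at later worlds. *)
pose (C a := (∀ a, ∀ q, sub p q ⇒ (∀ x, ∀ r, sub q r ⇒ listed r x a ⇒ slice (P x) r) ⇒ slice (P a) q)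
  ⇒ ∀ q, sub p q ⇒ slice (P a) q).
assert (K : w ⊩ ∀ a, C a).
{ intros a; clear H; revert w a; apply (deep_ind V HV); [unfold C; dfn|].
  intros w a IH; imp H; intros q; imp Hq; apply (mp (mp (H a q) Hq)).
  intros x r; imp Hr K; refine (mp (mp (mp (IH x) _) H r) _).
  - cases K; [exact (or_l (and_l K))|]; dech; apply or_r; exi x0.
    apply and_i; auto; obtain d Hd from (upair_ex V HV x2 x w); exi d; apply and_i.
    + apply (iff_r (K2 d)), or_r, Hd.
    + exact (upair_r V HV _ _ _ _ Hd).
  - exact (sub_trans V _ _ _ _ Hq Hr). }
rewrite slice_all; intros a; refine (mp (mp (K a) _ p) (sub_refl V p w)).
intros b q; imp Hq G; refine (slice_mp V _ _ p q w (H b) Hq _).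
rewrite slice_all; intros x; kimp r Hr F; rewrite slice_mem in F.
exact (mp (mp (G x r) Hr) F).
Qed.

Lemma kstr_sep p r : Delta0 p -> forall a q w,
  w ⊩ slice (∃ b, ∀ x, mem kstr x b ⇔ mem kstr x a ∧ sem kstr p (x .: r)) q.
Proof.
intros Hp a q w; rewrite slice_ex; obtain A HA from (listed_bound V HV a w).
obtain b Hb from (name_ex V HV HX HP A (fun x q => listed q x a ∧ slice (sem kstr p (x .: r)) q) w
  ltac:(dfn) (fun x w' _ _ => settles_and V HV _ _ w'
      (settles_listed V HV HX x a w') (settles_slice p Hp (x .: r) w'))).
exi b; rewrite slice_all; intros x; rewrite slice_iff; apply and_i; kimp s Hs K.
- rewrite slice_mem in K; rewrite slice_and, slice_mem; exact (and_r (iff_l (and_r Hb s x) K)).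
- rewrite slice_and, slice_mem in K; rewrite slice_mem.
  exact (iff_r (and_r Hb s x) (and_i (mp (HA s x) (and_l K)) K)).
Qed.

Lemma cup_lub s p q r w : (w ⊩ ∀ x, x ∈ s ⇔ x ∈ p ∨ x ∈ r) -> (w ⊩ sub p q) -> (w ⊩ sub r q) ->
  w ⊩ sub s q.
Proof.
intros H H1 H2 x; imp K; have G := (iff_l (H x) K); cases G;
  [exact (mp (H1 x) G) | exact (mp (H2 x) G)].
Qed.

Lemma sub_equ r s q w : (w ⊩ r ≐ s) -> (w ⊩ sub r q) -> w ⊩ sub s q.
Proof. intros H; apply (equ_subst V HE (fun r => sub r q) r s w ltac:(dfn) H). Qed.

(** Each listing of an element of [a] is answered at the least condition above
    [p] where it counts, so that a set of answers suffices for all conditions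
    above [p]. *)
Lemma kstr_coll P p a w : dfn2 kstr P ->
  (w ⊩ slice (∀ x, mem kstr x a ⇒ ∃ y, P x y) p) ->
  w ⊩ slice (∃ b, (∀ x, mem kstr x a ⇒ ∃ y, mem kstr y b ∧ P x y)
                ∧ (∀ y, mem kstr y b ⇒ ∃ x, mem kstr x a ∧ P x y)) p.
Proof.
intros HD H; have D := (slice_dfn3 P HD); obtain n Hn from (listing a w).
pose (R m m' := ∃ r x s y, opair m r x ∧ (∀ i, i ∈ s ⇔ i ∈ p ∨ i ∈ r) ∧ listed r x a ∧
  opair m' s y ∧ slice (P x y) s).
assert (HR : w ⊩ ∀ m, m ∈ n ⇒ ∃ m', R m m').
{ intros m; imp Hm; have G := (mp (and_l Hn m) Hm); obtain r Hr from G; obtain x Hx from Hr; dech.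
  obtain s Hs from (cup V HV p r w).
  assert (K : w ⊩ ∃ y, slice (P x y) s).
  { rewrite <- slice_ex; refine (slice_mp V _ _ p s w (H x) (cup_l V _ _ _ _ Hs) _).
    rewrite slice_mem; exact (listed_mono V HV _ _ _ _ _ (cup_r V _ _ _ _ Hs) Hx0). }
  obtain y Hy from K; obtain m' Hm' from (opair_ex V HV HX s y w).
  exi m'; exi r; exi x; exi s; exi y; ands. }
obtain b Hb from (cz_coll V HV R ltac:(unfold R; dfn) n w HR).
rewrite slice_ex; exi b; rewrite slice_and, !slice_all; apply and_i.
- intros x; kimp q Hq K; rewrite slice_mem in K.
  have G := (mp (and_r Hn q x) K); obtain m Hm from G; obtain r Hr from Hm; dech.
  have G := (mp (Hb m) Hr); obtain m' Hm' from G; dech; unfold R in Hm'0.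
  obtain r' H1 from Hm'0; obtain x' H2 from H1; obtain s H3 from H2; obtain y Hy from H3; dech.
  have E1 := (opair_inj1 V HV _ _ _ _ _ _ Hr0 Hy); have E2 := (opair_inj2 V HV _ _ _ _ _ _ Hr0 Hy).
  have Sq := (cup_lub _ _ _ _ _ Hy0 Hq (sub_equ _ _ _ _ E1 Hr1)).
  rewrite slice_ex; exi y; rewrite slice_and, slice_mem; apply and_i.
  + now apply (listed_i V HV m' s).
  + apply (equ_subst V HE (fun x => slice (P x y) q) x'); [dfn | now apply equ_sym|].
    now apply (slice_mono V _ s).
- intros y; kimp q Hq K; rewrite slice_mem in K.
  assert (Pb : w ⊩ ∀ m, m ∈ b ⇒ ∃ q x, opair m q x).
  { intros m'; imp Hm; have G := (mp (and_r Hb m') Hm); obtain m G' from G; dech; unfold R in G'0.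
    dech; exi x1; exi x2; auto. }
  have G := (listed_pairs V HV q y b w Pb K); obtain m' G' from G; obtain s0 Hs0 from G'; dech.
  have G := (mp (Hb0 m') Hs0); obtain m Hm from G; dech; unfold R in Hm0.
  obtain r' H1 from Hm0; obtain x H2 from H1; obtain s H3 from H2; obtain y' Hy from H3; dech.
  have E1 := (opair_inj1 V HV _ _ _ _ _ _ Hs1 Hy2); have E2 := (opair_inj2 V HV _ _ _ _ _ _ Hs1 Hy2).
  have Sq := (sub_equ _ _ _ _ E1 Hs2).
  rewrite slice_ex; exi x; rewrite slice_and, slice_mem; apply and_i.
  + apply (listed_mono V HV r'); auto; exact (sub_trans V _ _ _ _ (cup_r V _ _ _ _ Hy0) Sq).
  + apply (equ_subst V HE (fun y => slice (P x y) q) y'); [dfn | now apply equ_sym|].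
    now apply (slice_mono V _ s).
Qed.

(** The names for multi-valued functions are sets of pairs of a condition and an
    element; with the condition of the argument in the place of the one where
    the value is found, these pairs form a set that is independent of [u]. *)
Lemma kstr_subc P a b p w : dfn3 kstr P ->
  w ⊩ slice (∃ c, ∀ u, (∀ x, mem kstr x a ⇒ ∃ y, mem kstr y b ∧ P x y u) ⇒
      ∃ d, mem kstr d c ∧ (∀ x, mem kstr x a ⇒ ∃ y, mem kstr y d ∧ P x y u)
                        ∧ (∀ y, mem kstr y d ⇒ ∃ x, mem kstr x a ∧ P x y u)) p.
Proof.
intros HD; obtain n Hn from (listing a w); obtain B HB from (listed_bound V HV b w).
obtain u1 H1 from (cz_union V HV n w); obtain K HK from (cz_union V HV u1 w).
obtain Z HZ from (product V HV HX K B w); obtain Y HY from (HP Z w).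
obtain c Hc from (check_ex Y w).
rewrite slice_ex; exi c; rewrite slice_all; intros u; kimp q Hq H; clear Hq p.
assert (D : dfn3 V (fun q x y => slice (P x y u) q)).
{ apply (slice_dfn3 (fun x y => P x y u)); dfn. }
pose (R m m' := ∃ r x s y, opair m r x ∧ (∀ i, i ∈ s ⇔ i ∈ q ∨ i ∈ r) ∧ listed r x a ∧
  opair m' r y ∧ slice (P x y u) s ∧ m' ∈ Z).
assert (HR : w ⊩ ∀ m, m ∈ n ⇒ ∃ m', R m m').
{ intros m; imp Hm; have G := (mp (and_l Hn m) Hm); obtain r Hr from G; obtain x Hx from Hr; dech.
  obtain s Hs from (cup V HV q r w).
  assert (F : w ⊩ ∃ y, listed s y b ∧ slice (P x y u) s).
  { assert (G : w ⊩ slice (∃ y, mem kstr y b ∧ P x y u) s).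
    { refine (slice_mp V _ _ q s w (H x) (cup_l V _ _ _ _ Hs) _).
      rewrite slice_mem; exact (listed_mono V HV _ _ _ _ _ (cup_r V _ _ _ _ Hs) Hx0). }
    rewrite slice_ex in G; obtain y Hy from G; rewrite slice_and, slice_mem in Hy.
    exi y; auto. }
  obtain y Hy from F; dech; obtain m' Hm' from (opair_ex V HV HX r y w).
  exi m'; exi r; exi x; exi s; exi y; ands; apply (iff_r (HZ m')); exi r; apply and_i.
  - apply (iff_r (HK r)); obtain e He from (upair_ex V HV r r w); exi e; apply and_i.
    + apply (iff_r (H1 e)); exi m; apply and_i; auto; apply (iff_r (Hx e)), or_l, He.
    + exact (upair_l V HV _ _ _ _ He).
  - exi y; apply and_i; auto; exact (mp (HB s y) Hy). }
obtain d Hd from (cz_coll V HV R ltac:(unfold R; dfn) n w HR).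
assert (Dd : w ⊩ ∀ m', m' ∈ d ⇒ ∃ m, m ∈ n ∧ R m m') by exact (and_r Hd).
rewrite slice_ex; exi d; rewrite !slice_and, slice_mem, !slice_all; repeat apply and_i.
- apply (iff_r (Hc q d)), (iff_r (HY d)); intros m'; imp Hm'.
  have G := (mp (Dd m') Hm'); dech; unfold R in G0; dech; auto.
- intros x; kimp p Hp F; rewrite slice_mem in F.
  have G := (mp (and_r Hn p x) F); obtain m Hm from G; obtain r Hr from Hm; dech.
  have G := (mp (Hd m) Hr); obtain m' Hm' from G; dech; unfold R in Hm'0.
  obtain r' G1 from Hm'0; obtain x' G2 from G1; obtain s G3 from G2; obtain y Hy from G3; dech.
  have E1 := (opair_inj1 V HV _ _ _ _ _ _ Hr0 Hy); have E2 := (opair_inj2 V HV _ _ _ _ _ _ Hr0 Hy).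
  have Sr := (sub_equ _ _ _ _ E1 Hr1); have Sq := (cup_lub _ _ _ _ _ Hy0 Hp Sr).
  rewrite slice_ex; exi y; rewrite slice_and, slice_mem; apply and_i.
  + now apply (listed_i V HV m' r').
  + apply (equ_subst V HE (fun x => slice (P x y u) p) x'); [dfn | now apply equ_sym|].
    now apply (slice_mono V _ s).
- intros y; kimp p Hp F; rewrite slice_mem in F.
  assert (Pd : w ⊩ ∀ m, m ∈ d ⇒ ∃ q x, opair m q x).
  { intros m'; imp Hm; have G := (mp (Dd m') Hm); obtain m G' from G; dech; unfold R in G'0.
    dech; exi x; exi x2; auto. }
  have G := (listed_pairs V HV p y d w Pd F); obtain m' G' from G; obtain r Hr from G'; dech.
  have G := (mp (Dd m') Hr); obtain m Hm from G; dech; unfold R in Hm0.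
  obtain r' G1 from Hm0; obtain x G2 from G1; obtain s G3 from G2; obtain y' Hy from G3; dech.
  have E1 := (opair_inj1 V HV _ _ _ _ _ _ Hr0 Hy2); have E2 := (opair_inj2 V HV _ _ _ _ _ _ Hr0 Hy2).
  have Sr := (sub_equ _ _ _ _ E1 Hr1); have Sq := (cup_lub _ _ _ _ _ Hy0 Hp Sr).
  rewrite slice_ex; exi x; rewrite slice_and, slice_mem; apply and_i.
  + now apply (listed_mono V HV r').
  + apply (equ_subst V HE (fun y => slice (P x y u) p) y'); [dfn | now apply equ_sym|].
    now apply (slice_mono V _ s).
Qed.

Theorem kstr_czf_minus : czf_minus kstr.
Proof.
split.
- apply kstr_equality.
- intros a b [w p]; exact (kstr_pair a b p w).
- intros a [w p]; exact (kstr_union a p w).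
- intros [w p]; exact (kstr_inf p w).
- intros P HD [w p]; exact (kstr_ind P p w HD).
- intros q r Hq a [w p]; exact (kstr_sep q r Hq a p w).
- intros P HD a [w p]; exact (kstr_coll P p a w HD).
- intros P HD a b [w p]; exact (kstr_subc P a b p w HD).
Qed.

End ForcingAxioms.

(** * A set without a double complement *)

Section NonDoubleComplement.
Context {L : logic} (V : structure L) (HV : czf_minus V) (HX : extensional V) (HP : has_power V).
Local Notation "x '∈' y" := (mem V x y) (at level 70) : truth_scope.
Local Notation plain := (plain V).
Local Notation listed := (listed V).
Local Notation settles := (settles V).
Local Notation kstr := (kstr V HV).
Local Notation slice := (slice V).
Let HE : equality V := cz_eq V HV.
Let HK : czf_minus kstr := kstr_czf_minus V HV HX HP.

Ltac kimp q Hq H := rewrite slice_imp; intros q; imp Hq H.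

Lemma settles_inhabited v w : w ⊩ settles (fun q => ∃ t, listed q t v).
Proof.
obtain B HB from (listed_bound V HV v w).
apply (settles_iff V (fun q => ∃ t, t ∈ B ∧ listed q t v)).
- apply (settles_ex V HV B (fun t q => listed q t v)); [dfn|].
  intros t; imp Ht; now apply settles_listed.
- intros q; apply and_i; imp K; obtain t Ht from K; exi t; [exact (and_r Ht)|].
  apply and_i; auto; exact (mp (HB q t) Ht).
Qed.

Lemma settles_contains k w : w ⊩ settles (fun q => k ∈ q).
Proof.
obtain s Hs from (singleton V HV k w); exi s; apply and_i; [|intros q; apply (small_mem V HV)].
intros q q'; imp K; apply (mp (K k)), (iff_r (Hs k)), (eq_refl_ V HE).
Qed.

Lemma slice_half x y u p w : (w ⊩ slice (sim kstr x y) p) -> (w ⊩ listed p u x) ->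
  w ⊩ ∃ v, listed p v y ∧ slice (sim kstr u v) p.
Proof.
intros H K; assert (G : w ⊩ slice (∃ v, mem kstr v y ∧ sim kstr u v) p).
{ refine (slice_mp V (mem kstr u x) _ p p w (sim_half kstr x y (w, p) H u) (sub_refl V p w) _).
  now rewrite slice_mem. }
rewrite slice_ex in G; obtain v Hv from G; rewrite slice_and, slice_mem in Hv; exi v; auto.
Qed.

Lemma slice_fold x y p w :
  (w ⊩ ∀ q u, sub V p q ⇒ (listed q u x ⇔ listed q u y)) -> w ⊩ slice (sim kstr x y) p.
Proof.
intros H.
assert (F : forall a b w, (w ⊩ ∀ q u, sub V p q ⇒ listed q u a ⇒ listed q u b) ->
  w ⊩ slice (half kstr a b) p).
{ clear x y w H; intros a b w H; unfold half; rewrite slice_all; intros u; kimp q Hq K.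
  rewrite slice_mem in K; rewrite slice_ex; exi u; rewrite slice_and, slice_mem; apply and_i.
  - exact (mp (mp (H q u) Hq) K).
  - exact (sim_refl kstr HK (w, q) u). }
refine (sim_fold kstr HK x y (w, p) (F x y w _) (F y x w _)); intros q u; imp Hq K.
- exact (iff_l (mp (H q u) Hq) K).
- exact (iff_r (mp (H q u) Hq) K).
Qed.

(** The singleton [z] of zero that comes into being only at the conditions
    containing a fixed new element [k] is never distinct from zero and from one;
    but a name [y] to which it belonged at [p] would list a [v] similar to it,
    and whether [v] is inhabited does not depend on [k]. *)
Theorem kstr_NDCom r a : holds (sem (star kstr) NDCom r) a.
Proof.
destruct a as [w p]; cbn [NDCom sem star mem equ Neg scons].
change (w ⊩ slice (∃ x, ∀ y, ¬ ∀ z, ¬ ¬ smem kstr z x ⇒ smem kstr z y) p).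
have G := (cz_inf V HV w); obtain i0 G' from G; have G := (and_l G'); clear G'.
obtain e He from G; have Ze := (and_r He); clear He i0.
obtain one H1 from (singleton V HV e w); obtain two H2 from (cz_pair V HV e one w).
assert (Pe : w ⊩ plain e) by exact (or_l Ze).
assert (P1 : w ⊩ plain one).
{ apply or_r; exi e; apply and_i; auto; apply (iff_r (H1 e)), (eq_refl_ V HE). }
assert (Lone : w ⊩ ∀ q t, listed q t one ⇔ t ∈ one).
{ intros q t; apply (listed_plain V HV); intros x; imp Hx; apply (equ_subst V HE plain e);
    auto; [dfn | exact (eq_sym_ V HE _ _ _ (iff_l (H1 x) Hx))]. }
assert (Ltwo : w ⊩ ∀ q, listed q one two).
{ intros q; apply or_l, and_i; auto; apply (iff_r (H2 one)), or_r, (eq_refl_ V HE). }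
rewrite slice_ex; exi two; rewrite slice_all; intros y; unfold tNot at 1.
kimp q Hq H; clear Hq p; rename q into p; rewrite slice_bot.
obtain A HA from (listed_bound V HV y w).
(* The set [k] is a new element since it includes [p] and all that matters for
   the elements of [y], but is no element of itself. *)
obtain l Hl from (settles_uniform V HV A (fun v q => ∃ t, listed q t v) w ltac:(dfn)
  (fun v w' _ _ => settles_inhabited v w')).
obtain k Hk from (cup V HV l p w); obtain s Hs from (singleton V HV k w).
obtain z Hz from (name_ex V HV HX HP one (fun _ q => k ∈ q) w ltac:(dfn)
  (fun x w' _ _ => settles_contains k w')).
have Lz := (and_r Hz); clear Hz.
assert (N : w ⊩ slice (¬ ¬ smem kstr z two) p).
{ unfold tNot; kimp q Hq N; rewrite slice_bot.
  obtain q2 Hq2 from (cup V HV q s w).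
  assert (Mz : w ⊩ slice (smem kstr z two) q2).
  { unfold smem; rewrite slice_ex; exi one; rewrite slice_and, slice_mem; apply and_i;
      [exact (Ltwo q2)|].
    apply slice_fold; intros q' u; imp Hq' ; apply and_i; imp K.
    - exact (iff_r (Lone q' u) (and_l (iff_l (Lz q' u) K))).
    - apply (iff_r (Lz q' u)), and_i; [exact (iff_l (Lone q' u) K)|].
      apply (mp (Hq' k)), (iff_r (Hq2 k)), or_r, (iff_r (Hs k)), (eq_refl_ V HE). }
  have F := (slice_mp V _ _ q q2 w N (cup_l V _ _ _ _ Hq2) Mz); now rewrite slice_bot in F. }
have M := (slice_mp V _ _ p p w (H z) (sub_refl V p w) N).
unfold smem in M; rewrite slice_ex in M; obtain v Hv from M; rewrite slice_and, slice_mem in Hv.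
obtain p2 Hp2 from (cup V HV p s w).
have Kp2 := (mp (cup_r V _ _ _ _ Hp2 k) (iff_r (Hs k) (eq_refl_ V HE k w))).
assert (Ez : w ⊩ listed p2 e z).
{ apply (iff_r (Lz p2 e)), and_i; auto; apply (iff_r (H1 e)), (eq_refl_ V HE). }
have S2 := (slice_mono V _ p p2 w (cup_l V _ _ _ _ Hp2) (and_r Hv)).
have G := (slice_half z v e p2 w S2 Ez).
assert (I2 : w ⊩ ∃ t, listed p2 t v) by (obtain t Ht from G; exi t; exact (and_l Ht)).
have Sv := (and_l (mp (Hl v) (mp (HA p v) (and_l Hv)))).
assert (I : w ⊩ ∃ t, listed p t v).
{ refine (mp (mp (Sv p2 p) _) I2); intros i; imp Il Ip; have F := (iff_l (Hp2 i) Ip); cases F; auto.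
  have E := (iff_l (Hs i) F); apply (bot_e (L := L)), (mp (not_mem_self V HV k w)).
  exact (iff_r (Hk k) (or_l (eq_mem_l V HE _ _ _ _ E Il))). }
obtain t Ht from I.
have G2 := (slice_half v z t p w (sim_sym kstr z v (w, p) (and_r Hv)) Ht); obtain z' Hz' from G2.
apply (mp (not_mem_self V HV k w)), (iff_r (Hk k)), or_r.
exact (and_r (iff_l (Lz p z') (and_l Hz'))).
Qed.

End NonDoubleComplement.

(** * Power sets from a double complement *)

Section PowerSet.
Context {L : logic} (V : structure L) (HV : czf_minus V) (HX : extensional V).
Local Notation "x '∈' y" := (mem V x y) (at level 70) : truth_scope.
Local Notation "x '≐' y" := (equ V x y) (at level 70) : truth_scope.
Let HE : equality V := cz_eq V HV.
Local Notation equ_sym := (eq_sym_ V HE _ _ _).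

Lemma subsingleton x e t w : w ⊩ ∃ m, ∀ i, i ∈ m ⇔ i ≐ x ∧ e ∈ t.
Proof.
obtain c Hc from (singleton V HV x w).
obtain m Hm from (sep_small V HV (fun _ => e ∈ t) c w ltac:(dfn)
  (fun _ w' _ _ => small_mem V HV e t w')).
exi m; intros i; apply and_i; imp K.
- have G := (iff_l (Hm i) K); apply and_i; [exact (iff_l (Hc i) (and_l G)) | exact (and_r G)].
- apply (iff_r (Hm i)), and_i; [exact (iff_r (Hc i) (and_l K)) | exact (and_r K)].
Qed.

Lemma subsingletons a e y w : w ⊩ ∃ Y, ∀ m, m ∈ Y ⇔
  ∃ x, x ∈ a ∧ ∃ t, t ∈ y ∧ ∀ i, i ∈ m ⇔ i ≐ x ∧ e ∈ t.
Proof.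
apply (image V HV (fun x m => ∃ t, t ∈ y ∧ ∀ i, i ∈ m ⇔ i ≐ x ∧ e ∈ t)); [dfn|].
intros x; imp Hx; apply (image V HV (fun t m => ∀ i, i ∈ m ⇔ i ≐ x ∧ e ∈ t)); [dfn|].
intros t; imp Ht; obtain m Hm from (subsingleton x e t w); obtain s Hs from (singleton V HV m w).
exi s; intros n; apply and_i; imp K.
- apply (equ_subst V HE (fun n => ∀ i, i ∈ n ⇔ i ≐ x ∧ e ∈ t) m); [dfn| |exact Hm].
  exact (equ_sym (iff_l (Hs n) K)).
- apply (iff_r (Hs n)), HX; intros i; apply and_i; imp G;
    [exact (iff_r (Hm i) (iff_l (K i) G)) | exact (iff_r (K i) (iff_l (Hm i) G))].
Qed.

(** Every subset of one is not-not an element of two, so that a set [y]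
    including the double complement of two contains all truth values.  A subset
    [u] of [a] is a multi-valued function from [a] to the sets that are the
    singleton of an element of [a] to the extent of such a truth value, and
    subset collection bounds these functions. *)
Lemma power_of_double_complement w : w ⊩ ∃ x, ∀ y, (∀ z, ¬ ¬ z ∈ x ⇒ z ∈ y) ⇒
  ∀ a, ∃ b, ∀ u, u ∈ b ⇔ ∀ z, z ∈ u ⇒ z ∈ a.
Proof.
have G := (cz_inf V HV w); obtain i0 G' from G; have G := (and_l G'); clear G'.
obtain e He from G; have Ze := (and_r He); clear He i0.
obtain one H1 from (singleton V HV e w); obtain two H2 from (cz_pair V HV e one w).
exi two; intros y; imp H; intros a.
assert (Bd : w ⊩ ∀ z, sub V z one ⇒ z ∈ y).
{ intros z; imp Hz; apply (mp (H z)); imp N; apply (mp N), (iff_r (H2 z)), or_l, HX.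
  intros t; apply and_i; imp Ht; [|exact (bot_e (mp (Ze t) Ht))].
  apply (bot_e (L := L)), (mp N), (iff_r (H2 z)), or_r, HX; intros u; apply and_i; imp Hu.
  - exact (mp (Hz u) Hu).
  - refine (eq_mem_l V HE t u z w _ Ht); apply (eq_trans_ V HE t e u).
    + exact (iff_l (H1 t) (mp (Hz t) Ht)).
    + exact (equ_sym (iff_l (H1 u) Hu)). }
obtain Y HY from (subsingletons a e y w).
obtain c Hc from (cz_subc V HV (fun x s u => ∀ i, i ∈ s ⇔ i ≐ x ∧ x ∈ u) ltac:(dfn) a Y w).
obtain B HB from (cz_coll V HV (fun d v => ∀ x, x ∈ v ⇔ ∃ s, s ∈ d ∧ x ∈ s) ltac:(dfn) c w
  (fun d w' _ _ => cz_union V HV d w')).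
obtain b Hb from (sep_small V HV (fun v => sub V v a) B w ltac:(dfn)
  (fun v w' _ _ => small_sub V HV v a w')).
exi b; intros u; apply and_i; imp K; [exact (and_r (iff_l (Hb u) K))|].
apply (iff_r (Hb u)), and_i; auto.
assert (F : w ⊩ ∀ x, x ∈ a ⇒ ∃ s, s ∈ Y ∧ ∀ i, i ∈ s ⇔ i ≐ x ∧ x ∈ u).
{ intros x; imp Hx.
  (* [t] is the truth value of [x ∈ u] as a subset of one. *)
  obtain t Ht from (sep_small V HV (fun _ => x ∈ u) one w ltac:(dfn)
    (fun _ w' _ _ => small_mem V HV x u w')).
  obtain s Hs from (subsingleton x e t w).
  exi s; apply and_i.
  - apply (iff_r (HY s)); exi x; apply and_i; auto; exi t; apply and_i; auto.
    apply (mp (Bd t)); intros i; imp Hi; exact (and_l (iff_l (Ht i) Hi)).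
  - intros i; apply and_i; imp G.
    + have G' := (iff_l (Hs i) G); apply and_i; [exact (and_l G')|].
      exact (and_r (iff_l (Ht e) (and_r G'))).
    + apply (iff_r (Hs i)), and_i; [exact (and_l G)|].
      apply (iff_r (Ht e)), and_i; [|exact (and_r G)].
      apply (iff_r (H1 e)), (eq_refl_ V HE). }
have G := (mp (Hc u) F); obtain d Hd from G.
have G := (mp (and_l HB d) (and_l Hd)); obtain v Hv from G.
refine (eq_mem_l V HE v u B w _ (and_l Hv)); apply HX; intros i; apply and_i; imp I.
- have G := (iff_l (and_r Hv i) I); obtain s Hs from G.
  have G := (mp (and_r (and_r Hd) s) (and_l Hs)); obtain x Hx from G.
  have G := (iff_l (and_r Hx i) (and_r Hs)).
  exact (eq_mem_l V HE x i u w (equ_sym (and_l G)) (and_r G)).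
- apply (iff_r (and_r Hv i)).
  have G := (mp (and_l (and_r Hd) i) (mp (K i) I)); obtain s Hs from G; exi s; apply and_i.
  + exact (and_l Hs).
  + apply (iff_r (and_r Hs i)), and_i; auto; apply (eq_refl_ V HE).
Qed.

End PowerSet.

(** * Equiconsistency *)

Lemma add_closed p : fv p = 0 -> forall a, add CZF p a -> fv a = 0.
Proof. intros Hp a [Ha| ->]; auto; now apply CZF_closed. Qed.

Section Base.
Variable T : theory.
Hypothesis HT : forall a, T a -> fv a = 0.
Hypothesis HC : forall a, CZF a -> T a.

Lemma base_czf : czf_minus (prv_structure T) /\ extensional (prv_structure T).
Proof.
apply czf_minus_of_axioms; [apply prv_equality|].
intros a Ha r w; now apply axiom_holds; auto.
Qed.

Lemma base_inconsistent w : holds (⊥ : truth (prv_logic T)) w -> prv T w Bot.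
Proof. exact (bot_e (Q := proves T Bot)). Qed.
End Base.

Lemma model_inconsistent {L} (S : structure L) p w : equality S ->
  (forall a, CZF a -> forall r, w ⊩ sem S a r) -> (forall r, w ⊩ sem S p r) ->
  prv (add CZF p) [] Bot -> w ⊩ ⊥.
Proof.
intros HE H1 H2 K; apply (soundness S HE _ _ _ K (fun k => k)); [|easy].
intros a [Ha| ->] r; auto.
Qed.

(** Bisimilarity is applied to a model in which absurdity is that of the theory. *)
Lemma inconsistent_Pow p :
  (forall L (V : structure L), czf_minus V -> extensional V -> has_power V ->
     forall w : world L, exists L' (S : structure L') (w' : world L'), czf_minus S /\
       (forall r, w' ⊩ sem (star S) p r) /\ ((w' ⊩ ⊥) -> w ⊩ ⊥)) ->
  prv (add CZF p) [] Bot -> prv (add CZF Pow) [] Bot.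
Proof.
intros H K.
assert (HT := add_closed Pow eq_refl).
destruct (base_czf _ HT (fun a Ha => or_introl Ha)) as [HV HX].
assert (HP : has_power (prv_structure (add CZF Pow))).
{ intros a w; exact (axiom_holds _ HT Pow (fun k => k) w (or_intror eq_refl) a). }
destruct (H _ _ HV HX HP []) as (L' & S & w' & HS & Hp & Hb).
apply base_inconsistent, Hb; apply (model_inconsistent (star S) p); auto.
- now apply star_equality.
- intros a Ha r; apply axioms_of_czf_minus; auto; [now apply star_czf_minus | now apply star_extensional].
Qed.

Lemma inconsistent_Pow_of_DCom : prv (add CZF DCom) [] Bot -> prv (add CZF Pow) [] Bot.
Proof.
apply inconsistent_Pow; intros L V HV HX HP w.
exists (jlogic V), (jstr V), w; split; [now apply jstr_czf_minus | split].
- intros r; apply star_DCom; [now apply jstr_czf_minus | now apply jstr_stable].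
- intros H; rewrite <- (forget_bot V); exact H.
Qed.

Lemma inconsistent_Pow_of_NDCom : prv (add CZF NDCom) [] Bot -> prv (add CZF Pow) [] Bot.
Proof.
apply inconsistent_Pow; intros L V HV HX HP w.
exists (klogic V), (kstr V HV), (w, 0); split; [now apply kstr_czf_minus | split].
- intros r; now apply kstr_NDCom.
- intros H; rewrite <- (slice_bot V 0); exact H.
Qed.

Lemma inconsistent_DCom_of_Pow : prv (add CZF Pow) [] Bot -> prv (add CZF DCom) [] Bot.
Proof.
intros K; assert (HT := add_closed DCom eq_refl).
destruct (base_czf _ HT (fun a Ha => or_introl Ha)) as [HV HX].
apply base_inconsistent; apply (model_inconsistent (prv_structure _) Pow); auto.
- apply prv_equality.
- intros a Ha r; apply axiom_holds; auto; now left.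
- intros r; obtain x Hx from (power_of_double_complement _ HV HX (nil : list form)).
  have H := (axiom_holds _ HT DCom (fun k => k) w (or_intror eq_refl) x).
  obtain y Hy from H; exact (mp (Hx y) Hy).
Qed.

Theorem proposition3p12 :
  equiconsistent (add CZF DCom) (add CZF Pow) /\
  equiconsistent CZF (add CZF NDCom).
Proof.
split; split; intros H K; apply H; clear H.
- now apply inconsistent_DCom_of_Pow.
- now apply inconsistent_Pow_of_DCom.
- assert (HT : forall a, CZF a -> fv a = 0) by exact CZF_closed.
  destruct (base_czf _ HT (fun a Ha => Ha)) as [HV HX].
  apply base_inconsistent; apply (model_inconsistent (prv_structure _) NDCom); auto.
  + apply prv_equality.
  + intros a Ha r; now apply axiom_holds.
  + intros r; obtain x Hx from (power_of_double_complement _ HV HX (nil : list form)).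
    exi x; intros y; imp Hy.
    apply (model_inconsistent (prv_structure _) Pow); [apply prv_equality| | |].
    * intros a Ha s; now apply axiom_holds.
    * intros s; exact (mp (Hx y) Hy).
    * now apply inconsistent_Pow_of_NDCom.
- assert (HT := add_closed NDCom eq_refl).
  apply base_inconsistent; apply (soundness (prv_structure _) (prv_equality _) _ _ _ K (fun k => k));
    [|easy].
  intros a Ha s; apply axiom_holds; auto; now left.
Qed.
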